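(* Let $\Gamma=\mathbb{Z}^2\rtimes\mathcal{C}_s$ be the group of maps $x\mapsto\sigma x+(c,d)$ of $\mathbb{R}^2$ with $c,d\in\mathbb{Z}$ and $\sigma\in\{\mathrm{id},s\}$, where $s(x,y)=(x,-y)$ (so the reflection axis is parallel to $(1,0)$). Let $(G,m)$ be a $\Gamma$-gain graph and let $(\tilde G,\tilde p)$ be a $\Gamma$-regular framework in $(\mathbb{R}^2,\|\cdot\|_\infty)$ derived from $(G,m)$. Then $(\tilde G,\tilde p)$ is minimally $\Gamma$-symmetrically infinitesimally rigid if and only if $(G,m)$ is $(\mathbb{Z}^2\rtimes\mathcal{C}_s)_q$-tight.
   Context: $\|(a_1,a_2)\|_\infty=\max\{|a_1|,|a_2|\}$. For $(x,y)\in\mathbb{R}^2$ let $\kappa(x,y)=(1,0)$ if $|x|>|y|$, $(0,1)$ if $|x|<|y|$, $(0,0)$ if $|x|=|y|$. For a graph $\tilde G=(\tilde V,\tilde E)$ and $\tilde p:\tilde V\to\mathbb{R}^2$ with distinct endpoints on edges, an infinitesimal motion in $(\mathbb{R}^2,\|\cdot\|_\infty)$ is $u:\tilde V\to\mathbb{R}^2$ with $\kappa(\tilde p(x)-\tilde p(y))\cdot(u(x)-u(y))=0$ for all edges $\{x,y\}$; trivial motions are constant maps. A $\Gamma$-gain graph $(G,m)$ is a finite multigraph $G=(V,E)$ (loops, parallel edges allowed), edges oriented with gains in $\Gamma$, parallel edges of equal orientation having distinct gains and loops non-identity gains; $(v_i,v_j;g)$ is an edge from $v_i$ to $v_j$ with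 gain $g$. Net gain of a walk: product of gains along it (inverse for backward edges); gain space of a subgraph $H$ at $v$: subgroup generated by net gains of closed walks in $H$ at $v$; $H$ is purely periodic if all its gain spaces consist only of translations. Derived graph $\tilde G$: vertices $\gamma v$, edges $\{\gamma v_i,\gamma gv_j\}$ for each edge $(v_i,v_j;g)$, $\gamma\in\Gamma$ (an edge orbit); $p:V\to\mathbb{R}^2$ derives $\tilde p(\gamma v)=\gamma p(v)$ (distinct endpoints on edges required). $\Gamma$-symmetric infinitesimal motion: $u(\gamma x)=\gamma_lu(x)$ ($\gamma_l$ linear part). $\Gamma$-symmetrically infinitesimally rigid: every $\Gamma$-symmetric infinitesimal motion is trivial; minimally: additionally removing any edge orbit destroys this. $\Gamma$-regular: the dimension of the space of $\Gamma$-symmetric infinitesimal motions is minimal among all $\Gamma$-symmetric configurations. $(k,l)$-sparse: every subgraph with $|E'|\ge1$ has $|E'|\le k|V'|-l$; $(k,l)$-tight: also $|E|=k|V|-l$. $(G,m)$ is $(\mathbb{Z}^2\rtimes\mathcal{C}_s)_q$-tight if $G$ is $(2,1)$-tight and every purely periodic subgraph is $(2,2)$-sparse.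
   Formalization: The gain graph is assumed to have at least one vertex, and two distinct oppositely oriented parallel edges (or loops at one vertex) may not have mutually inverse gains, as they would give the same edge orbit; without these conditions the equivalence fails. *)

(* Defs.v *)
From HB Require Import structures.
From mathcomp Require Import all_boot all_order all_algebra.
From mathcomp Require Import reals.

Set Implicit Arguments.
Unset Strict Implicit.
Unset Printing Implicit Defensive.

Import Order.TTheory GRing.Theory Num.Theory.
Local Open Scope ring_scope.

(* The element (c, d, sigma) stands for the map x |-> sigma x + (c, d), where
   sigma is the reflection s(x, y) = (x, - y) if the boolean is true and the
   identity otherwise; [actM] and [act_inj] below show that this is the group
   of these maps under composition. *)
Record Z2Cs := MkZ2Cs { shift1 : int; shift2 : int; reflects : bool }.

Definition Z2Cs_tuple (g : Z2Cs) := (shift1 g, shift2 g, reflects g).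
Definition tuple_Z2Cs (t : int * int * bool) := MkZ2Cs t.1.1 t.1.2 t.2.
Lemma Z2Cs_tupleK : cancel Z2Cs_tuple tuple_Z2Cs. Proof. by case. Qed.
HB.instance Definition _ := Choice.copy Z2Cs (can_type Z2Cs_tupleK).

Definition Z2Cs_one := MkZ2Cs 0 0 false.
Definition Z2Cs_mul (g h : Z2Cs) :=
  MkZ2Cs (shift1 g + shift1 h) (shift2 g + (-1) ^+ reflects g * shift2 h)
         (reflects g (+) reflects h).
Definition Z2Cs_inv (g : Z2Cs) :=
  MkZ2Cs (- shift1 g) (- ((-1) ^+ reflects g * shift2 g)) (reflects g).

Lemma Z2Cs_mulA : associative Z2Cs_mul.
Proof.
move=> [a b s] [c d t] [e f r]; rewrite /Z2Cs_mul /= !addrA addbA.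
by rewrite mulrDr mulrA -signr_addb addrA.
Qed.

Lemma Z2Cs_mul1g : left_id Z2Cs_one Z2Cs_mul.
Proof. by move=> [a b s]; rewrite /Z2Cs_mul /= !add0r expr0 mul1r. Qed.

Lemma Z2Cs_mulg1 : right_id Z2Cs_one Z2Cs_mul.
Proof. by move=> [a b s]; rewrite /Z2Cs_mul /= mulr0 !addr0 addbF. Qed.

Lemma Z2Cs_mulVg : left_inverse Z2Cs_one Z2Cs_inv Z2Cs_mul.
Proof. by move=> [a b s]; rewrite /Z2Cs_mul /= !addNr addbb. Qed.

Lemma Z2Cs_mulgV : right_inverse Z2Cs_one Z2Cs_inv Z2Cs_mul.
Proof.
move=> [a b s]; rewrite /Z2Cs_mul /= subrr mulrN mulrA -signr_addb addbb.
by rewrite expr0 mul1r subrr.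
Qed.

HB.instance Definition _ := isGroup.Build Z2Cs
  Z2Cs_mulA Z2Cs_mul1g Z2Cs_mulg1 Z2Cs_mulVg Z2Cs_mulgV.

Definition is_translation (g : Z2Cs) : Prop := reflects g = false.

Section Plane.
Variable R : realType.

Definition vec2 (a b : R) : 'rV[R]_2 := \row_(i < 2) if i == 0 then a else b.

Definition dot (u v : 'rV[R]_2) : R := \sum_(i < 2) u 0 i * v 0 i.

Definition kappa (v : 'rV[R]_2) : 'rV[R]_2 :=
  if `|v 0 1| < `|v 0 0| then vec2 1 0
  else if `|v 0 0| < `|v 0 1| then vec2 0 1
  else 0.

Definition linear_part (g : Z2Cs) (v : 'rV[R]_2) : 'rV[R]_2 :=
  if reflects g then vec2 (v 0 0) (- v 0 1) else v.

Definition act (g : Z2Cs) (v : 'rV[R]_2) : 'rV[R]_2 :=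
  linear_part g v + vec2 (shift1 g)%:~R (shift2 g)%:~R.

Lemma vec2P (u v : 'rV[R]_2) : u 0 0 = v 0 0 -> u 0 1 = v 0 1 -> u = v.
Proof.
move=> h0 h1; apply/rowP=> -[[|[|//]] hi].
- by rewrite (_ : Ordinal hi = 0) //; apply: val_inj.
- by rewrite (_ : Ordinal hi = 1) //; apply: val_inj.
Qed.

Lemma actM (g h : Z2Cs) (v : 'rV[R]_2) : act (g * h)%g v = act g (act h v).
Proof.
case: g h => [a b s] [c d t].
rewrite /act /linear_part /=; apply: vec2P; case: s; case: t => /=;
  rewrite !mxE /= ?expr0 ?expr1 ?mul1r ?mulN1r ?rmorphD ?rmorphN /=
          ?opprD ?opprK ?[in LHS]addrA //;
  by rewrite ?(addrC a%:~R) ?(addrC b%:~R) ?addrA // -!addrA;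
     congr (_ + _); rewrite addrC.
Qed.

Lemma act_inj (g h : Z2Cs) :
  (forall v : 'rV[R]_2, act g v = act h v) -> g = h.
Proof.
case: g h => [a b s] [c d t] H.
have coord (v : 'rV[R]_2) i := congr1 (fun w : 'rV[R]_2 => w 0 i) (H v).
have := coord 0 0; have := coord 0 1; have := coord (vec2 0 1) 1.
rewrite /act /linear_part /= => h1 h2 h3.
have ebd : b = d.
  apply: (@intr_inj R); move: h2.
  by case: s {h1 h3 H coord}; case: t; rewrite !mxE /= ?oppr0 !add0r.
have eac : a = c.
  apply: (@intr_inj R); move: h3.
  by case: s {h1 h2 H coord}; case: t; rewrite !mxE /= ?oppr0 !add0r.
have neq : (1 : R) <> -1.
  by move/eqP; rewrite -subr_eq0 opprK -mulr2n pnatr_eq0.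
subst; congr MkZ2Cs; move: h1.
by case: s {h2 h3 H coord}; case: t => //; rewrite !mxE /= => /addIr // /esym.
Qed.

End Plane.

(* The orientation of an edge is only a reference: an edge (v, w; g) is the same
   as (w, v; g^-1). Hence [parallel_gain] together with [antiparallel_gain] say
   that parallel edges, once equally oriented, have distinct gains. *)
Record gain_graph := GainGraph {
  vertex : finType;
  edge : finType;
  src : edge -> vertex;
  tgt : edge -> vertex;
  gain : edge -> Z2Cs;
  vertex_gt0 : (0 < #|vertex|)%N;
  loop_gain : forall e, src e = tgt e -> gain e <> 1%g;
  parallel_gain : forall e f, e <> f ->
    src e = src f -> tgt e = tgt f -> gain e <> gain f;
  antiparallel_gain : forall e f, e <> f ->
    src e = tgt f -> tgt e = src f -> gain e <> (gain f)^-1%g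
}.

Section Sparsity.
Variable G : gain_graph.
Implicit Types (V : {set vertex G}) (E : {set edge G}).

Definition is_subgraph V E : Prop :=
  forall e, e \in E -> src e \in V /\ tgt e \in V.

(* [(e, true)] traverses [e] forward, [(e, false)] backward. *)
Definition step : Type := (edge G * bool)%type.
Definition step_src (x : step) := if x.2 then src x.1 else tgt x.1.
Definition step_tgt (x : step) := if x.2 then tgt x.1 else src x.1.
Definition step_gain (x : step) : Z2Cs :=
  if x.2 then gain x.1 else (gain x.1)^-1%g.

Fixpoint is_walk E (v : vertex G) (s : seq step) (w : vertex G) : Prop :=
  if s is x :: s' then
    [/\ x.1 \in E, step_src x = v & is_walk E (step_tgt x) s' w]
  else v = w.

Fixpoint net_gain (s : seq step) : Z2Cs :=
  if s is x :: s' then (step_gain x * net_gain s')%g else 1%g.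

Inductive generated (A : Z2Cs -> Prop) : Z2Cs -> Prop :=
| gen_base g of A g : generated A g
| gen_one : generated A 1%g
| gen_mul g h of generated A g & generated A h : generated A (g * h)%g
| gen_inv g of generated A g : generated A (g^-1)%g.

Definition gain_space E (v : vertex G) : Z2Cs -> Prop :=
  generated (fun g => exists2 s, is_walk E v s v & net_gain s = g).

Definition purely_periodic V E : Prop :=
  forall v, v \in V -> forall g, gain_space E v g -> is_translation g.

Definition sparse (k l : int) V E : Prop :=
  forall (V' : {set vertex G}) (E' : {set edge G}),
    is_subgraph V' E' -> V' \subset V -> E' \subset E ->
    (1 <= #|E'|)%N -> (#|E'|%:Z <= k * #|V'|%:Z - l)%R.

Definition tight (k l : int) V E : Prop :=
  sparse k l V E /\ #|E|%:Z = k * #|V|%:Z - l.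

Definition Z2Cs_q_tight : Prop :=
  tight 2 1 [set: vertex G] [set: edge G] /\
  forall V E, is_subgraph V E -> purely_periodic V E -> sparse 2 2 V E.

End Sparsity.

Section Frameworks.
Variables (R : realType) (G : gain_graph).

(* The pair (gamma, v) is the vertex "gamma v" of the derived graph. *)
Definition dvertex : Type := (Z2Cs * vertex G)%type.

Definition dact (g : Z2Cs) (x : dvertex) : dvertex := ((g * x.1)%g, x.2).

Definition edge_orbit (e : edge G) (x y : dvertex) : Prop :=
  exists g : Z2Cs,
    (x = (g, src e) /\ y = ((g * gain e)%g, tgt e)) \/
    (y = (g, src e) /\ x = ((g * gain e)%g, tgt e)).

Definition dedge (x y : dvertex) : Prop := exists e, edge_orbit e x y.

Definition dedge_minus (e : edge G) (x y : dvertex) : Prop :=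
  dedge x y /\ ~ edge_orbit e x y.

Definition dposition (p : vertex G -> 'rV[R]_2) (x : dvertex) : 'rV[R]_2 :=
  act x.1 (p x.2).

Definition configuration (p : vertex G -> 'rV[R]_2) : Prop :=
  forall x y, dedge x y -> dposition p x <> dposition p y.

Definition inf_motion (T : Type) (adj : T -> T -> Prop) (q u : T -> 'rV[R]_2) :
    Prop :=
  forall x y, adj x y -> dot (kappa (q x - q y)) (u x - u y) = 0.

Definition trivial_motion (T : Type) (u : T -> 'rV[R]_2) : Prop :=
  exists a, forall x, u x = a.

Definition sym_map (u : dvertex -> 'rV[R]_2) : Prop :=
  forall g x, u (dact g x) = linear_part g (u x).

Definition sym_inf_motion (adj : dvertex -> dvertex -> Prop)
    (p : vertex G -> 'rV[R]_2) (u : dvertex -> 'rV[R]_2) : Prop :=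
  inf_motion adj (dposition p) u /\ sym_map u.

Definition sym_inf_rigid (adj : dvertex -> dvertex -> Prop)
    (p : vertex G -> 'rV[R]_2) : Prop :=
  forall u, sym_inf_motion adj p u -> trivial_motion u.

Definition min_sym_inf_rigid (p : vertex G -> 'rV[R]_2) : Prop :=
  sym_inf_rigid dedge p /\ forall e, ~ sym_inf_rigid (dedge_minus e) p.

(* The space [U] of maps, closed under linear combinations, has a basis with
   [n] elements. *)
Definition has_dim (T : Type) (U : (T -> 'rV[R]_2) -> Prop) (n : nat) : Prop :=
  exists b : 'I_n -> T -> 'rV[R]_2,
    [/\ forall i, U (b i),
        forall c : 'I_n -> R,
          (forall x, \sum_i c i *: b i x = 0) -> forall i, c i = 0
      & forall u, U u ->
          exists c : 'I_n -> R, forall x, u x = \sum_i c i *: b i x].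

Definition regular (p : vertex G -> 'rV[R]_2) : Prop :=
  configuration p /\
  exists2 n, has_dim (sym_inf_motion dedge p) n &
    forall p' n', configuration p' -> has_dim (sym_inf_motion dedge p') n' ->
      (n <= n')%N.

End Frameworks.

(* Main.v *)
From HB Require Import structures.
Require Import Defs.
From mathcomp Require Import all_boot all_order all_algebra.
From mathcomp Require Import reals boolp zify lra ring.

(* A symmetric motion is a pair of functions on the vertices of G, one for each
   coordinate. An edge whose difference vector is dominated by its first
   coordinate says that the first function agrees on its ends; an edge dominated
   by the second one says that the second function agrees up to the sign of its
   gain. So a framework is minimally rigid iff the first class of edges is a
   basis of the graphic matroid and the second one a basis of the signed graphic
   matroid of G, and counting dimensions gives the necessity of the counts.

   Conversely, matroid partition turns the counts into a colouring of the edges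
   with both classes independent, and it remains to find positions whose classes
   are independent. This is an induction on the gain graph. A vertex with at
   most three edge ends exists. A vertex q joined to n1, n2, n3 can always be
   placed so that it sees n1 and n2 in different cones and n3 in a prescribed
   one; this extends a realization of the rest as soon as the three edges are
   not blocked by a dependency, which is ensured by adding to the rest a chord
   between two neighbours. If no chord can be added, the vertex lies in a K4
   with trivial gains, hence in a piece H spanned by both classes through
   trivial gains; H is contracted, realized separately, and inserted at an
   infinitesimal scale. When H spans all vertices, an additional edge is made
   to belong to the second class by a large translation along the second axis
   in the switched frame. *)

Set Implicit Arguments.
Unset Strict Implicit.
Unset Printing Implicit Defensive.

Import Order.TTheory GRing.Theory Num.Theory.
Local Open Scope ring_scope.

(** * Linear matroids and matroid partition *)

(** The classes of the realized framework need not be those of the given colouring. The induction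
    only carries the existence of some colouring with independent classes, as a certificate of
    sparsity, and this freedom makes a vertex of degree three removable, since the chord may come
    back in either class. The obstacle is simplicity: two edges with the same ends and the same gain
    have the same difference vector, so they always fall in the same class, whereas independence
    alone would allow one copy in each. Chords and contractions can create such pairs, and the
    exceptional cases answer this: chords that are already present lead to a K4, and a doubled edge
    in a quotient enlarges the contracted piece by one vertex. The count 2|V| - 1 = (|V| - 1) + |V|
    is a sum of two ranks: constants solve every constraint of the first class, while a reflecting
    closed walk removes the corresponding solution of the second. Regularity is used only at the
    end: the translation along (1, 0) is a motion of every framework, so a single rigid realization
    shows that the minimal dimension is 1. *)

Section Families.
Variables (F : fieldType) (U : vectType F) (I : finType).
Implicit Types (phi : I -> U) (A B : {set I}) (i : I) (x : U).

Definition sp phi A : {vspace U} := (\sum_(i in A) <[phi i]>)%VS.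

Definition indep phi A : bool := \dim (sp phi A) == #|A|.

Lemma mem_sp phi A i : i \in A -> phi i \in sp phi A.
Proof. by move=> iA; rewrite memvE; apply: (sumv_sup i). Qed.

Lemma sp_subP phi A (W : {vspace U}) :
  reflect {in A, forall i, phi i \in W} (sp phi A <= W)%VS.
Proof. by apply: (iffP subv_sumP) => h i /h; rewrite memvE. Qed.

Lemma spS phi A B : A \subset B -> (sp phi A <= sp phi B)%VS.
Proof. by move=> /subsetP AB; apply/sp_subP => i /AB; apply: mem_sp. Qed.

Lemma spU phi A B : sp phi (A :|: B) = (sp phi A + sp phi B)%VS.
Proof.
apply/eqP; rewrite eqEsubv subv_add !spS ?subsetUl ?subsetUr // !andbT.
apply/sp_subP => i; rewrite inE => /orP[] /(mem_sp phi).
- exact/subvP/addvSl.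
- exact/subvP/addvSr.
Qed.

Lemma sp0 phi : sp phi set0 = 0%VS.
Proof. by rewrite /sp big_set0. Qed.

Lemma sp1 phi i : sp phi [set i] = <[phi i]>%VS.
Proof. by rewrite /sp big_set1. Qed.

Lemma spU1 phi A i : sp phi (i |: A) = (<[phi i]> + sp phi A)%VS.
Proof. by rewrite spU sp1. Qed.

Lemma eq_sp phi psi A : {in A, forall i, <[phi i]>%VS = <[psi i]>%VS} ->
  sp phi A = sp psi A.
Proof. by move=> h; apply: eq_bigr => i iA; rewrite h. Qed.

Lemma dimv_add_line x (W : {vspace U}) :
  \dim (<[x]> + W) = ((x \notin W) + \dim W)%N.
Proof.
case: (boolP (x \in W)) => [xW|xW] /=.
  by congr (\dim _); apply/addv_idPr; rewrite -memvE.
rewrite dimv_disjoint_sum.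
  by rewrite dim_vline; case: eqP xW => // ->; rewrite mem0v.
apply/eqP; rewrite -subv0; apply/subvP => y; rewrite memv_cap.
case/andP=> /vlineP[k ->] kxW; rewrite memv0; case: (eqVneq k 0) kxW => [->|k0].
  by rewrite scale0r.
by rewrite rpredZeq (negPf k0) (negPf xW).
Qed.

Lemma dim_sp_le phi A : (\dim (sp phi A) <= #|A|)%N.
Proof.
elim: {A}#|A| {-2}A (erefl #|A|) => [|n IH] A cA.
  by rewrite (cards0_eq cA) sp0 dimv0.
have [i iA] : exists i, i \in A by apply/card_gt0P; rewrite cA.
have cAi : #|A :\ i| = n by move: (cardsD1 i A); rewrite iA cA => -[].
rewrite (cardsD1 i A) iA -{1}(setD1K iA) spU1 dimv_add_line.
by apply: leq_add (leq_b1 _) _; apply: IH.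
Qed.

Lemma indep0 phi : indep phi set0.
Proof. by rewrite /indep sp0 dimv0 cards0. Qed.

Lemma indepU1 phi A i : i \notin A ->
  indep phi (i |: A) = indep phi A && (phi i \notin sp phi A).
Proof.
move=> iA; rewrite /indep spU1 dimv_add_line cardsU1 iA.
have := dim_sp_le phi A; case: (phi i \in _) => /= h.
  by rewrite andbF; apply/eqP; lia.
by rewrite andbT eqn_add2l.
Qed.

Lemma indep_sub phi A B : A \subset B -> indep phi B -> indep phi A.
Proof.
move=> AB /eqP hB; rewrite /indep eqn_leq dim_sp_le /=.
have eB : A :|: (B :\: A) = B by rewrite -{1}(setIidPr AB) setID.
have := cardsID A B; rewrite (setIidPr AB) => cB.
have := (dimv_add_leqif (sp phi A) (sp phi (B :\: A))).1.
rewrite -spU eB hB; have := dim_sp_le phi (B :\: A); lia.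
Qed.

Lemma indep_notin phi A i : indep phi A -> i \in A ->
  phi i \notin sp phi (A :\ i).
Proof. by move=> + iA; rewrite -(setD1K iA) indepU1 ?setD11 // setU1K ?setD11 // => /andP[]. Qed.

Lemma indep_neq0 phi A i : indep phi A -> i \in A -> phi i != 0.
Proof.
by move=> h iA; apply: contraNneq (indep_notin h iA) => ->; rewrite mem0v.
Qed.

Lemma eq_indep phi psi A : {in A, forall i, <[phi i]>%VS = <[psi i]>%VS} ->
  indep phi A = indep psi A.
Proof. by move=> h; rewrite /indep (eq_sp h). Qed.

Lemma indepU phi A B : [disjoint A & B] -> indep phi A -> indep phi B ->
  (sp phi A :&: sp phi B = 0)%VS -> indep phi (A :|: B).
Proof.
move=> dAB /eqP hA /eqP hB h0; rewrite /indep spU dimv_disjoint_sum // hA hB.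
by rewrite cardsU disjoint_setI0 // cards0 subn0.
Qed.

Lemma sp_img phi A (W : vectType F) (f : 'Hom(U, W)) :
  (f @: sp phi A = (\sum_(i in A) <[f (phi i)]>))%VS.
Proof. by rewrite /sp limg_sum; apply: eq_bigr => i _; rewrite limg_line. Qed.
End Families.

Section Partition.
Variable I : finType.
Implicit Types (A B : {set I}) (r : {set I} -> nat).

Definition rank_function r : Prop :=
  [/\ r set0 = 0%N, forall A B, A \subset B -> (r A <= r B)%N,
      forall A i, (r (i |: A) <= (r A).+1)%N &
      forall A B, (r (A :|: B) + r (A :&: B) <= r A + r B)%N].

(** Contraction of a matroid by a non-loop; since [i] has rank 1, the predecessor never
    truncates. *)
Lemma rank_function_contract r i : rank_function r -> r [set i] = 1%N ->
  rank_function (fun A => (r (i |: A)).-1).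
Proof.
move=> [r0 rS rU rM] ri.
have pos A : (0 < r (i |: A))%N by rewrite -ri rS // sub1set setU11.
split=> [|A B AB|A j|A B].
- by rewrite setU0 ri.
- by have := rS _ _ (setUS [set i] AB); lia.
- by have := rU (i |: A) j; rewrite setUCA; have := pos A; lia.
- have := rM (i |: A) (i |: B); rewrite -setUIr -setUUr.
  by move: (pos A) (pos B) (pos (A :|: B)) (pos (A :&: B)); lia.
Qed.

Lemma rank_function_sp (F : fieldType) (U : vectType F) (phi : I -> U) :
  rank_function (fun A => \dim (sp phi A)).
Proof.
split=> [|A B AB|A i|A B].
- by rewrite sp0 dimv0.
- exact/dimvS/spS.
- by rewrite spU1 dimv_add_line; case: (_ \notin _).
- rewrite spU -(dimv_sum_cap (sp phi A)) leq_add2l; apply: dimvS.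
  by rewrite subv_cap !spS ?subsetIl ?subsetIr.
Qed.

(* Edmonds' matroid partition theorem for two matroids. If an element [i] can
   go to neither class, there are tight witnesses [A] and [B] for the two
   failures, and submodularity applied to [A] and [B] is contradictory. *)
Lemma matroid_partition r1 r2 A : rank_function r1 -> rank_function r2 ->
  (forall B : {set I}, B \subset A -> #|B| <= r1 B + r2 B)%N ->
  exists2 B : {set I}, B \subset A & (r1 B = #|B| /\ r2 (A :\: B) = #|A :\: B|)%N.
Proof.
elim: {A}_.+1 {-2}A r1 r2 (ltnSn #|A|) => // n IH A r1 r2 /ltnSE An h1 h2 hA.
have [A0|[i iA]] := set_0Vmem A.
  by exists set0; rewrite ?sub0set // A0 setD0 cards0; case: h1 h2 => -> _ _ _ [].
have Ai : (#|A :\ i| < n)%N by rewrite (cardsD1 i A) iA in An.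
(* [bad s1 s2]: giving [i] to the class of [s1], that is contracting it there, breaks the counting
   hypothesis on [B]. If [i] is a loop of [s1], the empty set is such a [B]. *)
pose bad (s1 s2 : {set I} -> nat) := exists2 B : {set I}, B \subset A :\ i &
  (s1 (i |: B) + s2 B <= #|B|)%N.
have step s1 s2 : rank_function s1 -> rank_function s2 ->
    (forall B : {set I}, B \subset A -> #|B| <= s1 B + s2 B)%N -> bad s1 s2 \/
    exists2 B : {set I}, B \subset A & (s1 B = #|B| /\ s2 (A :\: B) = #|A :\: B|)%N.
  move=> g1 g2 gA; have [g10 g1S g1U _] := g1; have [g20 _ _ _] := g2.
  have [e0|e1] : s1 [set i] = 0%N \/ s1 [set i] = 1%N.
    by have := g1U set0 i; rewrite setU0 g10; lia.
    left; exists set0; first exact: sub0set.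
    by rewrite setU0 e0 g20.
  have [|nb] := pselect (bad s1 s2); first by left.
  right; have [|B BA [B1 B2]] := IH _ _ _ Ai (rank_function_contract g1 e1) g2.
    move=> B BA; rewrite leqNgt; apply/negP => lt; apply: nb; exists B => //.
    have : (0 < s1 (i |: B))%N by rewrite -e1 g1S // sub1set setU11.
    by lia.
  have iB : i \notin B by apply/negP => /(subsetP BA); rewrite setD11.
  exists (i |: B).
    by rewrite subUset sub1set iA (subset_trans BA) // subD1set.
  split; last by rewrite -setDDl.
  have : (0 < s1 (i |: B))%N by rewrite -e1 g1S // sub1set setU11.
  by rewrite cardsU1 iB; lia.
have [[B BA hB]|//] := step _ _ h1 h2 hA.
have hA' (C : {set I}) : C \subset A -> (#|C| <= r2 C + r1 C)%N.
  by move=> /hA; rewrite addnC.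
have [[C CA hC]|[C CA [C1 C2]]] := step _ _ h2 h1 hA'; last first.
  exists (A :\: C); first exact: subsetDl.
  by rewrite setDDr setDv set0U (setIidPr CA).
exfalso; have [_ _ _ M1] := h1; have [_ _ _ M2] := h2.
have iB : i \notin B by apply/negP => /(subsetP BA); rewrite setD11.
have iC : i \notin C by apply/negP => /(subsetP CA); rewrite setD11.
have BC : i \notin B :|: C by rewrite inE negb_or iB.
have e1 : (i |: B) :&: C = B :&: C.
  by rewrite setIUl (_ : [set i] :&: C = set0) ?set0U //; apply/setP => j;
    rewrite !inE; case: eqP => // ->; rewrite (negPf iC).
have e2 : B :&: (i |: C) = B :&: C.
  by rewrite setIUr (_ : B :&: [set i] = set0) ?set0U //; apply/setP => j;
    rewrite !inE andbC; case: eqP => // ->; rewrite (negPf iB).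
(* The counting hypothesis on [i |: (B :|: C)] and on [B :&: C], with submodularity and both
   witnesses, gives |B| + |C| + 1 <= |B| + |C|. *)
have := M1 (i |: B) C; have := M2 B (i |: C).
rewrite e1 e2 -setUA setUCA.
have : (#|i |: (B :|: C)| <= r1 (i |: (B :|: C)) + r2 (i |: (B :|: C)))%N.
  apply: hA; rewrite !subUset sub1set iA /=.
  by rewrite !(subset_trans _ (subD1set A i)).
have : (#|B :&: C| <= r1 (B :&: C) + r2 (B :&: C))%N.
  by apply: hA; rewrite subIset // (subset_trans BA (subD1set A i)).
rewrite cardsU1 BC; have := cardsUI B C; move: hB hC; lia.
Qed.
End Partition.

(** * Dominant coordinates *)

Section Dominance.
Variable R : realType.
Implicit Types (g h : Z2Cs) (u v w : 'rV[R]_2) (c : bool) (t : R).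

(* Classes of edges are encoded by a boolean, [false] for the direction (1, 0)
   and [true] for the direction (0, 1); only the latter sees the reflection. *)
Definition sg c g : R := if c && reflects g then -1 else 1.

Lemma sg_false g : sg false g = 1. Proof. by []. Qed.

Lemma sg1 c : sg c 1%g = 1. Proof. by rewrite /sg andbF. Qed.

Lemma sgM c g h : sg c (g * h)%g = sg c g * sg c h.
Proof.
case: g h => [a b s] [a' b' s']; rewrite /sg /=.
by case: c; case: s; case: s' => /=; rewrite ?mulr1 ?mulrNN ?mulr1 ?mul1r.
Qed.

Lemma sg_sqr c g : sg c g * sg c g = 1.
Proof. by rewrite /sg; case: ifP; rewrite ?mulrNN mulr1. Qed.

Lemma sgV c g : sg c g^-1%g = sg c g.
Proof. by case: g => [a b s]. Qed.

Lemma sg_neq0 c g : sg c g != 0.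
Proof. by rewrite /sg; case: ifP; rewrite ?oppr_eq0 oner_eq0. Qed.

Lemma act0E g v : act g v 0 0 = v 0 0 + (shift1 g)%:~R.
Proof. by rewrite /act /linear_part; case: ifP; rewrite !mxE. Qed.

Lemma act1E g v : act g v 0 1 = sg true g * v 0 1 + (shift2 g)%:~R.
Proof.
by rewrite /act /linear_part /sg /=; case: ifP; rewrite !mxE /= ?mul1r ?mulN1r.
Qed.

Lemma linear0E g v : linear_part g v 0 0 = v 0 0.
Proof. by rewrite /linear_part; case: ifP; rewrite ?mxE. Qed.

Lemma linear1E g v : linear_part g v 0 1 = sg true g * v 0 1.
Proof. by rewrite /linear_part /sg /=; case: ifP; rewrite ?mxE ?mulN1r ?mul1r. Qed.

Lemma coordB u v i : (u - v) 0 i = u 0 i - v 0 i.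
Proof. by rewrite !mxE. Qed.

Lemma actB g u v : act g u - act g v = linear_part g (u - v).
Proof.
by apply: vec2P; rewrite ?linear0E ?linear1E !coordB ?act0E ?act1E; ring.
Qed.

Lemma act1 v : act 1%g v = v.
Proof. by apply: vec2P; rewrite ?act0E ?act1E ?sg1 ?mul1r addr0. Qed.

Lemma actK g v : act g^-1%g (act g v) = v.
Proof. by rewrite -actM mulVg act1. Qed.

Lemma actKV g v : act g (act g^-1%g v) = v.
Proof. by rewrite -actM mulgV act1. Qed.

Definition seg t u v : 'rV[R]_2 := (1 - t) *: u + t *: v.

Lemma segE t u v i : seg t u v 0 i = (1 - t) * u 0 i + t * v 0 i.
Proof. by rewrite !mxE. Qed.

Lemma act_seg g t u v : act g (seg t u v) = seg t (act g u) (act g v).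
Proof. by apply: vec2P; rewrite ?segE !(act0E, act1E) segE; ring. Qed.

Lemma segB t u v u' v' : seg t u v - seg t u' v' = seg t (u - u') (v - v').
Proof. by rewrite /seg !scalerBr opprD addrACA. Qed.

(** Nonvanishing of [kappa v]: an edge whose difference is not strict imposes no constraint. *)
Definition strict v : bool := `|v 0 0| != `|v 0 1|.
Definition ydom v : bool := `|v 0 0| < `|v 0 1|.

Lemma strictN v : strict (- v) = strict v.
Proof. by rewrite /strict !mxE !normrN. Qed.
Lemma ydomN v : ydom (- v) = ydom v.
Proof. by rewrite /ydom !mxE !normrN. Qed.

Lemma strict_linear g v : strict (linear_part g v) = strict v.
Proof. by rewrite /strict /linear_part; case: ifP => //; rewrite !mxE /= normrN. Qed.
Lemma ydom_linear g v : ydom (linear_part g v) = ydom v.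
Proof. by rewrite /ydom /linear_part; case: ifP => //; rewrite !mxE /= normrN. Qed.

Lemma strictZ t v : t != 0 -> strict (t *: v) = strict v.
Proof.
by move=> t0; rewrite /strict !mxE !normrM -subr_eq0 -mulrBr mulf_eq0 normr_eq0
  (negPf t0) subr_eq0.
Qed.
Lemma ydomZ t v : t != 0 -> ydom (t *: v) = ydom v.
Proof. by move=> t0; rewrite /ydom !mxE !normrM ltr_pM2l // normr_gt0. Qed.

Lemma strict_neq0 v : strict v -> v != 0.
Proof. by apply: contraTneq => ->; rewrite /strict !mxE eqxx. Qed.

(** The cones are the sign regions of x^2 - y^2, a product in the rotated coordinates used by
    [strip]. *)
Lemma ydom_mul v : ydom v = ((v 0 0 - v 0 1) * (v 0 0 + v 0 1) < 0).
Proof.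
by rewrite /ydom -subr_sqr subr_lt0 -(real_normK (num_real (v 0 0)))
  -(real_normK (num_real (v 0 1))) ltr_pXn2r ?nnegrE.
Qed.
Lemma strict_mul v : strict v = ((v 0 0 - v 0 1) * (v 0 0 + v 0 1) != 0).
Proof.
by rewrite /strict -subr_sqr subr_eq0 -(real_normK (num_real (v 0 0)))
  -(real_normK (num_real (v 0 1))) eqrXn2.
Qed.

(** Germs at 0 from the right. Finitely many open conditions can be met together, which replaces
    genericity arguments. *)
Definition small (P : R -> Prop) : Prop :=
  exists2 e, 0 < e & forall t, 0 < t -> t < e -> P t.

Lemma small_and P Q : small P -> small Q -> small (fun t => P t /\ Q t).
Proof.
move=> [e e0 eP] [f f0 fQ]; exists (Num.min e f); first by rewrite lt_min e0.
by move=> t t0; rewrite lt_min => /andP[/(eP _ t0) ? /(fQ _ t0) ?].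
Qed.

Lemma small_all (I : finType) (A : {set I}) (P : I -> R -> Prop) :
  {in A, forall i, small (P i)} -> small (fun t => {in A, forall i, P i t}).
Proof.
move=> h; suff : forall s : seq I, {subset s <= A} ->
    small (fun t => forall i, i \in s -> P i t).
  case/(_ (enum A)) => [i|e e0 eP]; first by rewrite mem_enum.
  by exists e => // t t0 te i iA; apply: eP => //; rewrite mem_enum.
elim=> [|i s IH] sA; first by exists 1.
have [e e0 eP] : small (P i) by apply/h/sA; rewrite mem_head.
have [|f f0 fP] := IH; first by move=> j js; apply: sA; rewrite inE js orbT.
exists (Num.min e f); first by rewrite lt_min e0.
move=> t t0; rewrite lt_min => /andP[te tf] j.
by rewrite inE => /orP[/eqP -> |]; [apply: eP | apply: fP].
Qed.

Lemma smallW (P Q : R -> Prop) : (forall t, 0 < t -> P t -> Q t) -> small P -> small Q.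
Proof. by move=> PQ [e e0 eP]; exists e => // t t0 te; apply/PQ/eP. Qed.

Lemma small_ex P : small P -> exists2 t, 0 < t & P t.
Proof.
by case=> e e0 eP; exists (e / 2); [|apply: eP]; rewrite ?divr_gt0 // ltr_pdivrMr // mulr_natr mulr2n ltrDr.
Qed.

Lemma small_lt_seg (a b a' b' : R) : a < b ->
  small (fun t => (1 - t) * a + t * a' < (1 - t) * b + t * b').
Proof.
move=> ab; set M := `|a' - a| + `|b' - b| + 1.
have M0 : 0 < M by rewrite ltr_wpDl // addr_ge0.
exists ((b - a) / M); first by rewrite divr_gt0 // subr_gt0.
move=> t t0; rewrite ltr_pdivlMr // => tM.
have h1 := ler_norm (a' - a); have h2 := ler_norm (- (b' - b)); rewrite normrN in h2.
have : t * ((a' - a) - (b' - b)) <= t * M by rewrite ler_pM2l // /M; lra.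
by lra.
Qed.

Lemma small_strict u v : strict u ->
  small (fun t => strict (seg t u v) /\ ydom (seg t u v) = ydom u).
Proof.
have aux (a b a' b' : R) : `|a| < `|b| ->
    small (fun t => `|(1 - t) * a + t * a'| < `|(1 - t) * b + t * b'|).
  move=> ab; set M := `|a'| + `|b'| + `|a| + `|b| + 1.
  have M0 : 0 < M by rewrite /M ltr_wpDl // !addr_ge0.
  exists ((`|b| - `|a|) / M); first by rewrite divr_gt0 // subr_gt0.
  move=> t t0; rewrite ltr_pdivlMr // => tM.
  have h1 : `|(1 - t) * a + t * a'| <= `|a| + t * (`|a| + `|a'|).
    have -> : (1 - t) * a + t * a' = a + t * (a' - a) by ring.
    apply: le_trans (ler_normD _ _) _; rewrite lerD2l normrM (gtr0_norm t0) ler_pM2l //.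
    by rewrite [leRHS]addrC; apply: ler_normB.
  have h2 : `|b| <= `|(1 - t) * b + t * b'| + t * (`|b| + `|b'|).
    have {1}-> : b = ((1 - t) * b + t * b') + t * (b - b') by ring.
    apply: le_trans (ler_normD _ _) _; rewrite lerD2l normrM (gtr0_norm t0) ler_pM2l //.
    exact: ler_normB.
  have : t * M = t * (`|a| + `|a'|) + t * (`|b| + `|b'|) + t by rewrite /M; ring.
  by lra.
rewrite /strict neq_lt => /orP[] uv.
  apply: smallW (aux _ _ (v 0 0) (v 0 1) uv) => t _ h.
  by rewrite /ydom !segE h uv lt_eqF.
apply: smallW (aux _ _ (v 0 1) (v 0 0) uv) => t _ h.
by rewrite /ydom !segE gt_eqF // !ltNge !ltW.
Qed.

Lemma small_neq0 u v : u != 0 -> small (fun t => seg t u v != 0).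
Proof.
move=> u0; have [i ui] : exists i, u 0 i != 0.
  by apply/existsP; apply: contraNT u0 => /existsPn h; apply/eqP/rowP => i;
    rewrite mxE; apply/eqP; move: (h i); rewrite negbK.
suff: small (fun t => (1 - t) * u 0 i + t * v 0 i != 0).
  by apply: smallW => t _; apply: contraNneq => /rowP/(_ i); rewrite segE mxE => ->.
move: ui; rewrite neq_lt => /orP[] ui.
  apply: smallW (small_lt_seg (v 0 i) 0 ui) => t _.
  by rewrite !mulr0 addr0 => /lt_eqF ->.
apply: smallW (small_lt_seg 0 (v 0 i) ui) => t _.
by rewrite !mulr0 addr0 => /gt_eqF ->.
Qed.

Lemma small_neq0_line v : v != 0 -> small (fun t => seg t 0 v != 0).
Proof.
move=> v0; exists 1 => // t t0 _.
by rewrite /seg scaler0 add0r scaler_eq0 (negPf v0) orbF gt_eqF.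
Qed.

(* In the coordinates z = x - y, w = x + y the two cones at a point are pairs
   of opposite quadrants. If z separates n1 from n2 and w is huge, then q sees
   n1 and n2 in different cones, and replacing w by - w swaps all cones. *)
Lemma strip n1 n2 n3 c : n1 != n2 -> exists q,
  [/\ strict (q - n1), strict (q - n2), strict (q - n3),
      ydom (q - n1) = ~~ ydom (q - n2) & ydom (q - n3) = c].
Proof.
have main (z1 z2 z3 w1 w2 w3 : R) : z1 < z2 -> exists z w : R,
   [/\ (z - z1) * (w - w1) != 0, (z - z2) * (w - w2) != 0,
       (z - z3) * (w - w3) != 0,
       ((z - z1) * (w - w1) < 0) = ~~ ((z - z2) * (w - w2) < 0) &
       ((z - z3) * (w - w3) < 0) = c].
  move=> z12; have [z [h1 h2 h3]] : exists z, [/\ z1 < z, z < z2 & z != z3].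
    have [e|e] := eqVneq ((z1 + z2) / 2) z3.
      by exists ((z1 + ((z1 + z2) / 2)) / 2); split; lra.
    by exists ((z1 + z2) / 2); split=> //; lra.
  (* [N] exceeds the absolute values of w1, w2 and w3, so for w = N or w = - N the three factors in
     w have the same sign. *)
  pose N := `|w1| + `|w2| + `|w3| + 1.
  have b1 := ler_norm w1; have b2 := ler_norm w2; have b3 := ler_norm w3.
  have b1' := ler_norm (- w1); have b2' := ler_norm (- w2).
  have b3' := ler_norm (- w3); rewrite !normrN in b1' b2' b3'.
  have c1 := normr_ge0 w1; have c2 := normr_ge0 w2; have c3 := normr_ge0 w3.
  have := h3; rewrite neq_lt => hz.
  have pz1 : 0 < z - z1 by lra.
  have nz2 : z - z2 < 0 by lra.
  have [up|dn] : (z < z3) = c \/ (z < z3) = ~~ c by case: (z < z3) (c) => -[]; tauto.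
    exists z, N; have p1 : 0 < N - w1 by rewrite /N; lra.
    have p2 : 0 < N - w2 by rewrite /N; lra.
    have p3 : 0 < N - w3 by rewrite /N; lra.
    split.
    - by rewrite mulf_neq0 ?gt_eqF.
    - by rewrite mulf_neq0 ?(gt_eqF p2) ?(lt_eqF nz2).
    - by rewrite mulf_neq0 ?(gt_eqF p3) // subr_eq0.
    - by rewrite !pmulr_llt0 // nz2 ltNge ltW.
    - by rewrite pmulr_llt0 // subr_lt0.
  exists z, (- N); have p1 : - N - w1 < 0 by rewrite /N; lra.
  have p2 : - N - w2 < 0 by rewrite /N; lra.
  have p3 : - N - w3 < 0 by rewrite /N; lra.
  split.
  - by rewrite mulf_neq0 ?(gt_eqF pz1) ?(lt_eqF p1).
  - by rewrite mulf_neq0 ?(lt_eqF p2) ?(lt_eqF nz2).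
  - by rewrite mulf_neq0 ?(lt_eqF p3) // subr_eq0.
  - by rewrite !nmulr_llt0 // pz1 -leNgt ltW.
  - by rewrite nmulr_llt0 // subr_gt0 ltNge le_eqVlt (negPf h3) dn negbK.
have main' (z1 z2 z3 w1 w2 w3 : R) : z1 != z2 -> exists z w : R,
   [/\ (z - z1) * (w - w1) != 0, (z - z2) * (w - w2) != 0,
       (z - z3) * (w - w3) != 0,
       ((z - z1) * (w - w1) < 0) = ~~ ((z - z2) * (w - w2) < 0) &
       ((z - z3) * (w - w3) < 0) = c].
  rewrite neq_lt => /orP[/main|z21]; first exact.
  have [z [w [k1 k2 k3 k4 k5]]] := main _ _ z3 w2 w1 w3 z21; exists z, w; split=> //.
  by rewrite k4 negbK.
move=> n12.
suff [z [w [k1 k2 k3 k4 k5]]] : exists z w : R,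
   [/\ (z - (n1 0 0 - n1 0 1)) * (w - (n1 0 0 + n1 0 1)) != 0,
       (z - (n2 0 0 - n2 0 1)) * (w - (n2 0 0 + n2 0 1)) != 0,
       (z - (n3 0 0 - n3 0 1)) * (w - (n3 0 0 + n3 0 1)) != 0,
       ((z - (n1 0 0 - n1 0 1)) * (w - (n1 0 0 + n1 0 1)) < 0) =
       ~~ ((z - (n2 0 0 - n2 0 1)) * (w - (n2 0 0 + n2 0 1)) < 0) &
       ((z - (n3 0 0 - n3 0 1)) * (w - (n3 0 0 + n3 0 1)) < 0) = c].
  exists (vec2 ((z + w) / 2) ((w - z) / 2)).
  have e n : let q := vec2 ((z + w) / 2) ((w - z) / 2) - n in
      (q 0 0 - q 0 1) * (q 0 0 + q 0 1) =
      (z - (n 0 0 - n 0 1)) * (w - (n 0 0 + n 0 1)).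
    by rewrite /= !mxE /=; field.
  by rewrite !strict_mul !ydom_mul !e; split.
(* Distinct points differ in z or in w; in the second case the two coordinates exchange roles. *)
case: (eqVneq (n1 0 0 - n1 0 1) (n2 0 0 - n2 0 1)) => [ez|]; last exact: main'.
have ew : n1 0 0 + n1 0 1 != n2 0 0 + n2 0 1.
  apply: contraNneq n12 => ew; apply/eqP/vec2P; lra.
have [w [z [k1 k2 k3 k4 k5]]] := main' _ _ (n3 0 0 + n3 0 1)
  (n1 0 0 - n1 0 1) (n2 0 0 - n2 0 1) (n3 0 0 - n3 0 1) ew.
exists z, w; rewrite !(mulrC (z - _)); by split.
Qed.

(** From [n], the direction (N + 1, N) is dominated by its first coordinate, while a reflecting [g]
    moves the point by 2N up to a bounded amount in the second coordinate and by a fixed amount in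
    the first. *)
Lemma place_pendant n (d : seq Z2Cs) : exists q,
  [/\ strict (q - n), ydom (q - n) = false &
      forall g, g \in d -> reflects g -> strict (q - act g q) /\ ydom (q - act g q)].
Proof.
pose f g : R := `|(shift1 g)%:~R| + `|(shift2 g)%:~R|.
pose N := \sum_(g <- d) f g + `|n 0 1| + 1.
exists (n + vec2 (N + 1) N).
have N0 : 0 < N.
  by rewrite /N ltr_wpDl // addr_ge0 // sumr_ge0 // => g _; rewrite /f addr_ge0.
have e : n + vec2 (N + 1) N - n = vec2 (N + 1) N by rewrite addrAC subrr add0r.
split; rewrite ?e.
- have N1 : 0 < N + 1 by rewrite addr_gt0.
  by rewrite /strict !mxE /= (gtr0_norm N0) (gtr0_norm N1); apply/eqP; lra.
- have N1 : 0 < N + 1 by rewrite addr_gt0.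
  by rewrite /ydom !mxE /= (gtr0_norm N0) (gtr0_norm N1) ltNge; lra.
move=> g gd rg; suff h : `|(n + vec2 (N + 1) N - act g (n + vec2 (N + 1) N)) 0 0| <
     `|(n + vec2 (N + 1) N - act g (n + vec2 (N + 1) N)) 0 1|.
  by rewrite /strict /ydom h lt_eqF.
rewrite !coordB act0E act1E /sg /= rg !mxE /=.
have fN : f g <= \sum_(g <- d) f g.
  rewrite (big_rem g) //= lerDl sumr_ge0 // => k _; by rewrite /f addr_ge0.
have k1 := ler_norm (- n 0 1); rewrite normrN in k1.
have k2 := ler_norm ((shift2 g)%:~R : R).
rewrite [X in `|X| < _](_ : _ = - (shift1 g)%:~R); last by ring.
rewrite normrN.
apply: lt_le_trans (ler_norm _).
have k3 := normr_ge0 (n 0 1); have k4 := normr_ge0 ((shift2 g)%:~R : R).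
have k5 := normr_ge0 ((shift1 g)%:~R : R).
by move: fN; rewrite /N; move: (\sum_(g0 <- d) f g0) => S; rewrite /f; lra.
Qed.

End Dominance.

(** * Coloured gain graphs *)

Section Rows.
Variables (R : realType) (V : finType).
Local Notation vec := {ffun V -> R^o}.
Implicit Types (u v w : V) (c : bool) (x : vec) (W : {set V}) (b : V -> R).

Definition dl v : vec := [ffun w => (w == v)%:R].

Definition edata := (V * V * Z2Cs)%type.
Implicit Types (e f : edata) (gam : V -> Z2Cs) (p : V -> 'rV[R]_2).

Definition einv e : edata := (e.1.2, e.1.1, e.2^-1%g).
Definition eqv e f : bool := (f == e) || (f == einv e).
(** The incidence row of the edge in the graphic matroid for [false] and in the signed graphic
    matroid for [true]; reversing the edge only rescales it. *)
Definition row c e : vec := dl e.1.1 - sg R c e.2 *: dl e.1.2.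
Definition diff p e : 'rV[R]_2 := p e.1.1 - act e.2 (p e.1.2).

Lemma einvK : involutive einv.
Proof. by case=> [[u v] g]; rewrite /einv /= invgK. Qed.

Lemma eqv_refl e : eqv e e. Proof. by rewrite /eqv eqxx. Qed.
Lemma eqv_inv e : eqv e (einv e). Proof. by rewrite /eqv eqxx orbT. Qed.

Lemma eqv_sym e f : eqv e f = eqv f e.
Proof.
by rewrite /eqv eq_sym; congr (_ || _); apply/eqP/eqP => ->; rewrite einvK.
Qed.

Lemma eqv_trans : transitive eqv.
Proof.
move=> f e h /orP[] /eqP -> // /orP[] /eqP ->; rewrite ?einvK ?eqv_refl ?eqv_inv //.
Qed.

Lemma row_inv c e : row c (einv e) = - sg R c e.2 *: row c e.
Proof.
rewrite /row /= sgV scalerBr scalerA mulNr sg_sqr scaleN1r opprK addrC.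
by rewrite scaleNr.
Qed.

Lemma line_scale (F : fieldType) (U : vectType F) (k : F) (y : U) : k != 0 ->
  <[k *: y]>%VS = <[y]>%VS.
Proof.
move=> k0; apply/eqP; rewrite eqEsubv -!memvE memvZ ?memv_line //=.
by rewrite -[X in X \in _](scalerK k0) memvZ // memv_line.
Qed.

Lemma line_eqv c e f : eqv e f -> <[row c f]>%VS = <[row c e]>%VS.
Proof.
by case/orP => /eqP -> //; rewrite row_inv line_scale // oppr_eq0 sg_neq0.
Qed.

Lemma diff_inv p e : diff p (einv e) = - linear_part e.2^-1%g (diff p e).
Proof. by rewrite -actB actK /diff opprB. Qed.

Lemma strict_eqv p e f : eqv e f -> strict (diff p f) = strict (diff p e).
Proof. by case/orP => /eqP -> //; rewrite diff_inv strictN strict_linear. Qed.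
Lemma ydom_eqv p e f : eqv e f -> ydom (diff p f) = ydom (diff p e).
Proof. by case/orP => /eqP -> //; rewrite diff_inv ydomN ydom_linear. Qed.

Definition pairing b x : R := \sum_v b v * x v.

Lemma pairing_dl b v : pairing b (dl v) = b v.
Proof.
rewrite /pairing (bigD1 v) //= ffunE eqxx mulr1 big1 ?addr0 // => w wv.
by rewrite ffunE (negPf wv) mulr0.
Qed.

Lemma pairingD b x y : pairing b (x + y) = pairing b x + pairing b y.
Proof. by rewrite -big_split; apply: eq_bigr => v _; rewrite ffunE mulrDr. Qed.

Lemma pairingZ b (k : R) x : pairing b (k *: x) = k * pairing b x.
Proof. by rewrite mulr_sumr; apply: eq_bigr => v _; rewrite ffunE mulrCA. Qed.

Lemma pairing_row b c e :
  pairing b (row c e) = b e.1.1 - sg R c e.2 * b e.1.2.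
Proof. by rewrite /row -scaleNr pairingD pairingZ !pairing_dl mulNr. Qed.

Lemma pairing_sp b (I : finType) (phi : I -> vec) (A : {set I}) x :
  {in A, forall i, pairing b (phi i) = 0} -> x \in sp phi A -> pairing b x = 0.
Proof.
move=> h /memv_sumP[xs xsE ->].
have b0 : pairing b 0 = 0.
  by rewrite /pairing big1 // => v _; rewrite ffunE mulr0.
rewrite (big_morph (pairing b) (pairingD b) b0) big1 // => i iA.
by have /vlineP[k ->] := xsE i iA; rewrite pairingZ h // mulr0.
Qed.

Lemma pairing_coord v x : pairing (fun w => (w == v)%:R) x = x v.
Proof.
rewrite /pairing (bigD1 v) //= eqxx mul1r big1 ?addr0 // => w /negPf ->.
by rewrite mul0r.
Qed.

Lemma sp_coord0 (I : finType) (phi : I -> vec) (A : {set I}) x v :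
  {in A, forall i, phi i v = 0} -> x \in sp phi A -> x v = 0.
Proof.
move=> h /(pairing_sp (b := fun w => (w == v)%:R)); rewrite pairing_coord.
by apply=> i iA; rewrite pairing_coord h.
Qed.

Lemma mem_sp_dl W x : (forall v, v \notin W -> x v = 0) -> x \in sp dl W.
Proof.
move=> h; have -> : x = \sum_(v in W) x v *: dl v.
  apply/ffunP => w; rewrite sum_ffunE.
  case: (boolP (w \in W)) => wW.
    rewrite (bigD1 w) //= !ffunE eqxx big1 ?addr0 => [|v /andP[_ vw]].
      by rewrite [_ *: _]mulr1.
    by rewrite !ffunE eq_sym (negPf vw) [_ *: _]mulr0.
  rewrite (h w wW) big1 // => v vW; rewrite !ffunE.
  by case: eqP vW => [<-|_ _]; rewrite ?(negPf wW) // [_ *: _]mulr0.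
by apply: memv_suml => v vW; apply/memvZ/mem_sp.
Qed.

Lemma sp_le_dl (I : finType) (phi : I -> vec) (A : {set I}) W :
  {in A, forall i, forall v, v \notin W -> phi i v = 0} ->
  (sp phi A <= sp dl W)%VS.
Proof. by move=> h; apply/sp_subP => i /h; apply: mem_sp_dl. Qed.

Lemma indep_card_le (I : finType) (phi : I -> vec) (A : {set I}) W :
  {in A, forall i, forall v, v \notin W -> phi i v = 0} ->
  indep phi A -> (#|A| <= #|W|)%N.
Proof.
move=> /sp_le_dl /dimvS h /eqP <-; exact: leq_trans h (dim_sp_le _ _).
Qed.

(** A common zero [b] of the rows keeps [dl w] out of their span, so the span misses a dimension of
    the vectors supported on [W]. *)
Lemma indep_card_lt (I : finType) (phi : I -> vec) (A : {set I}) W b w :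
  {in A, forall i, forall v, v \notin W -> phi i v = 0} ->
  {in A, forall i, pairing b (phi i) = 0} -> w \in W -> b w != 0 ->
  indep phi A -> (#|A| < #|W|)%N.
Proof.
move=> /sp_le_dl hW hb wW bw /eqP iA.
have : dl w \notin sp phi A.
  by apply: contraNN bw => /(pairing_sp hb); rewrite pairing_dl => ->.
move=> h; have : (\dim (<[dl w]> + sp phi A) <= \dim (sp dl W))%N.
  by apply: dimvS; rewrite subv_add hW andbT -memvE mem_sp.
rewrite dimv_add_line h iA add1n => h'; exact: leq_trans h' (dim_sp_le _ _).
Qed.

Lemma row_out c e v : v != e.1.1 -> v != e.1.2 -> row c e v = 0.
Proof.
by move=> h1 h2; rewrite !ffunE (negPf h1) (negPf h2) scaler0 subr0.
Qed.

Lemma row_src c e : e.1.1 != e.1.2 -> row c e e.1.1 = 1.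
Proof. by move=> h; rewrite !ffunE eqxx (negPf h) scaler0 subr0. Qed.

(** Switching by the potential [gam] makes the gains of exactly these edges trivial. *)
Definition balanced gam e : bool := (gam e.1.1 * e.2)%g == gam e.1.2.

Lemma balanced_eqv gam e f : eqv e f -> balanced gam f = balanced gam e.
Proof.
case/orP => /eqP -> //; rewrite /balanced /=; apply/eqP/eqP => [<-|<-].
  by rewrite mulgVK.
by rewrite mulgK.
Qed.

(** The signs of a potential solve the balanced constraints of either class; this caps a balanced
    class at |W| - 1 in [class_lt]. *)
Lemma pairing_balanced gam c e : balanced gam e ->
  pairing (fun v => sg R c (gam v)) (row c e) = 0.
Proof.
by move=> /eqP h; rewrite pairing_row -h sgM mulrCA sg_sqr mulr1 subrr.
Qed.

End Rows.

(** * Colourings and realizations *)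

Section States.
Variables (R : realType) (V I : finType).
Implicit Types (u v w : V) (c : bool) (W : {set V}) (p : V -> 'rV[R]_2).
Implicit Types (ed : I -> edata V) (S : {set I}) (col : I -> bool).

Definition rows c ed i : {ffun V -> R^o} := row R c (ed i).

Definition class S col c := [set i in S | col i == c].

Definition dec ed S col : Prop := forall c, indep (rows c ed) (class S col c).

Definition simple ed S : Prop :=
  {in S &, forall i j, i != j -> ~~ eqv (ed i) (ed j)}.

Definition within W ed S : Prop :=
  {in S, forall i, (ed i).1.1 \in W /\ (ed i).1.2 \in W}.

Definition ycol p ed i : bool := ydom (diff p (ed i)).

Definition realizes ed S p : Prop :=
  {in S, forall i, strict (diff p (ed i))} /\ dec ed S (ycol p ed).

Definition realizable ed S : Prop := exists p, realizes ed S p.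

Lemma class_mem S col c i : (i \in class S col c) = (i \in S) && (col i == c).
Proof. by rewrite inE. Qed.

Lemma class_sub S col c : class S col c \subset S.
Proof. by apply/subsetP => i; rewrite inE => /andP[]. Qed.

Lemma eq_class S col col' c : {in S, col =1 col'} ->
  class S col c = class S col' c.
Proof.
by move=> h; apply/setP => i; rewrite !inE; case iS: (i \in S); rewrite //= h.
Qed.

Lemma eq_dec ed ed' S col col' : {in S, forall i, eqv (ed i) (ed' i)} ->
  {in S, col =1 col'} -> dec ed S col -> dec ed' S col'.
Proof.
move=> he hc h c; rewrite -(eq_class _ hc) -(eq_indep (phi := rows c ed)) //.
by move=> i; rewrite inE => /andP[/he /line_eqv h' _]; rewrite /rows h'.
Qed.

Lemma realizes_eqv ed ed' S p : {in S, forall i, eqv (ed i) (ed' i)} ->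
  realizes ed S p -> realizes ed' S p.
Proof.
move=> he [h1 h2]; split=> [i iS|]; first by rewrite (strict_eqv _ (he i iS)) h1.
by apply: (eq_dec he _ h2) => i iS; rewrite /ycol (ydom_eqv _ (he i iS)).
Qed.

Lemma simple_eqv ed ed' S : {in S, forall i, eqv (ed i) (ed' i)} ->
  simple ed S -> simple ed' S.
Proof.
move=> he h i j iS jS ij; apply: contraNN (h i j iS jS ij) => e.
apply: eqv_trans (he i iS) _; apply: eqv_trans e _.
by rewrite eqv_sym he.
Qed.

Lemma within_eqv W ed ed' S : {in S, forall i, eqv (ed i) (ed' i)} ->
  within W ed S -> within W ed' S.
Proof. by move=> he h i iS; have [h1 h2] := h i iS; case/orP: (he i iS) => /eqP ->. Qed.

Lemma dec_sub ed S S' col : S' \subset S -> dec ed S col -> dec ed S' col.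
Proof.
move=> /subsetP SS h c; apply: indep_sub (h c); apply/subsetP => i.
by rewrite !inE => /andP[/SS -> ->].
Qed.

(** The row of any other loop is zero, as its two terms cancel unless the sign is -1. *)
Lemma dec_loop ed S col i : dec ed S col -> i \in S ->
  (ed i).1.1 = (ed i).1.2 -> col i /\ reflects (ed i).2.
Proof.
move=> h iS e; have := indep_neq0 (h (col i)) (i := i); rewrite inE iS eqxx.
move=> /(_ isT); rewrite /rows /row e /sg; case: (col i) => /=; last first.
  by rewrite scale1r subrr eqxx.
by case: ifP => // _; rewrite scale1r subrr eqxx.
Qed.

Lemma rows_within W ed S c : within W ed S ->
  {in S, forall i, forall v, v \notin W -> rows c ed i v = 0}.
Proof.
move=> h i /h[h1 h2] v vW; apply: row_out.
  by apply: contraNneq vW => ->.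
by apply: contraNneq vW => ->.
Qed.

Lemma class_le W ed S col c : within W ed S -> dec ed S col ->
  (#|class S col c| <= #|W|)%N.
Proof.
move=> h /(_ c); apply: indep_card_le => i iS.
by apply: (rows_within c h); apply: subsetP iS; apply: class_sub.
Qed.

Lemma class_lt W ed S S' col c gam : within W ed S -> dec ed S col ->
  S' \subset class S col c -> {in S', forall i, balanced gam (ed i)} ->
  W != set0 -> (#|S'| < #|W|)%N.
Proof.
move=> h hd hS hb /set0Pn[w wW].
apply: (indep_card_lt (phi := rows c ed) (w := w) (b := fun v => sg R c (gam v))) => //.
- move=> i iS; apply: (rows_within c h); apply: subsetP iS.
  exact: subset_trans hS (class_sub _ _ _).
- by move=> i iS; apply/pairing_balanced/hb.
- exact: sg_neq0.
- exact: indep_sub hS (hd c).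
Qed.

Lemma class_false_lt W ed S col : within W ed S -> dec ed S col -> W != set0 ->
  (#|class S col false| < #|W|)%N.
Proof.
move=> h hd /set0Pn[w wW].
apply: (indep_card_lt (phi := rows false ed) (w := w) (b := fun _ => 1)) => //.
- move=> i iS; apply: (rows_within false h); apply: subsetP iS.
  exact: class_sub.
- by move=> i _; rewrite pairing_row sg_false mul1r subrr.
- exact: oner_neq0.
Qed.

Lemma card_class S col : #|S| = (#|class S col false| + #|class S col true|)%N.
Proof.
rewrite -(cardsID [set i | col i]) addnC; congr (_ + _)%N;
by apply: eq_card => i; rewrite !inE eqbF_neg || rewrite !inE eqb_id; rewrite andbC.
Qed.

End States.

(** * Placing a vertex *)

Section Placement.
Variables (R : realType) (V I : finType).
Implicit Types (u v w : V) (c : bool) (W : {set V}) (p : V -> 'rV[R]_2).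
Implicit Types (ed : I -> edata V) (S A : {set I}) (col : I -> bool).

Local Notation rows := (@rows R V I).

Definition pseg t p0 p1 v : 'rV[R]_2 := seg t (p0 v) (p1 v).

Lemma diff_pseg t p0 p1 (e : edata V) :
  diff (pseg t p0 p1) e = seg t (diff p0 e) (diff p1 e).
Proof. by rewrite /diff /pseg act_seg segB. Qed.

Lemma small_realizes ed S p0 p1 : realizes ed S p0 ->
  small (fun t => realizes ed S (pseg t p0 p1) /\
                  {in S, ycol (pseg t p0 p1) ed =1 ycol p0 ed}).
Proof.
move=> [h1 h2].
have : small (fun t => {in S, forall i, strict (diff (pseg t p0 p1) (ed i)) /\
    ycol (pseg t p0 p1) ed i = ycol p0 ed i}).
  apply: small_all => i iS; apply: smallW (small_strict (diff p1 (ed i)) (h1 i iS)).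
  by move=> t _; rewrite /ycol diff_pseg.
apply: smallW => t _ h; have hc : {in S, ycol (pseg t p0 p1) ed =1 ycol p0 ed}.
  by move=> i /h[].
split=> //; split; first by move=> i /h[].
by apply: eq_dec h2 => [i _|i /hc ->]; rewrite ?eqv_refl.
Qed.

Definition orbit_point p (x : Z2Cs * V) : 'rV[R]_2 := act x.1 (p x.2).

Lemma orbit_point_seg t p0 p1 x :
  orbit_point (pseg t p0 p1) x = seg t (orbit_point p0 x) (orbit_point p1 x).
Proof. by rewrite /orbit_point /pseg act_seg. Qed.

Lemma orbit_point_separated (x y : Z2Cs * V) p : x != y ->
  exists p', orbit_point p' x != orbit_point p' y.
Proof.
case: x y => [g v] [h w] xy; rewrite /orbit_point /=.
have [vw|vw] := eqVneq v w.
  subst w; have gh : g <> h by move=> e; rewrite e eqxx in xy.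
  have [q qP] : exists q : 'rV[R]_2, act g q <> act h q.
    by apply: contrapT => /forallNP n; apply: gh; apply: (@act_inj R) => q;
      apply: contrapT; apply: n.
  by exists (fun _ => q); apply/eqP.
exists (fun u => if u == v then act g^-1%g (act h 0 + vec2 1 0) else 0).
rewrite eqxx (eq_sym w) (negPf vw) actKV -subr_eq0 addrAC subrr add0r.
by apply/eqP => /rowP/(_ 0); rewrite !mxE /= => /eqP; rewrite oner_eq0.
Qed.

(** Realizing is an open condition, and the difference of two orbit points is affine along a segment
    of positions. A small step towards positions that separate one more pair therefore separates it
    and keeps what was obtained before. *)
Lemma realizes_generic ed S p (L : seq ((Z2Cs * V) * (Z2Cs * V))) :
  realizes ed S p -> {in L, forall x, x.1 != x.2} ->
  exists p', [/\ realizes ed S p', {in S, ycol p' ed =1 ycol p ed} &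
    {in L, forall x, orbit_point p' x.1 != orbit_point p' x.2}].
Proof.
move=> hp; elim: L => [|x L IH] hL; first by exists p.
have [y yL|p1 [h1 h2 h3]] := IH; first by apply: hL; rewrite inE yL orbT.
have [p2 p2x] := orbit_point_separated p (hL _ (mem_head x L)).
have sx : small (fun t => orbit_point (pseg t p1 p2) x.1 !=
                          orbit_point (pseg t p1 p2) x.2).
  have [e0|e0] := eqVneq (orbit_point p1 x.1 - orbit_point p1 x.2) 0.
    have := @small_neq0_line R (orbit_point p2 x.1 - orbit_point p2 x.2).
    rewrite subr_eq0 => /(_ p2x); apply: smallW => t _ ht.
    by rewrite -subr_eq0 !orbit_point_seg segB e0.
  have := small_neq0 (orbit_point p2 x.1 - orbit_point p2 x.2) e0.
  apply: smallW => t _ ht.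
  by rewrite -subr_eq0 !orbit_point_seg segB.
have sL : small (fun t => {in [set j : 'I_(size L) | true], forall j,
    orbit_point (pseg t p1 p2) (tnth (in_tuple L) j).1 !=
    orbit_point (pseg t p1 p2) (tnth (in_tuple L) j).2}).
  apply: small_all => j _.
  have := h3 _ (mem_tnth j (in_tuple L)); rewrite -subr_eq0 => e0.
  have := small_neq0 (orbit_point p2 (tnth (in_tuple L) j).1 -
                      orbit_point p2 (tnth (in_tuple L) j).2) e0.
  apply: smallW => t _ ht.
  by rewrite -subr_eq0 !orbit_point_seg segB.
have [t t0 [[[k1 k2] kx] kL]] :=
  small_ex (small_and (small_and (small_realizes p2 h1) sx) sL).
exists (pseg t p1 p2); split=> //; first by move=> i iS; rewrite k2 // h2.
move=> y; rewrite inE => /orP[/eqP -> //|yL].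
by have /tnthP[j ->] := (yL : y \in in_tuple L); apply: kL; rewrite inE.
Qed.

Definition outward v ed S : Prop :=
  {in S, forall i, (ed i).1.2 = v -> (ed i).1.1 = v}.

(** For an [outward] orientation these are exactly the edges avoiding [v]. *)
Definition off v ed S := [set i in S | (ed i).1.1 != v].

Lemma orient v ed S : exists ed', {in S, forall i, eqv (ed i) (ed' i)} /\
  outward v ed' S.
Proof.
exists (fun i => if (ed i).1.2 == v then einv (ed i) else ed i); split=> i _.
  by case: ifP; rewrite ?eqv_inv ?eqv_refl.
by case: ifP => //= /eqP //; case: eqP.
Qed.

Lemma off_sub v ed S : off v ed S \subset S.
Proof. by apply/subsetP => i; rewrite inE => /andP[]. Qed.

Lemma off_coord0 v ed S A c : outward v ed S -> A \subset off v ed S ->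
  {in A, forall i, rows c ed i v = 0}.
Proof.
move=> h /subsetP hA i /hA; rewrite inE => /andP[iS iv].
apply: row_out; first by rewrite eq_sym.
by apply: contraNneq iv => e; rewrite (h i iS (esym e)).
Qed.

Lemma off_within v W ed S : outward v ed S -> within W ed S ->
  within (W :\ v) ed (off v ed S).
Proof.
move=> h hW i; rewrite inE => /andP[iS iv]; have [h1 h2] := hW i iS.
rewrite !inE h1 h2 iv !andbT; split=> //.
by apply: contraNneq iv => /(h i iS) ->.
Qed.

Lemma indep_pendant v ed S A c i : outward v ed S -> A \subset off v ed S ->
  rows c ed i v != 0 -> indep (rows c ed) A -> indep (rows c ed) (i |: A).
Proof.
move=> h hA iv iA; have ni : rows c ed i \notin sp (rows c ed) A.
  by apply: contraNN iv => /(sp_coord0 (off_coord0 c h hA)) ->.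
rewrite indepU1 ?iA //; apply: contraNN ni; exact: mem_sp.
Qed.

(** The difference cancels the coordinate at [v]; by [row_chord] it is proportional to the row of
    the chord joining the two neighbours. *)
Lemma indep_two v ed S A c i k : outward v ed S -> A \subset off v ed S ->
  rows c ed i v = 1 -> rows c ed k v = 1 ->
  rows c ed i - rows c ed k \notin sp (rows c ed) A ->
  indep (rows c ed) A -> indep (rows c ed) (i |: (k |: A)).
Proof.
move=> h hA iv kv d iA.
have := indep_pendant (c := c) (i := k) h hA; rewrite kv oner_neq0 => /(_ isT iA) kA.
have ni : rows c ed i \notin sp (rows c ed) (k |: A).
  apply: contraNN d; rewrite spU1 => /memv_addP[_ /vlineP[t ->] [a aA e]].
  have : rows c ed i v = t * rows c ed k v + a v by rewrite e !ffunE.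
  rewrite (sp_coord0 (off_coord0 c h hA) aA) iv kv mulr1 addr0 => t1.
  by rewrite e -t1 scale1r addrC addKr.
rewrite indepU1 ?kA //; apply: contraNN ni; exact: mem_sp.
Qed.

Lemma indep_two_inv v ed S A c i k : outward v ed S -> A \subset off v ed S ->
  i \notin k |: A -> k \notin A ->
  indep (rows c ed) (i |: (k |: A)) ->
  rows c ed i - rows c ed k \notin sp (rows c ed) A.
Proof.
move=> h hA iA kA; rewrite indepU1 // => /andP[_]; apply: contraNN => d.
rewrite -[rows c ed i](subrK (rows c ed k)) spU1 addrC memv_add //.
exact: memv_line.
Qed.

Definition place v p q w : 'rV[R]_2 := if w == v then q else p w.

Lemma diff_place v p q (e : edata V) : e.1.1 != v -> e.1.2 != v ->
  diff (place v p q) e = diff p e.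
Proof. by move=> /negPf h1 /negPf h2; rewrite /diff /place h1 h2. Qed.

(** [D c] only bounds the set of new edges in class [c], so their exact colours need not be
    known. *)
Lemma place_realizes v ed S p q (D : bool -> {set I}) : outward v ed S ->
  realizes ed (off v ed S) p ->
  {in S :\: off v ed S, forall i, strict (diff (place v p q) (ed i)) /\
    i \in D (ydom (diff (place v p q) (ed i)))} ->
  (forall c, indep (rows c ed) (class (off v ed S) (ycol p ed) c :|: D c)) ->
  realizes ed S (place v p q).
Proof.
move=> h [h1 h2] hN hD.
have e i : i \in off v ed S -> diff (place v p q) (ed i) = diff p (ed i).
  rewrite inE => /andP[iS iv]; rewrite diff_place //.
  by apply: contraNneq iv => /(h i iS) ->.
split=> [i iS|c].
  case: (boolP (i \in off v ed S)) => io; first by rewrite e // h1.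
  by have [|] := hN i; rewrite // in_setD io.
apply: indep_sub (hD c); apply/subsetP => i; rewrite class_mem => /andP[iS ic].
rewrite inE class_mem; case: (boolP (i \in off v ed S)) => io /=.
  by rewrite -(eqP ic) /ycol e // eqxx.
by have [|_] := hN i; [rewrite in_setD io | rewrite -/(ycol _ ed i) (eqP ic)].
Qed.


Lemma rows_src v ed c i : (ed i).1.1 = v -> (ed i).1.2 != v -> rows c ed i v = 1.
Proof. by move=> <- h; rewrite /rows row_src // eq_sym. Qed.

Lemma rows_loop v ed i : (ed i).1.1 = v -> (ed i).1.2 = v ->
  reflects (ed i).2 -> rows true ed i v != 0.
Proof.
move=> h1 h2 r; rewrite /rows /row h1 h2 /sg r scaleN1r opprK !ffunE eqxx.
by rewrite -mulr2n pnatr_eq0.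
Qed.

Definition nbr ed i : Z2Cs * V := ((ed i).2, (ed i).1.2).

Lemma diff_place_src v ed p q i : (ed i).1.1 = v -> (ed i).1.2 != v ->
  diff (place v p q) (ed i) = q - orbit_point p (nbr ed i).
Proof. by move=> h1 /negPf h2; rewrite /diff /place h1 h2 eqxx. Qed.

(** The link goes to the first class and the reflecting loop to the second; each is the only new
    edge of its class and has a nonzero coordinate at [v]. *)
Lemma extend_low v ed S p : outward v ed S -> realizes ed (off v ed S) p ->
  (#|[set i in S | ((ed i).1.1 == v) && ((ed i).1.2 != v)]| <= 1)%N ->
  (#|[set i in S | ((ed i).1.1 == v) && ((ed i).1.2 == v)]| <= 1)%N ->
  {in S, forall i, (ed i).1.1 = (ed i).1.2 -> reflects (ed i).2} ->
  realizable R ed S.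
Proof.
move=> h hp; set N := [set i in S | _]; set L := [set i in S | _] => cN cL hL.
have hN i : i \in N -> N = [set i].
  move=> iN; apply/eqP; rewrite eq_sym eqEcard sub1set iN cards1.
  by rewrite cN.
have hLp i : i \in L -> L = [set i].
  move=> iN; apply/eqP; rewrite eq_sym eqEcard sub1set iN cards1.
  by rewrite cL.
pose n := if [pick i in N] is Some i then orbit_point p (nbr ed i) else 0.
have [q [q1 q2 q3]] := place_pendant n [seq (ed i).2 | i in L].
exists (place v p q).
apply: (place_realizes (D := fun c => if c then L else N) h hp) => [i|c].
  rewrite !inE => /andP[+ iS]; rewrite iS negbK /= => /eqP iv.
  have [iv2|iv2] := eqVneq (ed i).1.2 v.
    have -> : diff (place v p q) (ed i) = q - act (ed i).2 q.
      by rewrite /diff /place iv iv2 eqxx.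
    have iL : i \in L by rewrite inE iS iv iv2 eqxx.
    have [||-> ->] // := q3 (ed i).2; first exact: image_f.
    by rewrite hL // iv iv2.
  have iN : i \in N by rewrite inE iS iv iv2 eqxx.
  rewrite diff_place_src //; have -> : orbit_point p (nbr ed i) = n.
    rewrite /n; case: pickP => [j|/(_ i)]; last by rewrite iN.
    by rewrite (hN i iN) => /set1P ->.
  by rewrite q1 q2.
have cl := class_sub (off v ed S) (ycol p ed) c.
case: c cl => cl.
  have [->|[i iL]] := set_0Vmem L; first by rewrite setU0; apply: hp.2.
  rewrite (hLp i iL) setUC; apply: (indep_pendant h cl) (hp.2 true).
  move: iL; rewrite inE => /and3P[iS /eqP i1 /eqP i2]; apply: rows_loop => //.
  by apply: hL => //; rewrite i1 i2.
have [->|[i iL]] := set_0Vmem N; first by rewrite setU0; apply: hp.2.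
rewrite (hN i iL) setUC; apply: (indep_pendant h cl) (hp.2 false).
by move: iL; rewrite inE => /and3P[iS /eqP i1 i2]; rewrite rows_src // oner_neq0.
Qed.

Lemma extend_two v ed S p i j : outward v ed S -> realizes ed (off v ed S) p ->
  S :\: off v ed S \subset [set i; j] ->
  (ed i).1.1 = v -> (ed i).1.2 != v -> (ed j).1.1 = v -> (ed j).1.2 != v ->
  orbit_point p (nbr ed i) != orbit_point p (nbr ed j) -> realizable R ed S.
Proof.
move=> h hp /subsetP hS i1 i2 j1 j2 nij.
have [q [q1 q2 _ q3 _]] := strip (orbit_point p (nbr ed i)) false nij.
exists (place v p q); set ci := ydom (q - orbit_point p (nbr ed i)) in q3.
apply: (place_realizes (D := fun c => if c == ci then [set i] else [set j]) h hp).
  move=> k /hS; rewrite !inE => /orP[] /eqP ->; rewrite diff_place_src //.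
    by rewrite q1 -/ci eqxx set11.
  by rewrite q2 -[ydom _]negbK -q3; case: ci {q3}; rewrite /= set11.
move=> c; rewrite setUC.
have cl := class_sub (off v ed S) (ycol p ed) c.
by case: ifP => _; apply: (indep_pendant h cl) (hp.2 c); rewrite rows_src // oner_neq0.
Qed.

(** [strip] separates [i] from [j] and puts [k] in class [c], but does not tell which of [i] and [j]
    shares that class; hence the two conditions on differences. *)
Lemma extend_three_at v ed S p c i j k : outward v ed S ->
  realizes ed (off v ed S) p -> S :\: off v ed S \subset [set i; j; k] ->
  {in [set i; j; k], forall l, (ed l).1.1 = v /\ (ed l).1.2 != v} ->
  orbit_point p (nbr ed i) != orbit_point p (nbr ed j) ->
  rows c ed i - rows c ed k \notin sp (rows c ed) (class (off v ed S) (ycol p ed) c) ->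
  rows c ed j - rows c ed k \notin sp (rows c ed) (class (off v ed S) (ycol p ed) c) ->
  realizable R ed S.
Proof.
move=> h hp /subsetP hS hl nij di dj.
have [[i1 i2] [j1 j2] [k1 k2]] : [/\ (ed i).1.1 = v /\ (ed i).1.2 != v,
    (ed j).1.1 = v /\ (ed j).1.2 != v & (ed k).1.1 = v /\ (ed k).1.2 != v].
  by split; apply: hl; rewrite !inE eqxx ?orbT.
have [q [q1 q2 q3 q4 q5]] := strip (orbit_point p (nbr ed k)) c nij.
exists (place v p q); set ci := ydom (q - orbit_point p (nbr ed i)) in q4.
pose D c' := (if c' == ci then [set i] else [set j]) :|:
             (if c' == c then [set k] else set0).
apply: (place_realizes (D := D) h hp).
  move=> l /hS; rewrite !inE -orbA => /or3P[] /eqP ->; rewrite diff_place_src //.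
  - by rewrite q1 /D -/ci eqxx set11.
  - rewrite q2 /D -[ydom _]negbK -q4.
    by case: ci {q4 D}; rewrite /= set11.
  - by rewrite q3 q5 /D eqxx set11 orbT.
move=> c'; rewrite setUC /D.
have cl := class_sub (off v ed S) (ycol p ed) c'.
have [->|_] := eqVneq c' c; last first.
  rewrite setU0; case: ifP => _; apply: (indep_pendant h cl) (hp.2 c');
  by rewrite rows_src // oner_neq0.
have clc := class_sub (off v ed S) (ycol p ed) c.
by case: ifP => _; rewrite -setUA; apply: (indep_two h clc) (hp.2 c);
  rewrite ?rows_src.
Qed.

(** Three differences adding up to zero cannot have exactly one outside the span, so at least two
    are outside. The edge these two share plays the part of [k] in [extend_three_at]. *)
Lemma extend_three v ed S p c i j k : outward v ed S -> simple ed S ->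
  realizes ed (off v ed S) p -> S :\: off v ed S = [set i; j; k] ->
  i != j -> i != k -> j != k ->
  {in [set i; j; k], forall l, (ed l).1.1 = v /\ (ed l).1.2 != v} ->
  rows c ed i - rows c ed j \notin sp (rows c ed) (class (off v ed S) (ycol p ed) c) ->
  realizable R ed S.
Proof.
move=> h hs hp eS ij ik jk hl dij.
have nS l : l \in [set i; j; k] -> l \in S by rewrite -eS => /setDP[].
have nb l m : l \in [set i; j; k] -> m \in [set i; j; k] -> l != m ->
    nbr ed l != nbr ed m.
  move=> hl1 hm1 lm; have := hs l m (nS l hl1) (nS m hm1) lm.
  apply: contraNneq => -[e1 e2]; rewrite /eqv; apply/orP; left.
  have [] := hl l hl1; have [] := hl m hm1; move: e1 e2.
  by case: (ed l) => [[? ?] ?]; case: (ed m) => [[? ?] ?] /= -> -> -> _ -> _.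
have mi : i \in [set i; j; k] by rewrite !inE eqxx.
have mj : j \in [set i; j; k] by rewrite !inE eqxx orbT.
have mk : k \in [set i; j; k] by rewrite !inE eqxx orbT.
(* Simplicity makes the three neighbours distinct as orbit points; a perturbation makes their
   positions distinct. *)
pose L := [:: (nbr ed i, nbr ed j); (nbr ed i, nbr ed k); (nbr ed j, nbr ed k)].
have [|p' [hp' hc hL]] := realizes_generic (L := L) hp.
  by move=> x; rewrite !inE => /or3P[] /eqP -> /=; apply: nb.
have nij := hL (nbr ed i, nbr ed j) _; have nik := hL (nbr ed i, nbr ed k) _.
have njk := hL (nbr ed j, nbr ed k) _.
rewrite !inE !eqxx ?orbT /= in nij nik njk.
have {}nij := nij isT; have {}nik := nik isT; have {}njk := njk isT.
rewrite -(eq_class c hc) in dij.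
set U := sp _ _ in dij.
have cycl (x y z : {ffun V -> R^o}) : x - z \in U -> y - z \in U -> x - y \in U.
  by move=> xz yz; rewrite -(subrKA z) -(opprB y) memvB.
have perm3 (a b d : I) : [set a; b; d] = [set i; j; k] ->
    S :\: off v ed S \subset [set a; b; d] /\
    {in [set a; b; d], forall l, (ed l).1.1 = v /\ (ed l).1.2 != v}.
  by move=> ->; rewrite eS.
case: (boolP (rows c ed i - rows c ed k \in U)) => dik.
  have [|s1 s2] := perm3 i k j.
    by apply/setP => l; rewrite !inE orbAC.
  apply: (extend_three_at (c := c) h hp' s1 s2 nik dij).
  apply: contraNN dij => dkj; apply: cycl dik _.
  by rewrite -opprB memvN.
case: (boolP (rows c ed j - rows c ed k \in U)) => djk.
  have [|s1 s2] := perm3 j k i.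
    by apply/setP => l; rewrite !inE orbC orbA.
  apply: (extend_three_at (c := c) h hp' s1 s2 njk).
    by rewrite -opprB memvN.
  by rewrite -opprB memvN.
have [|s1 s2] := perm3 i j k; first by [].
exact: (extend_three_at h hp' s1 s2 nij dik djk).
Qed.

End Placement.

(** * Removing a vertex of low degree *)

Section Reductions.
Variables (R : realType) (V I : finType).
Implicit Types (u v w : V) (c : bool) (W : {set V}) (p : V -> 'rV[R]_2).
Implicit Types (ed : I -> edata V) (S A : {set I}) (col : I -> bool).

Local Notation rows := (@rows R V I).
Local Notation realizable := (@realizable R V I).
Local Notation dec := (@dec R V I).

Lemma realizable_eqv ed ed' S : {in S, forall i, eqv (ed i) (ed' i)} ->
  realizable ed S -> realizable ed' S.
Proof. by move=> he [p hp]; exists p; apply: realizes_eqv he hp. Qed.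

(** Induction on vertices plus edges, over all labellings [ed], since chords and quotients change
    the labels. *)
Definition below (n : nat) : Prop := forall W ed S col,
  (#|W| + #|S| < n)%N -> simple ed S -> within W ed S -> dec ed S col ->
  realizable ed S.

Definition links v ed S := [set i in S | ((ed i).1.1 == v) (+) ((ed i).1.2 == v)].
Definition loops v ed S := [set i in S | ((ed i).1.1 == v) && ((ed i).1.2 == v)].

Lemma eqv_links v ed ed' S : {in S, forall i, eqv (ed i) (ed' i)} ->
  links v ed' S = links v ed S /\ loops v ed' S = loops v ed S.
Proof.
move=> he; split; apply/setP => i; rewrite !inE; case iS: (i \in S) => //=.
  by case/orP: (he i iS) => /eqP ->; rewrite //= addbC.
by case/orP: (he i iS) => /eqP ->; rewrite //= andbC.
Qed.

Lemma outward_links v ed S : outward v ed S ->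
  links v ed S = [set i in S | ((ed i).1.1 == v) && ((ed i).1.2 != v)].
Proof.
move=> h; apply/setP => i; rewrite !inE; case iS: (i \in S) => //=.
have := h i iS; case: eqP => //= n1; case: eqP => //= n2 n3.
by case: n1; apply: n3.
Qed.

Lemma setD_off v ed S : outward v ed S ->
  S :\: off v ed S = links v ed S :|: loops v ed S.
Proof.
move=> h; rewrite outward_links //; apply/setP => i; rewrite !inE.
by case: (i \in S) => //=; rewrite ?andbF //; case: eqP => //= _; case: eqP.
Qed.

Lemma off_realizable v W ed S col : below (#|W| + #|S|) -> v \in W ->
  outward v ed S -> simple ed S -> within W ed S -> dec ed S col ->
  realizable ed (off v ed S).
Proof.
move=> IH vW h hs hW hd.
apply: (IH (W :\ v) ed (off v ed S) col).
- rewrite [#|W|](cardsD1 v) vW add1n addSn ltnS leq_add2l.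
  exact/subset_leq_card/off_sub.
- by move=> i j iS jS; apply: hs; apply: subsetP (off_sub v ed S) _ _.
- exact: off_within.
- exact: dec_sub (off_sub v ed S) hd.
Qed.

(** The degree bound, with loops counted twice, leaves two cases: at most one link and one loop, or
    two links and no loop. *)
Lemma low_degree v W ed S col : below (#|W| + #|S|) -> v \in W ->
  simple ed S -> within W ed S -> dec ed S col ->
  (#|links v ed S| + 2 * #|loops v ed S| <= 3)%N -> (#|links v ed S| <= 2)%N ->
  realizable ed S.
Proof.
move=> IH vW hs hW hd; have [ed' [he h]] := orient v ed S.
have [<- <-] := eqv_links v he => deg3 deg2.
have he' : {in S, forall i, eqv (ed' i) (ed i)} by move=> i /he; rewrite eqv_sym.
apply: (realizable_eqv he').
have {}hs := simple_eqv he hs; have {}hW := within_eqv he hW.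
have {he he'}hd : dec ed' S col by apply: (eq_dec he _ hd).
have [p hp] := off_realizable IH vW h hs hW hd.
have [c1|c2] : (#|links v ed' S| <= 1)%N \/ #|links v ed' S| == 2%N by lia.
  apply: (extend_low h hp).
  - by rewrite -outward_links.
  - by rewrite -/(loops v ed' S); lia.
  - by move=> i iS /(dec_loop hd iS)[].
have L0 : loops v ed' S = set0 by apply/eqP; rewrite -cards_eq0; lia.
case/cards2P: c2 => i [j [ij eN]].
have hl l : l \in [set i; j] -> (ed' l).1.1 = v /\ (ed' l).1.2 != v.
  by rewrite -eN outward_links // inE => /and3P[_ /eqP].
have nS l : l \in [set i; j] -> l \in S by rewrite -eN inE => /andP[].
have [i1 i2] := hl i (set21 i j); have [j1 j2] := hl j (set22 i j).
have [|p' [hp' _ hL]] := realizes_generic (L := [:: (nbr ed' i, nbr ed' j)]) hp.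
  move=> x; rewrite inE => /eqP -> /=.
  have := hs i j (nS i (set21 i j)) (nS j (set22 i j)) ij.
  apply: contraNneq; rewrite /nbr /eqv; move: i1 j1.
  by case: (ed' i) => [[? ?] ?]; case: (ed' j) => [[? ?] ?] /= -> -> [-> ->]; rewrite eqxx.
apply: (extend_two h hp' _ i1 i2 j1 j2).
  by rewrite setD_off // L0 setU0 eN.
exact: hL (mem_head _ _).
Qed.

Definition chord ed i j : edata V :=
  ((ed i).1.2, (ed j).1.2, ((ed i).2^-1 * (ed j).2)%g).

Lemma row_chord c ed i j : (ed i).1.1 = (ed j).1.1 ->
  row R c (chord ed i j) = - sg R c (ed i).2 *: (rows c ed i - rows c ed j).
Proof.
move=> h; rewrite /rows /row /= h sgM sgV.
rewrite opprD opprK addrACA subrr add0r scalerDr scalerN scaleNr opprK.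
by rewrite scalerA sg_sqr scale1r scaleNr scalerA.
Qed.

Lemma mem_chord c ed i j (U : {vspace {ffun V -> R^o}}) :
  (ed i).1.1 = (ed j).1.1 ->
  (row R c (chord ed i j) \in U) = (rows c ed i - rows c ed j \in U).
Proof. by move=> h; rewrite row_chord // rpredZeq oppr_eq0 (negPf (sg_neq0 _ _ _)). Qed.

(* The removed vertex is replaced by a chord of its star, stored at the index
   [i] that has become free. *)
Lemma reduce_three v W ed S col c i j k : below (#|W| + #|S|) -> v \in W ->
  outward v ed S -> simple ed S -> within W ed S -> dec ed (off v ed S) col ->
  S :\: off v ed S = [set i; j; k] -> i != j -> i != k -> j != k ->
  {in [set i; j; k], forall l, (ed l).1.1 = v /\ (ed l).1.2 != v} ->
  rows c ed i - rows c ed j \notin sp (rows c ed) (class (off v ed S) col c) ->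
  {in off v ed S, forall f, ~~ eqv (chord ed i j) (ed f)} ->
  realizable ed S.
Proof.
move=> IH vW h hs hW hd eS ij ik jk hl dij hf.
set S0 := off v ed S in hd eS dij hf *.
pose ed' l := if l == i then chord ed i j else ed l.
have mi : i \in [set i; j; k] by rewrite !inE eqxx.
have mj : j \in [set i; j; k] by rewrite !inE eqxx orbT.
have [[i1 i2] [j1 j2]] := (hl i mi, hl j mj).
have [iS iS0] : i \in S /\ i \notin S0 by move: mi; rewrite -eS => /setDP.
have [jS jS0] : j \in S /\ j \notin S0 by move: mj; rewrite -eS => /setDP.
have e0 l : l \in S0 -> ed' l = ed l.
  by move=> lS; rewrite /ed' ifN //; apply: contraNneq iS0 => <-.
have ei : ed' i = chord ed i j by rewrite /ed' eqxx.
have sub0 : S0 \subset S := off_sub v ed S.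
have rows0 c' A : A \subset S0 -> {in A, forall l, <[rows c' ed' l]>%VS = <[rows c' ed l]>%VS}.
  by move=> /subsetP hA l /hA lS0; rewrite /rows e0.
pose col' l := if l == i then c else col l.
have cls c' col1 : class (i |: S0) col1 c' = if col1 i == c' then i |: class S0 col1 c'
    else class S0 col1 c'.
  apply/setP => l; rewrite class_mem in_setU1; case: eqVneq => [->|li] /=.
    by case: ifP; rewrite ?in_setU1 class_mem ?eqxx ?(negPf iS0).
  by case: ifP; rewrite ?in_setU1 class_mem ?(negPf li).
have clsS c' col1 := class_sub S0 col1 c'.
have iN c' col1 : i \notin class S0 col1 c'.
  by apply: contra iS0; apply: subsetP (clsS _ _) _.
have [p [p1 p2]] : realizable ed' (i |: S0).
  apply: (IH (W :\ v) _ _ col').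
  - rewrite [#|W|](cardsD1 v) vW add1n addSn ltnS leq_add2l.
    by apply: subset_leq_card; rewrite subUset sub1set iS.
  - move=> l m; rewrite !in_setU1 => /predU1P[->|lS] /predU1P[->|mS]; rewrite ?eqxx // => lm.
    + by rewrite ei e0 // hf.
    + by rewrite ei e0 // eqv_sym hf.
    + by rewrite !e0 //; apply: hs => //; apply: subsetP sub0 _ _.
  - move=> l; rewrite in_setU1 => /predU1P[->|lS].
      rewrite ei /= !in_setD1 i2 j2.
      by have [_ ->] := hW i iS; have [_ ->] := hW j jS.
    by rewrite e0 //; apply: off_within lS.
  - have ecl c' : class S0 col' c' = class S0 col c'.
      by apply: eq_class => l lS0; rewrite /col'; case: eqP => // e; rewrite -e lS0 in iS0.
    have i0 c' : indep (rows c' ed') (class S0 col c').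
      by rewrite (eq_indep (rows0 _ _ (clsS _ _))); apply: hd.
    move=> c'; rewrite cls ecl {1}/col' eqxx; case: eqP => [<-|_ //].
    rewrite indepU1 // i0 (eq_sp (rows0 _ _ (clsS _ _))) {1}/rows ei.
    by rewrite mem_chord // i1 j1.
have hp : realizes ed S0 p.
  split=> [l lS|c'].
    by rewrite -e0 // p1 // in_setU1 lS orbT.
  have -> : class S0 (ycol p ed) c' = class S0 (ycol p ed') c'.
    by apply: eq_class => l lS; rewrite /ycol e0.
  rewrite -(eq_indep (rows0 _ _ (clsS _ _))); apply: indep_sub (p2 c').
  by rewrite cls; case: ifP => _; rewrite ?subsetUr.
(* The realization may have put the chord in either class; the vertex is reinserted using that
   class, which may differ from [c]. *)
apply: (extend_three (c := ycol p ed' i) h hs hp eS) => //.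
have -> : class S0 (ycol p ed) (ycol p ed' i) = class S0 (ycol p ed') (ycol p ed' i).
  by apply: eq_class => l lS; rewrite /ycol e0.
have := p2 (ycol p ed' i); rewrite cls eqxx indepU1 // => /andP[_].
by rewrite (eq_sp (rows0 _ _ (clsS _ _))) {1}/rows ei mem_chord // i1 j1.
Qed.

(** Some class of the remaining edges has at most one element, and a single row cannot have the
    chords from one neighbour to two others, all distinct, among its multiples. No chord is added,
    so this also works when all chords are already present. *)
Lemma reduce_three_small v W ed S col i j k : below (#|W| + #|S|) -> v \in W ->
  outward v ed S -> simple ed S -> within W ed S -> dec ed S col ->
  S :\: off v ed S = [set i; j; k] -> i != j -> i != k -> j != k ->
  {in [set i; j; k], forall l, (ed l).1.1 = v /\ (ed l).1.2 != v} ->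
  (#|off v ed S| <= 3)%N -> (ed i).1.2 != (ed j).1.2 -> (ed i).1.2 != (ed k).1.2 ->
  (ed j).1.2 != (ed k).1.2 -> realizable ed S.
Proof.
move=> IH vW h hs hW hd eS ij ik jk hl c3 nij nik njk.
have [p hp] := off_realizable IH vW h hs hW hd.
have [c hc] : exists c, (#|class (off v ed S) (ycol p ed) c| <= 1)%N.
  have := card_class (off v ed S) (ycol p ed) => e.
  have [hc|hc] : (#|class (off v ed S) (ycol p ed) false| <= 1)%N \/
     (#|class (off v ed S) (ycol p ed) true| <= 1)%N by lia.
    by exists false.
  by exists true.
set U := sp (rows c ed) (class (off v ed S) (ycol p ed) c).
have hi : i \in [set i; j; k] by rewrite !inE eqxx.
have hj : j \in [set i; j; k] by rewrite !inE eqxx orbT.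
have hk : k \in [set i; j; k] by rewrite !inE eqxx orbT.
have [[i1 i2] [j1 j2] [k1 k2]] := And3 (hl i hi) (hl j hj) (hl k hk).
have [x Ux] : exists x, (U <= <[x]>)%VS.
  have [e|[l lC]] := set_0Vmem (class (off v ed S) (ycol p ed) c).
    by exists 0; rewrite /U e sp0 sub0v.
  exists (rows c ed l); apply/sp_subP => m mC.
  by rewrite (card_le1_eqP hc m l mC lC) memv_line.
have [dij|] := boolP (rows c ed i - rows c ed j \in U); last first.
  exact: (extend_three h hs hp eS).
have dik : rows c ed i - rows c ed k \notin U.
  apply/negP => dik.
  have /vlineP[a ea] := subvP Ux _ dij; have /vlineP[b eb] := subvP Ux _ dik.
  have := congr1 (fun y : {ffun V -> R^o} => y (ed j).1.2) ea.
  have := congr1 (fun y : {ffun V -> R^o} => y (ed j).1.2) eb.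
  have := congr1 (fun y : {ffun V -> R^o} => y (ed k).1.2) eb.
  rewrite /rows /row i1 j1 k1 !ffunE !eqxx (negPf j2) (negPf k2).
  rewrite !(eq_sym _ (ed i).1.2) (negPf nij) (negPf nik) (negPf njk).
  have sE (y z : R) : y *: (z : R^o) = y * z by [].
  have := sg_neq0 R c (ed j).2; have := sg_neq0 R c (ed k).2.
  rewrite !sE !mulr0n !mulr1n !mulr0 !mulr1 !subr0 !sub0r !opprK => nk nj hk' hj' hj''.
  move/esym/eqP: hj'; rewrite mulf_eq0 => /orP[] /eqP e0.
    by rewrite hk' e0 mul0r eqxx in nk.
  by rewrite hj'' e0 mulr0 eqxx in nj.
have s3 : [set i; j; k] = [set i; k; j] by apply/setP => l; rewrite !inE orbAC.
rewrite s3 in eS hl.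
by apply: (extend_three (c := c) h hs hp eS) => //; rewrite eq_sym.
Qed.

End Reductions.

(** * Contracting a tight piece *)

Section Cores.
Variables (R : realType) (V I : finType).
Implicit Types (u v w : V) (c : bool) (W H : {set V}) (p : V -> 'rV[R]_2).
Implicit Types (ed : I -> edata V) (S A : {set I}) (col : I -> bool).
Implicit Types (gam : V -> Z2Cs).

Local Notation vec := {ffun V -> R^o}.
Local Notation rows := (@rows R V I).
Local Notation realizable := (@realizable R V I).
Local Notation dec := (@dec R V I).
Local Notation below := (@below R V I).

Definition inner ed S H gam := [set i in S |
  [&& (ed i).1.1 \in H, (ed i).1.2 \in H & balanced gam (ed i)]].

(* A switching [gam] makes enough gains inside [H] trivial for both classes of
   edges to span [H]; such a piece can be realized at an infinitesimal scale. *)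
Definition core ed S col H gam : Prop :=
  forall c, (#|H| <= #|class (inner ed S H gam) col c|.+1)%N.

Lemma eqv_inner ed ed' S H gam : {in S, forall i, eqv (ed i) (ed' i)} ->
  inner ed' S H gam = inner ed S H gam.
Proof.
move=> he; apply/setP => i; rewrite !inE; case iS: (i \in S) => //=.
rewrite (balanced_eqv _ (he i iS)).
by case/orP: (he i iS) => /eqP -> //=; rewrite andbCA.
Qed.

Lemma inner_sub ed S H gam : inner ed S H gam \subset S.
Proof. by apply/subsetP => i; rewrite inE => /andP[]. Qed.

Lemma linear_part_inv g (x : 'rV[R]_2) : linear_part g x = 0 -> x = 0.
Proof.
move=> h; apply: vec2P.
  by have := congr1 (fun y : 'rV[R]_2 => y 0 0) h; rewrite /= linear0E !mxE.
have := congr1 (fun y : 'rV[R]_2 => y 0 1) h; rewrite /= linear1E !mxE => /eqP.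
by rewrite mulf_eq0 (negPf (sg_neq0 _ _ _)) => /eqP.
Qed.

(* Translating all vertices along the reflected axis, in the switched frame,
   keeps the shape of the balanced edges and stretches the reflecting one. *)
Lemma core_whole W ed S col gam : below (#|W| + #|S|) -> W != set0 ->
  simple ed S -> within W ed S -> dec ed S col -> core ed S col W gam ->
  {in S, forall i, balanced gam (ed i)} \/ realizable ed S.
Proof.
move=> IH W0 hs hW hd hc.
have [//|nb] := pselect {in S, forall i, balanced gam (ed i)}; first by left.
right; have [s sS sb] : exists2 s, s \in S & ~~ balanced gam (ed s).
  apply: contrapT => n; apply: nb => i iS; apply/negPn/negP => bi.
  by apply: n; exists i.
set B := inner ed S W gam.
have BP i : (i \in B) = (i \in S) && balanced gam (ed i).
  rewrite inE; case iS: (i \in S) => //=.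
  by have [-> ->] := hW i iS.
have BS c : class B col c \subset class S col c.
  by apply/subsetP => i; rewrite !class_mem BP => /andP[/andP[-> _] ->].
have sB c : s \notin class B col c by rewrite class_mem BP (negPf sb) andbF.
have full c : (#|class S col c| <= #|class B col c|)%N -> class S col c = class B col c.
  by move=> le; apply/eqP; rewrite eq_sym eqEcard BS.
(* The first class has at most |W| - 1 edges and the second at most |W|, and the balanced ones
   number at least |W| - 1 in each. So there is a single unbalanced edge, and it lies in the second
   class. *)
have cF : class S col false = class B col false.
  by apply: full; have := class_false_lt hW hd W0; have := hc false; rewrite -/B; lia.
have st : col s = true.
  apply: contraNT (sB false) => /negPf cs.
  by rewrite -cF class_mem sS cs.
have cT : class S col true = s |: class B col true.
  apply/eqP; rewrite eq_sym eqEcard subUset sub1set class_mem sS st eqxx BS /=.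
  rewrite cardsU1 sB; have := hc true; have := class_le true hW hd; rewrite -/B.
  by lia.
have SB : S :\ s = B.
  apply/setP => i; rewrite in_setD1; case: (boolP (i \in B)) => iB.
    have := iB; rewrite BP => /andP[-> bi]; rewrite andbT.
    by apply: contraNneq sb => <-.
  apply/negP => /andP[is_ iS].
  have : i \in class S col (col i) by rewrite class_mem iS eqxx.
  case: (col i); rewrite ?cF ?cT ?in_setU1 ?(negPf is_) class_mem (negPf iB) //.
have [p [p1 p2]] : realizable ed B.
  apply: (IH W _ _ col); rewrite -?SB.
  - by rewrite ltn_add2l [in X in (_ < X)%N](cardsD1 s) sS.
  - by move=> i j /setD1P[_ iS] /setD1P[_ jS]; apply: hs.
  - by move=> i /setD1P[_]; apply: hW.
  - exact: dec_sub (subsetDl _ _) hd.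
case es: (ed s) => [[u v] g].
(* Were the switched sign of [s] trivial, the signs of [gam] would solve the whole second class,
   which has |W| edges. *)
have rg : sg R true (gam u * g)%g != sg R true (gam v).
  apply/eqP => eg.
  have [w wW] := set0Pn _ W0.
  have le : (#|W| <= #|class S col true|)%N.
    by rewrite cT cardsU1 sB; have := hc true; rewrite -/B; lia.
  suff : (#|class S col true| < #|W|)%N by rewrite ltnNge le.
  have out : {in class S col true, forall i, forall x, x \notin W -> rows true ed i x = 0}.
    move=> i iS; apply: (rows_within R true hW); apply: subsetP iS.
    exact: class_sub.
  apply: (indep_card_lt out (b := fun v => sg R true (gam v)) _ wW _ (hd true)); last first.
    exact: sg_neq0.
  move=> i; rewrite cT in_setU1 => /predU1P[->|].
    by rewrite /rows es pairing_row /= -eg sgM mulrCA sg_sqr mulr1 subrr.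
  by rewrite class_mem BP => /andP[/andP[_ bi] _]; apply: pairing_balanced.
pose P w := act (gam w) (p w).
pose pt t w : 'rV[R]_2 := act (gam w)^-1%g (P w + vec2 0 t).
have lin t (e : edata V) : linear_part (gam e.1.1) (diff (pt t) e) =
    P e.1.1 + vec2 0 t - act (gam e.1.1 * e.2 * (gam e.1.2)^-1)%g (P e.1.2 + vec2 0 t).
  by rewrite -actB /pt actKV -!actM ?mulgA.
have bal t i : i \in B -> strict (diff (pt t) (ed i)) = strict (diff p (ed i)) /\
    ydom (diff (pt t) (ed i)) = ydom (diff p (ed i)).
  rewrite BP => /andP[_ /eqP bi].
  rewrite -(strict_linear (gam (ed i).1.1) (diff (pt t) _)).
  rewrite -(ydom_linear (gam (ed i).1.1) (diff (pt t) _)).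
  rewrite lin bi mulgV act1 opprD addrACA subrr addr0.
  rewrite /P -bi actM actB strict_linear ydom_linear //.
pose h := (gam u * g * (gam v)^-1)%g.
have rh : sg R true h = -1.
  have : sg R true h != 1.
    apply: contra rg => /eqP e; apply/eqP.
    by rewrite -[(gam u * g)%g](mulgVK (gam v)) sgM e mul1r.
  by rewrite /sg; case: ifP; rewrite ?eqxx.
pose K0 := `|(P u - act h (P v)) 0 0|; pose K1 := `|(P u - act h (P v)) 0 1|.
(* The translation adds 2t to the second coordinate of the switched difference of [s] and fixes the
   first; this [t] is large enough for the second to dominate. *)
pose t := K0 + K1 + 1.
have sd : strict (diff (pt t) (ed s)) /\ ydom (diff (pt t) (ed s)).
  have -> : strict (diff (pt t) (ed s)) = strict (linear_part (gam u) (diff (pt t) (ed s))).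
    by rewrite strict_linear.
  have -> : ydom (diff (pt t) (ed s)) = ydom (linear_part (gam u) (diff (pt t) (ed s))).
    by rewrite ydom_linear.
  have := lin t (ed s); rewrite es /= -/h => ->.
  set D := _ - _; suff yd : `|D 0 0| < `|D 0 1|.
    by rewrite /strict /ydom yd lt_eqF.
  have aux (x y : 'rV[R]_2) : let d := x + vec2 0 t - act h (y + vec2 0 t) in
      d 0 0 = (x - act h y) 0 0 /\ d 0 1 = (x - act h y) 0 1 + (t + t).
    rewrite /= !coordB !act0E !act1E rh.
    by split; rewrite !mxE /=; ring.
  have [-> ->] := aux (P u) (P v).
  have k1 := ler_norm (- (P u - act h (P v)) 0 1); rewrite normrN in k1.
  apply: lt_le_trans (ler_norm _); rewrite -/K0.
  have : 0 <= K0 by apply: normr_ge0.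
  have : 0 <= K1 by apply: normr_ge0.
  by move: k1; rewrite -/K1 /t; lra.
have Ssplit i : i \in S -> i = s \/ i \in B.
  move=> iS; case: (eqVneq i s) => [->|is_]; [by left|right].
  by rewrite -SB in_setD1 is_.
exists (pt t); split=> [i /Ssplit[->|iB]|c].
- exact: sd.1.
- by rewrite (bal t i iB).1 p1.
have eB c' : class S (ycol (pt t) ed) c' =
    if c' then s |: class B (ycol p ed) true else class B (ycol p ed) false.
  apply/setP => i; rewrite class_mem.
  case: (boolP (i \in S)) => iS; last first.
    have iB : i \notin B by rewrite BP (negPf iS).
    have is_ : i != s by apply: contraNneq iS => ->.
    by case: c'; rewrite ?in_setU1 ?(negPf is_) class_mem (negPf iB).
  have [e|iB] := Ssplit i iS.
    rewrite e /ycol sd.2; case: c'; rewrite ?in_setU1 ?eqxx //.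
    by rewrite class_mem BP (negPf sb) andbF.
  have is_ : i != s by apply: contraTneq iB => ->; rewrite BP (negPf sb) andbF.
  rewrite /ycol (bal t i iB).2; case: c'; rewrite ?in_setU1 ?(negPf is_) class_mem iB //.
rewrite eB; case: c; last exact: p2.
rewrite indepU1; last by rewrite class_mem BP (negPf sb) andbF.
(* The signs of [gam] annihilate the balanced rows of the second class but not the row of [s]. *)
rewrite p2 /=; apply/negP => /(@pairing_sp R V (fun v => sg R true (gam v))).
have hB : {in class B (ycol p ed) true, forall i,
    pairing (fun v => sg R true (gam v)) (rows true ed i) = 0}.
  by move=> i; rewrite class_mem BP => /andP[/andP[_ bi] _]; apply: pairing_balanced.
move=> /(_ hB)/eqP; rewrite /rows es pairing_row /= subr_eq0 => /eqP eg.
by move: rg; rewrite sgM eg mulrAC sg_sqr mul1r eqxx.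
Qed.


(** * Contraction of rows *)

Section Contraction.
Variables (H : {set V}) (h : V) (gam : V -> Z2Cs).
Hypothesis hH : h \in H.

Definition contract v := if v \in H then h else v.

(** Gains are switched before contracting, so that balanced edges inside [H] become loops of trivial
    gain. *)
Definition quotient_edge (e : edata V) : edata V :=
  (contract e.1.1, contract e.1.2, (gam e.1.1 * e.2 * (gam e.1.2)^-1)%g).

Definition quotient_fun c (x : vec) : vec :=
  \sum_v (sg R c (gam v) * x v) *: dl R (contract v).

Lemma quotient_fun_linear c : linear (quotient_fun c).
Proof.
move=> k x y; rewrite /quotient_fun scaler_sumr -big_split /=.
apply: eq_bigr => v _; rewrite !ffunE scalerA -scalerDl; congr (_ *: _).
by rewrite mulrDr; congr (_ + _); exact: mulrCA.
Qed.

HB.instance Definition _ c :=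
  GRing.isLinear.Build R vec vec *:%R (quotient_fun c) (quotient_fun_linear c).

Definition quotient_map c : 'Hom(vec, vec) := linfun (quotient_fun c).

Lemma quotient_map_dl c v :
  quotient_map c (dl R v) = sg R c (gam v) *: dl R (contract v).
Proof.
rewrite lfunE /= /quotient_fun (bigD1 v) //= big1 => [|w /negPf wv].
  by rewrite ffunE eqxx mulr1 addr0.
by rewrite ffunE wv mulr0 scale0r.
Qed.

Lemma quotient_map_row c e : quotient_map c (row R c e) =
  sg R c (gam e.1.1) *: row R c (quotient_edge e).
Proof.
rewrite /row linearB linearZ /= !quotient_map_dl /= scalerBr !sgM sgV.
by rewrite !scalerA !mulrA sg_sqr mul1r.
Qed.

Lemma contract_in v : v \in H -> contract v = h.
Proof. by rewrite /contract => ->. Qed.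
Lemma contract_notin v : v \notin H -> contract v = v.
Proof. by rewrite /contract => /negPf ->. Qed.

Lemma contract_notin_eq u v : v \notin H -> contract u = v -> u = v.
Proof.
by move=> vH; rewrite /contract; case: ifP => // _ e; rewrite -e hH in vH.
Qed.

Lemma quotient_map_inner c e : e.1.1 \in H -> e.1.2 \in H -> balanced gam e ->
  quotient_map c (row R c e) = 0.
Proof.
move=> h1 h2 /eqP b; rewrite quotient_map_row /row /= !contract_in // b mulgV.
by rewrite sg1 scale1r subrr scaler0.
Qed.

(** The kernel lives on the coordinates of [H], and these coordinates have a nonzero image. *)
Lemma dim_quotient_ker c : (\dim (lker (quotient_map c)) < #|H|)%N.
Proof.
have sub : (lker (quotient_map c) <= sp (@dl R V) H)%VS.
  apply/subvP => x; rewrite memv_ker => /eqP xk; apply: mem_sp_dl => v vH.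
  have := congr1 (fun y : vec => y v) xk; rewrite lfunE /= /quotient_fun sum_ffunE.
  rewrite (bigD1 v) //= big1 => [|w wv]; last first.
    rewrite !ffunE; case: eqVneq => [e|]; last by rewrite [_ *: _]mulr0.
    by rewrite (contract_notin_eq vH (esym e)) eqxx in wv.
  rewrite !ffunE contract_notin // eqxx addr0 [_ *: _]mulr1 => /eqP.
  by rewrite mulf_eq0 (negPf (sg_neq0 _ _ _)) => /eqP.
have := limg_ker_dim (quotient_map c) (sp (@dl R V) H).
rewrite (capv_idPr sub) => e.
have : (0 < \dim (quotient_map c @: sp (@dl R V) H))%N.
  rewrite lt0n dimv_eq0; apply/negP => /eqP z.
  have : quotient_map c (dl R h) \in (quotient_map c @: sp (@dl R V) H)%VS.
    by apply: memv_img; apply: mem_sp.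
  rewrite z memv0 quotient_map_dl scaler_eq0 (negPf (sg_neq0 _ _ _)) /=.
  move=> /eqP/ffunP/(_ (contract h)); rewrite !ffunE eqxx => /eqP.
  by rewrite oner_eq0.
have := dim_sp_le (@dl R V) H; lia.
Qed.

(** The rows of [A] lie in a kernel of dimension at most |H| - 1, and [A] has at least that many
    elements. Rank-nullity then leaves full rank to the remaining rows in the quotient. *)
Lemma indep_quotient c ed (A B : {set I}) : A \subset B ->
  {in A, forall i, [/\ (ed i).1.1 \in H, (ed i).1.2 \in H & balanced gam (ed i)]} ->
  (#|H| <= #|A|.+1)%N -> indep (rows c ed) B ->
  indep (rows c (fun i => quotient_edge (ed i))) (B :\: A).
Proof.
move=> AB hA cA /eqP iB; rewrite /indep eqn_leq dim_sp_le /=.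
have eA : (quotient_map c @: sp (rows c ed) A = 0)%VS.
  rewrite sp_img big1 // => i /hA[h1 h2 h3].
  by rewrite /rows quotient_map_inner //; apply/eqP; rewrite -subv0 -memvE mem0v.
have eB : (quotient_map c @: sp (rows c ed) (B :\: A))%VS =
    sp (rows c (fun i => quotient_edge (ed i))) (B :\: A).
  rewrite sp_img; apply: eq_bigr => i _; rewrite /rows quotient_map_row.
  by rewrite line_scale // sg_neq0.
have e : B = A :|: (B :\: A) by rewrite -{1}(setIidPr AB) setID.
have := limg_ker_dim (quotient_map c) (sp (rows c ed) B).
rewrite {2}e spU limgD eA add0v eB iB.
have := dim_quotient_ker c; have := cardsID A B; rewrite (setIidPr AB).
have : (\dim (sp (rows c ed) B :&: lker (quotient_map c)) <=
        \dim (lker (quotient_map c)))%N by apply/dimvS/capvSr.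
lia.
Qed.

(** Independence of the images makes the span of [B] meet the kernel trivially, and the kernel
    contains the span of [A]. *)
Lemma indep_lift c ed (A B : {set I}) : [disjoint A & B] ->
  {in A, forall i, [/\ (ed i).1.1 \in H, (ed i).1.2 \in H & balanced gam (ed i)]} ->
  indep (rows c ed) A -> indep (rows c (fun i => quotient_edge (ed i))) B ->
  indep (rows c ed) (A :|: B).
Proof.
move=> dAB hA iA /eqP iB.
have eB : (quotient_map c @: sp (rows c ed) B)%VS =
    sp (rows c (fun i => quotient_edge (ed i))) B.
  rewrite sp_img; apply: eq_bigr => i _; rewrite /rows quotient_map_row.
  by rewrite line_scale // sg_neq0.
have := limg_ker_dim (quotient_map c) (sp (rows c ed) B); rewrite eB iB => e.
have le := dim_sp_le (rows c ed) B.
have /eqP iB' : \dim (sp (rows c ed) B) == #|B| by rewrite eqn_leq le; lia.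
have : \dim (sp (rows c ed) B :&: lker (quotient_map c)) == 0%N by lia.
rewrite dimv_eq0 => /eqP k0.
apply: indepU => //; first by rewrite /indep iB'.
apply/eqP; rewrite -subv0 -k0 subv_cap capvSr /=.
apply: subv_trans (capvSl _ _) _; apply/sp_subP => i /hA[h1 h2 h3].
by rewrite memv_ker /rows quotient_map_inner.
Qed.

End Contraction.

End Cores.

(** * Lifting from the quotient and growing a core *)

Section Growth.
Variables (R : realType) (V I : finType).
Implicit Types (u v w : V) (c : bool) (W H : {set V}) (p : V -> 'rV[R]_2).
Implicit Types (ed : I -> edata V) (S A : {set I}) (col : I -> bool).
Implicit Types (gam : V -> Z2Cs).

Local Notation vec := {ffun V -> R^o}.
Local Notation rows := (@rows R V I).
Local Notation realizable := (@realizable R V I).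
Local Notation dec := (@dec R V I).
Local Notation below := (@below R V I).

(* The quotient is realized first; the vertices of [H] are then moved apart by
   an infinitesimal copy of a realization of [H]. *)
Lemma realizable_lift ed S H h gam : h \in H ->
  realizable (fun i => quotient_edge H h gam (ed i)) (S :\: inner ed S H gam) ->
  realizable ed (inner ed S H gam) -> realizable ed S.
Proof.
move=> hH [p' [p1 p2]] [pH [q1 q2]].
set T := inner ed S H gam in p1 p2 q1 q2 *.
set ed' := fun i => quotient_edge H h gam (ed i) in p1 p2 *.
have TP i : i \in T -> [/\ (ed i).1.1 \in H, (ed i).1.2 \in H & balanced gam (ed i)].
  by rewrite inE => /and4P[].
(* At [P0] the differences are those of the quotient edges, up to a linear part; for inner edges
   they vanish. *)
pose P0 v := act (gam v)^-1%g (p' (contract H h v)).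
(* Inside [H] a copy of [pH], translated in the switched frame, so that inner edges keep their
   differences in [pH]. *)
pose P1 v : 'rV[R]_2 :=
  if v \in H then act (gam v)^-1%g (p' h + act (gam v) (pH v)) else P0 v.
have d0 i : linear_part (gam (ed i).1.1) (diff P0 (ed i)) = diff p' (ed' i).
  by rewrite /diff -actB /P0 actKV -!actM ?mulgA.
have dT i : i \in T -> diff P0 (ed i) = 0.
  case/TP => h1 h2 /eqP b; apply: (@linear_part_inv R (gam (ed i).1.1)).
  by rewrite d0 /diff /= !contract_in // b mulgV act1 subrr.
have d1 i : i \in T ->
    linear_part (gam (ed i).1.1) (diff P1 (ed i)) =
    linear_part (gam (ed i).1.1) (diff pH (ed i)).
  case/TP => h1 h2 /eqP b; rewrite /diff -!actB /P1 h1 h2 actKV -!actM b mulgV act1.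
  by rewrite opprD addrACA subrr add0r.
have [t t0 ht] : exists2 t, 0 < t & {in S :\: T, forall i,
    strict (seg t (diff P0 (ed i)) (diff P1 (ed i))) /\
    ydom (seg t (diff P0 (ed i)) (diff P1 (ed i))) = ydom (diff P0 (ed i))}.
  apply/small_ex/small_all => i iS; apply: small_strict.
  by rewrite -(strict_linear (gam (ed i).1.1)) d0 p1.
(* Along the segment the inner differences are only rescaled by [t], so these edges keep the classes
   they have in [pH]. *)
have sT i : i \in T -> diff (pseg t P0 P1) (ed i) = t *: diff P1 (ed i).
  by move=> iT; rewrite diff_pseg dT // /seg scaler0 add0r.
have t1 : t != 0 by rewrite gt_eqF.
have cT i : i \in T -> strict (diff (pseg t P0 P1) (ed i)) /\
    ycol (pseg t P0 P1) ed i = ycol pH ed i.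
  move=> iT; rewrite /ycol sT // strictZ // ydomZ //.
  rewrite -(strict_linear (gam (ed i).1.1)) -(ydom_linear (gam (ed i).1.1)) d1 //.
  by rewrite strict_linear ydom_linear q1.
have cS i : i \in S :\: T -> strict (diff (pseg t P0 P1) (ed i)) /\
    ycol (pseg t P0 P1) ed i = ycol p' ed' i.
  move=> iS; rewrite /ycol diff_pseg; have [-> ->] := ht i iS; split=> //.
  by rewrite -(ydom_linear (gam (ed i).1.1)) d0.
exists (pseg t P0 P1); split=> [i iS|c].
  case: (boolP (i \in T)) => iT; first by have [] := cT i iT.
  by have [] := cS i; rewrite // in_setD iT.
have -> : class S (ycol (pseg t P0 P1) ed) c =
    class T (ycol pH ed) c :|: class (S :\: T) (ycol p' ed') c.
  apply/setP => i; rewrite in_setU !class_mem in_setD.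
  case: (boolP (i \in T)) => iT /=.
    have -> : i \in S by apply: subsetP iT; apply: inner_sub.
    by rewrite orbF (cT i iT).2.
  case iS: (i \in S) => //=; have [|_ ->] // := cS i.
  by rewrite in_setD iT.
apply: (indep_lift (h := h) (gam := gam) hH); [| |exact: q2|exact: p2].
- rewrite -setI_eq0; apply/eqP/setP => i; rewrite in_setI !class_mem in_setD in_set0.
  by case: (i \in T); rewrite ?andbF.
- by move=> i; rewrite class_mem => /andP[/TP].
Qed.

Definition inward H ed S : Prop :=
  {in S, forall i, (ed i).1.2 \in H -> (ed i).1.1 \in H}.

Lemma orient_inward H ed S : exists ed', {in S, forall i, eqv (ed i) (ed' i)} /\
  inward H ed' S.
Proof.
exists (fun i => if (ed i).1.1 \in H then ed i else einv (ed i)); split=> i _.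
  by case: ifP; rewrite ?eqv_inv ?eqv_refl.
by case: ifP => //= ->.
Qed.

(** Two edges that become equivalent have proportional rows, hence different colours. They are not
    loops, since a loop cannot belong to the first class, and they were not equivalent before. So
    both join [H] to the same outer vertex with the same switched gain, and adding that vertex gains
    one edge in each class. *)
Lemma quotient_simple W ed S col H h gam : h \in H -> H \subset W ->
  simple ed S -> within W ed S -> inward H ed S -> core ed S col H gam ->
  dec (fun i => quotient_edge H h gam (ed i)) (S :\: inner ed S H gam) col ->
  simple (fun i => quotient_edge H h gam (ed i)) (S :\: inner ed S H gam) \/
  exists2 v, v \in W :\: H & exists gam', core ed S col (v |: H) gam' /\
    inner ed S H gam = inner ed S H gam'.
Proof.
move=> hH HW hs hW ho hc hd; set T := inner ed S H gam in hd *.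
set ed' := fun i => quotient_edge H h gam (ed i) in hd *.
have [s|ns] := pselect (simple ed' (S :\: T)); [by left|right].
have [i [j [iT jT ij /negPn eij]]] : exists i j,
    [/\ i \in S :\: T, j \in S :\: T, i != j & ~~ ~~ eqv (ed' i) (ed' j)].
  apply: contrapT => n; apply: ns => i j iS jS ij; apply/negP => e; apply: n.
  by exists i, j; split=> //; rewrite e.
have [[iS niT] [jS njT]] := (setDP iT, setDP jT).
have cij : col i != col j.
  apply/eqP => e; have := hd (col i).
  have iC : i \in class (S :\: T) col (col i) by rewrite class_mem iT eqxx.
  have jC : j \in class (S :\: T) col (col i) by rewrite class_mem jT e eqxx.
  move=> /indep_notin/(_ jC); rewrite memvE /rows (line_eqv _ _ eij) -memvE.
  by rewrite (@mem_sp _ _ _ (rows (col i) ed')) // in_setD1 ij.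
have nl k : k \in [set i; j] -> (ed' k).1.1 != (ed' k).1.2.
  move=> kij; apply/negP => /eqP lk.
  have [l [lij cl ll]] : exists l, [/\ l \in [set i; j], col l = false &
      (ed' l).1.1 = (ed' l).1.2].
    have lij : (ed' i).1.1 = (ed' i).1.2 /\ (ed' j).1.1 = (ed' j).1.2.
      move: kij lk; rewrite !inE => /orP[] /eqP -> lk; split=> //.
        by case/orP: eij => /eqP ->.
      by have := eij; rewrite eqv_sym => /orP[] /eqP ->.
    case ci: (col i); last by exists i; rewrite !inE eqxx; split=> //; case: lij.
    exists j; rewrite !inE eqxx orbT; split=> //; last by case: lij.
    by move: cij; rewrite ci; case: (col j).
  have lT : l \in S :\: T by move: lij; rewrite in_set2 => /orP[] /eqP ->.
  by have [] := dec_loop hd lT ll; rewrite cl.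
have nH k : k \in [set i; j] -> k \in S -> (ed k).1.2 \notin H.
  move=> kij kS; apply/negP => k2; have k1 := ho k kS k2.
  by have := nl k kij; rewrite /ed' /= !contract_in ?eqxx.
have i2 := nH i (set21 i j) iS; have j2 := nH j (set22 i j) jS.
have nij := hs i j iS jS ij.
have [e1 e2 e3] : [/\ contract H h (ed j).1.1 = contract H h (ed i).1.1,
    (ed j).1.2 = (ed i).1.2 &
    (gam (ed j).1.1 * (ed j).2 * (gam (ed j).1.2)^-1 =
     gam (ed i).1.1 * (ed i).2 * (gam (ed i).1.2)^-1)%g].
  case/orP: (eij) => /eqP e; have e1 := congr1 (fun x : edata V => x.1.1) e;
    have e2 := congr1 (fun x : edata V => x.1.2) e;
    have e3 : (ed' j).2 = _ := congr1 snd e; rewrite {e}/= in e1 e2.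
    split=> //; by rewrite !contract_notin in e2.
  rewrite (contract_notin _ i2) in e1; rewrite (contract_notin _ j2) in e2.
  have {}e1 := contract_notin_eq hH i2 e1.
  have {}e2 := contract_notin_eq hH j2 (esym e2).
  have {}e3 : (gam (ed j).1.1 * (ed j).2 * (gam (ed j).1.2)^-1 =
     (gam (ed i).1.1 * (ed i).2 * (gam (ed i).1.2)^-1)^-1)%g by [].
  exfalso; move/negP: nij; apply; rewrite /eqv; apply/orP; right; apply/eqP.
  move: e1 e2 e3; case: (ed i) => [[a b] x]; case: (ed j) => [[a' b'] y] /= -> -> e3.
  congr (_, _); apply: (mulgI (gam b)); apply: (mulIg (gam b')^-1%g).
  by rewrite e3 !invgM invgK mulgA.
have i1 : (ed i).1.1 \in H.
  apply/negP => /negP i1; move/negP: nij; apply; rewrite /eqv; apply/orP; left.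
  rewrite (contract_notin h i1) in e1; have {}e1 := contract_notin_eq hH i1 e1.
  apply/eqP; move: e1 e2 e3.
  case: (ed i) => [[a b] x]; case: (ed j) => [[a' b'] y] /= -> -> /mulIg/mulgI -> //.
have j1 : (ed j).1.1 \in H.
  apply/negP => /negP j1; rewrite (contract_notin h j1) (contract_in _ i1) in e1.
  by rewrite e1 hH in j1.
set v := (ed i).1.2 in i2 e2 e3.
have vH w : w \in H -> (w == v) = false.
  by move=> wH; apply: contraNF i2 => /eqP <-.
exists v; first by rewrite in_setD i2; have [_ ->] := hW i iS.
(* The value at [v] makes [i] balanced; the equality [e3] of switched gains makes [j] balanced
   too. *)
pose gam' w := if w == v then (gam (ed i).1.1 * (ed i).2)%g else gam w.
have eT : T = inner ed S H gam'.
  apply/setP => k; rewrite !in_set; case: (k \in S) => //=.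
  case k1: (_ \in H) => //=; case k2: (_ \in H) => //=.
  by rewrite /balanced /gam' !vH.
have bi : i \in inner ed S (v |: H) gam'.
  by rewrite in_set iS !in_setU1 i1 eqxx orbT /= /balanced /gam' eqxx vH.
have bj : j \in inner ed S (v |: H) gam'.
  rewrite in_set jS !in_setU1 j1 e2 eqxx orbT /= /balanced /gam' e2 eqxx vH //.
  by rewrite e2 in e3; apply/eqP; apply: (mulIg (gam v)^-1%g).
have TS : T \subset inner ed S (v |: H) gam'.
  rewrite eT; apply/subsetP => k; rewrite !in_set => /and4P[-> k1 k2 ->].
  by rewrite k1 k2 !orbT.
exists gam'; split=> // c.
have [k [kT kb kc]] : exists k, [/\ k \notin T, k \in inner ed S (v |: H) gam' & col k = c].
  case: (eqVneq (col i) c) => [e|ne]; first by exists i.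
  by exists j; split=> //; move: cij ne; case: c (col i) (col j) => -[] [].
have : (#|k |: class T col c| <= #|class (inner ed S (v |: H) gam') col c|)%N.
  apply/subset_leq_card/subsetP => l; rewrite in_setU1 => /predU1P[->|].
    by rewrite class_mem kb kc eqxx.
  by rewrite !class_mem => /andP[/(subsetP TS) -> ->].
rewrite !cardsU1 class_mem (negPf kT) i2 /= !add1n => le.
by rewrite ltnS; apply: leq_trans (hc c) le.
Qed.

Lemma eqv_core ed ed' S col H gam : {in S, forall i, eqv (ed i) (ed' i)} ->
  core ed S col H gam -> core ed' S col H gam.
Proof. by move=> he hc c; rewrite (eqv_inner _ _ he). Qed.

(** If the quotient is simple, quotient and core are both smaller instances: [1 < #|H|] shrinks the
    former and [H \proper W] the latter. [realizable_lift] combines their realizations. *)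
Lemma core_grow W ed S col H gam : below (#|W| + #|S|) ->
  H \proper W -> (1 < #|H|)%N -> simple ed S -> within W ed S -> dec ed S col ->
  core ed S col H gam -> realizable ed S \/
  exists2 v, v \in W :\: H & exists gam', core ed S col (v |: H) gam' /\
    core ed S col H gam'.
Proof.
move=> IH HW H2 hs hW hd hc.
have [ed' [he ho]] := orient_inward H ed S.
have he' : {in S, forall i, eqv (ed' i) (ed i)} by move=> i /he; rewrite eqv_sym.
have {}hs := simple_eqv he hs; have {}hW := within_eqv he hW.
have {}hd : dec ed' S col by apply: (eq_dec he _ hd).
have {}hc := eqv_core he hc.
suff [r|[v vW [gam' [k1 k2]]]] : realizable ed' S \/
  exists2 v, v \in W :\: H & exists gam', core ed' S col (v |: H) gam' /\
    core ed' S col H gam'.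
- by left; apply: realizable_eqv he' r.
- by right; exists v => //; exists gam'; split; apply: eqv_core he' _.
have sHW : H \subset W by case/andP: HW.
have [h hH] : exists h, h \in H by apply/card_gt0P; lia.
have ltHW := proper_card HW.
have cS := cardsID (inner ed' S H gam) S.
rewrite (setIidPr (inner_sub ed' S H gam)) in cS.
have hdq : dec (fun i => quotient_edge H h gam (ed' i)) (S :\: inner ed' S H gam) col.
  move=> c; have -> : class (S :\: inner ed' S H gam) col c =
      class S col c :\: class (inner ed' S H gam) col c.
    apply/setP => i; rewrite in_setD !class_mem in_setD.
    by case: (col i == c); rewrite ?andbF ?andbT.
  apply: indep_quotient => //.
  - by apply/subsetP => i; rewrite !class_mem => /andP[/(subsetP (inner_sub _ _ _ _)) -> ->].
  - by move=> i; rewrite class_mem in_set => /andP[/and4P[]].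
have [sq|[v vW [gam' [k1 k2]]]] := quotient_simple hH sHW hs hW ho hc hdq; last first.
  by right; exists v => //; exists gam'; split=> // c; rewrite -k2.
left; apply: (realizable_lift hH).
  apply: (IH (h |: (W :\: H)) _ _ col) => //.
  - have := cardsID H W; rewrite (setIidPr sHW) => cW.
    by rewrite cardsU1 in_setD hH /=; lia.
  - exact: sq.
  - move=> i; rewrite in_setD => /andP[_ iS]; have [w1 w2] := hW i iS.
    by rewrite /= /contract; split; case: ifP => wH; rewrite in_setU1 ?eqxx // in_setD wH ?w1 ?w2 orbT.
apply: (IH H _ _ col) => //.
- by lia.
- by move=> i j iS jS; apply: hs; apply: subsetP (inner_sub _ _ _ _) _ _; eassumption.
- by move=> i; rewrite in_set => /and4P[].
- exact: dec_sub (inner_sub _ _ _ _) hd.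
Qed.

(** The core grows one vertex at a time. If it reaches [W] and all edges are balanced, the last
    vertex added has at most one edge in each class, and [low_degree] applies. *)
Lemma core_realizable W ed S col H gam : below (#|W| + #|S|) ->
  H \proper W -> (1 < #|H|)%N -> simple ed S -> within W ed S -> dec ed S col ->
  core ed S col H gam -> realizable ed S.
Proof.
move=> IH; elim: {H}_.+1 {-2}H gam (ltnSn (#|W| - #|H|)) => // n IHn H gam hn.
move=> HW H2 hs hW hd hc.
have [//|[v vWH [gam' [k1 k2]]]] := core_grow IH HW H2 hs hW hd hc.
have /setDP[vW vH] := vWH.
have sHW : H \subset W by case/andP: HW.
have ltHW := proper_card HW.
have svW : v |: H \subset W by rewrite subUset sub1set vW.
have [eW|neW] := eqVneq (v |: H) W; last first.
  apply: (IHn (v |: H) gam') => //.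
  - by rewrite cardsU1 vH; lia.
  - by rewrite properEneq neW.
  - by rewrite cardsU1 vH; lia.
rewrite eW in k1.
have W0 : W != set0 by apply/set0Pn; exists v.
have [bal|//] := core_whole IH W0 hs hW hd k1.
have cW : #|W| = #|H|.+1 by rewrite -eW cardsU1 vH.
(* A balanced class has at most |W| - 1 = |H| edges, and the core on [H] already contains at least
   |H| - 1 of them. *)
have nv c : (#|class S col c :\: inner ed S H gam'| <= 1)%N.
  have sub : class (inner ed S H gam') col c \subset class S col c.
    apply/subsetP => i; rewrite !class_mem => /andP[/(subsetP (inner_sub _ _ _ _)) -> //].
  have := cardsID (inner ed S H gam') (class S col c).
  have -> : class S col c :&: inner ed S H gam' = class (inner ed S H gam') col c.
    apply/setP => i; rewrite in_setI !class_mem.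
    case: (boolP (i \in inner _ _ _ _)) => iT; rewrite ?andbF ?andbT //=.
    by rewrite (subsetP (inner_sub _ _ _ _) _ iT).
  have : (#|class S col c| < #|W|)%N.
    apply: (class_lt (gam := gam') hW hd (subxx _)) => // i.
    by rewrite class_mem => /andP[iS _]; apply: bal.
  by have := k2 c; lia.
have lv : (#|links v ed S :|: loops v ed S| <= 2)%N.
  apply: leq_trans (_ : #|(class S col false :\: inner ed S H gam') :|:
      (class S col true :\: inner ed S H gam')| <= _)%N.
    apply/subset_leq_card/subsetP => i iv.
    have [iS ni] : i \in S /\ i \notin inner ed S H gam'.
      move: iv; rewrite !in_set; case: (i \in S) => //=; split=> //.
      apply/negP => /and3P[h1 h2 _].
      have n1 : ((ed i).1.1 == v) = false by apply: contraNF vH => /eqP <-.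
      have n2 : ((ed i).1.2 == v) = false by apply: contraNF vH => /eqP <-.
      by move: iv; rewrite n1 n2.
    by rewrite in_setU !in_setD ni !class_mem iS; case: (col i).
  apply: leq_trans (leq_card_setU _ _) _.
  by have := nv false; have := nv true; lia.
have L0 : loops v ed S = set0.
  apply/setP => i; rewrite !in_set; apply/negP => /and3P[iS /eqP i1 /eqP i2].
  have [_] : col i /\ reflects (ed i).2 by apply: (dec_loop hd iS); rewrite i1.
  have /eqP := bal i iS; rewrite i1 i2 => e.
  by have -> : (ed i).2 = 1%g by apply: (mulgI (gam' v)); rewrite e mulg1.
rewrite L0 setU0 in lv.
by apply: (low_degree IH vW hs hW hd) => //; rewrite L0 cards0; lia.
Qed.

End Growth.

(** * Realizing a coloured gain graph *)

Section Realization.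
Variables (R : realType) (V I : finType).
Implicit Types (u v w : V) (W H : {set V}) (p : V -> 'rV[R]_2).
Implicit Types (ed : I -> edata V) (S A : {set I}) (col : I -> bool).

Local Notation vec := {ffun V -> R^o}.
Local Notation rows := (@rows R V I).
Local Notation realizable := (@realizable R V I).
Local Notation dec := (@dec R V I).
Local Notation below := (@below R V I).

(** * The star of a vertex of degree three *)

Section Star.
Variables (v : V) (W : {set V}) (ed : I -> edata V) (S : {set I}).
Variables (col : I -> bool) (c : bool) (d : I).
Hypotheses (IH : below (#|W| + #|S|)) (vW : v \in W) (h : outward v ed S).
Hypotheses (hs : simple ed S) (hW : within W ed S) (hd : dec ed S col).
Hypothesis cd : col d = ~~ c.

Let S0 := off v ed S.
Let A := class S0 col c.
Let A' := class S0 col (~~ c).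

Definition star (a b : I) : Prop := [/\ S :\: S0 = [set a; b; d],
  a != b, a != d, b != d & {in [set a; b; d], forall l, (ed l).1.1 = v /\ (ed l).1.2 != v}]
  /\ (col a = c /\ col b = c).

Lemma set3_rot (x y z : I) : [set y; z; x] = [set x; y; z].
Proof. by apply/setP => l; rewrite !inE orbC orbA. Qed.

Lemma subr_cycle (U : zmodType) (x y z : U) : (x - z) - (x - y) = y - z.
Proof. by rewrite opprB addrC subrKA. Qed.

Lemma subr_cancel (U : zmodType) (x y z : U) : (x - z) - (y - z) = x - y.
Proof. by rewrite opprB subrKA. Qed.

Lemma star_sym a b : star a b -> star b a.
Proof.
by move=> [[e ab ad bd hl] [ca cb]]; do 2!split=> //;
  rewrite 1?eq_sym // (_ : [set b; a; d] = [set a; b; d]) // (setUC [set b]).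
Qed.

Let S0S : S0 \subset S. Proof. exact: off_sub. Qed.

Lemma chord_sp a b f c' (B : {set I}) : (ed a).1.1 = v -> (ed b).1.1 = v ->
  f \in B -> eqv (chord ed a b) (ed f) ->
  rows c' ed a - rows c' ed b \in sp (rows c' ed) B.
Proof.
move=> a1 b1 fB e; rewrite -mem_chord ?a1 //.
have := mem_sp (rows c' ed) fB; rewrite memvE /rows (line_eqv _ _ e) -memvE.
by [].
Qed.

Lemma chord_sp_row a b f c' (U : {vspace vec}) : (ed a).1.1 = v -> (ed b).1.1 = v ->
  eqv (chord ed a b) (ed f) -> rows c' ed a - rows c' ed b \in U ->
  rows c' ed f \in U.
Proof.
move=> a1 b1 e; rewrite -mem_chord ?a1 // !memvE -(line_eqv _ c' e).
by [].
Qed.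

Lemma rows_same_tgt a b : (ed a).1.1 = v -> (ed b).1.1 = v ->
  (ed a).1.2 = (ed b).1.2 -> rows false ed a - rows false ed b = 0.
Proof. by move=> a1 b1 e; rewrite /rows /row a1 b1 e !sg_false subrr. Qed.

Lemma eqv_loop (e f : edata V) : eqv e f -> e.1.1 = e.1.2 -> f.1.1 = f.1.2.
Proof. by case/orP => /eqP ->. Qed.

(** With equal neighbours, [f] would be a loop, hence of the second class. Then [c] is the first
    class, where the two rows coincide. *)
Lemma chord_neq a b f : (ed a).1.1 = v -> (ed b).1.1 = v ->
  f \in A' -> eqv (chord ed a b) (ed f) ->
  rows c ed a - rows c ed b \notin sp (rows c ed) A ->
  (ed a).1.2 != (ed b).1.2.
Proof.
move=> a1 b1; rewrite class_mem => /andP[fS /eqP cf] e; apply: contraNneq => ab.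
have [ct _] := dec_loop hd (subsetP S0S _ fS) (eqv_loop e ab).
have -> : c = false by move: ct; rewrite cf; case: (c).
by rewrite rows_same_tgt // mem0v.
Qed.

(* The chords ab, bd and ad are tried in turn; the last one may be added after
   recolouring the edge [g] equivalent to bd. If all three are already present,
   they form with the star a K4 whose gains are trivial after switching. *)
Lemma star_realizable_aux a b f : star a b ->
  rows c ed a - rows c ed b \notin sp (rows c ed) A ->
  rows c ed b - rows c ed d \notin sp (rows c ed) A ->
  f \in A' -> eqv (chord ed a b) (ed f) -> realizable ed S.
Proof.
move=> st dab dbd fA ef; have [[eS ab ad bd hl] [ca cb]] := st.
have [na nb nd] : [/\ a \in [set a; b; d], b \in [set a; b; d] & d \in [set a; b; d]].
  by rewrite !inE !eqxx ?orbT.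
have [[a1 a2] [b1 b2] [d1 d2]] := And3 (hl a na) (hl b nb) (hl d nd).
have nS l : l \in [set a; b; d] -> l \in S /\ l \notin S0.
  by rewrite -eS => /setDP.
have hd0 : dec ed S0 col := dec_sub S0S hd.
have fS : f \in S0 by move: fA; rewrite class_mem => /andP[].
have vab := chord_neq a1 b1 fA ef dab.
have [/exists_inP[g gS eg]|/exists_inPn ng] :=
    boolP [exists g in S0, eqv (chord ed b d) (ed g)]; last first.
  have [ba da] : b != a /\ d != a by rewrite !(eq_sym _ a).
  rewrite -(set3_rot a) in eS hl.
  exact: (reduce_three IH vW h hs hW hd0 eS bd ba da hl dbd ng).
have gA : g \in A'.
  rewrite class_mem gS; case: (eqVneq (col g) c) => [cg|]; last by case: (c); case: (col g).
  by rewrite (chord_sp c b1 d1 _ eg) // class_mem gS cg eqxx in dbd.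
have vbd := chord_neq b1 d1 gA eg dbd.
have fg : f != g.
  apply: contraNneq vab => e; rewrite -e in eg.
  have := eqv_trans ef; rewrite eqv_sym in eg => /(_ _ eg).
  case/orP => /eqP e'.
    have := congr1 (fun x : edata V => x.1.1) e'; rewrite /= => ->.
    by rewrite eqxx.
  have e1 := congr1 (fun x : edata V => x.1.2) e'; rewrite /= in e1.
  have e2 : ((ed b).2^-1 * (ed d).2 = ((ed a).2^-1 * (ed b).2)^-1)%g := congr1 snd e'.
  rewrite invgM invgK in e2; have /mulgI e3 := e2.
  have := hs (nS a na).1 (nS d nd).1 ad; rewrite /eqv.
  suff -> : ed d = ed a by rewrite eqxx.
  by move: a1 d1 e1 e3; case: (ed a) => [[? ?] ?]; case: (ed d) => [[? ?] ?] /= -> -> -> ->.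
(* The chord ab is in this span through [f]; if ad were as well, so would be bd, that is the row of
   [g]. *)
have key : rows (~~ c) ed a - rows (~~ c) ed d \notin sp (rows (~~ c) ed) (A' :\ g).
  apply: contraNN (indep_notin (hd0 (~~ c)) gA) => dad.
  apply: (chord_sp_row b1 d1 eg).
  have dab' : rows (~~ c) ed a - rows (~~ c) ed b \in sp (rows (~~ c) ed) (A' :\ g).
    by apply: (chord_sp (~~ c) a1 b1 _ ef); rewrite in_setD1 fg.
  by have := memvB dad dab'; rewrite subr_cycle.
have [/exists_inP[k kS ek]|/exists_inPn nk] :=
    boolP [exists k in S0, eqv (chord ed a d) (ed k)]; last first.
  (* Moving [g] to class [c], possible as bd is outside the span of [A], makes room for the chord ad
     in the other class. *)
  pose col0 l := if l == g then c else col l.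
  have cl0 : class S0 col0 (~~ c) = A' :\ g.
    apply/setP => l; rewrite in_setD1 !class_mem /col0.
    by case: (eqVneq l g) => //= _; rewrite andbC; case: (c).
  have hd1 : dec ed S0 col0.
    move=> c'; case: (eqVneq c' c) => [->|].
      have cl1 : class S0 col0 c = g |: A.
        apply/setP => l; rewrite in_setU1 !class_mem /col0.
        by case: (eqVneq l g) => [->|] //=; rewrite gS eqxx.
      rewrite cl1 indepU1.
        rewrite (hd0 c) /=; apply: contraNN dbd => gsp.
        rewrite -mem_chord ?b1 // memvE -(line_eqv _ _ eg) -memvE //.
      by move: gA; rewrite !class_mem => /andP[-> /eqP ->]; case: (c).
    move=> n; have -> : c' = ~~ c by move: n; case: (c); case: (c').
    by rewrite cl0; apply: indep_sub (subD1set _ _) (hd0 (~~ c)).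
  have db : d != b by rewrite eq_sym.
  have e3 : [set a; b; d] = [set a; d; b] by apply/setP => l; rewrite !inE orbAC.
  rewrite e3 in eS hl; rewrite -cl0 in key.
  exact: (reduce_three IH vW h hs hW hd1 eS ad ab db hl key nk).
(* With the other colour, [k] would put ad in the span excluded by [key]. *)
have ck : col k = c.
  have [//|nck] := eqVneq (col k) c; exfalso.
  have kA : k \in A' by rewrite class_mem kS; move: nck; case: (c); case: (col k).
  move/negP: key; apply; apply: (chord_sp (~~ c) a1 d1 _ ek).
  rewrite in_setD1 kA andbT; apply: contraNneq vab => e; rewrite e in ek.
  have := eqv_trans ek; rewrite eqv_sym in eg => /(_ _ eg).
  case/orP => /eqP e'.
    by have := congr1 (fun x : edata V => x.1.1) e'; rewrite /= => ->.
  have := congr1 (fun x : edata V => x.1.1) e'; rewrite /= => e1.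
  by rewrite e1 eqxx in vbd.
have vad : (ed a).1.2 != (ed d).1.2.
  apply: contraNneq key => e.
  have [ct _] := dec_loop hd (subsetP S0S _ kS) (eqv_loop ek e).
  have -> : ~~ c = false by move: ct; rewrite ck => ->.
  by rewrite rows_same_tgt // mem0v.
pose H := [set v; (ed a).1.2; (ed b).1.2; (ed d).1.2].
(* The potential makes the three edges at [v] balanced, hence also the three chords. *)
pose gam w := if w == (ed a).1.2 then (ed a).2 else
  if w == (ed b).1.2 then (ed b).2 else
  if w == (ed d).1.2 then (ed d).2 else 1%g.
have gv : gam v = 1%g by rewrite /gam !(eq_sym v) (negPf a2) (negPf b2) (negPf d2).
have ga : gam (ed a).1.2 = (ed a).2 by rewrite /gam eqxx.
have gb : gam (ed b).1.2 = (ed b).2 by rewrite /gam eq_sym (negPf vab) eqxx.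
have gd : gam (ed d).1.2 = (ed d).2.
  by rewrite /gam !(eq_sym (ed d).1.2) (negPf vad) (negPf vbd) eqxx.
have gl l : l \in [set a; b; d] -> gam (ed l).1.2 = (ed l).2.
  by rewrite !inE -orbA => /or3P[] /eqP ->.
have Hl l : l \in [set a; b; d] -> (ed l).1.2 \in H.
  by rewrite !inE -orbA => /or3P[] /eqP ->; rewrite eqxx ?orbT.
have inl l : l \in [set a; b; d] -> l \in inner ed S H gam.
  move=> hl1; have [l1 l2] := hl l hl1; rewrite in_set (nS l hl1).1 (Hl l hl1) l1.
  by rewrite /balanced l1 gv mul1g gl // eqxx !inE eqxx.
have inc l m f' : l \in [set a; b; d] -> m \in [set a; b; d] -> f' \in S0 ->
    eqv (chord ed l m) (ed f') -> f' \in inner ed S H gam.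
  move=> hl1 hm1 fS' e; rewrite in_set (subsetP S0S _ fS') (balanced_eqv _ e).
  have -> : balanced gam (chord ed l m).
    by rewrite /balanced /= !gl // mulVKg.
  by case/orP: e => /eqP -> /=; rewrite !Hl.
have cH : #|H| = 4%N.
  rewrite /H -!setUA !cardsU1 cards1 !inE !negb_or !(eq_sym v).
  by rewrite a2 b2 d2 vab vad vbd.
have off3 l f' : l \in [set a; b; d] -> f' \in S0 -> (f' == l) = false.
  by move=> hl1 fS'; apply: contraTF fS' => /eqP ->; case: (nS l hl1).
have cf : col f = ~~ c by move: fA; rewrite class_mem => /andP[_ /eqP].
have cg : col g = ~~ c by move: gA; rewrite class_mem => /andP[_ /eqP].
(* Class [c] contains a, b, k and the other class d, f, g: three edges each on four vertices. *)
have hc : core ed S col H gam.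
  move=> c'; rewrite cH ltnS; case: (eqVneq c' c) => [->|].
    apply: leq_trans (_ : (#|[set a; b; k]| <= _)%N).
      rewrite -setUA !cardsU1 cards1 !inE negb_or ab (eq_sym a k) (eq_sym b k).
      by rewrite !(off3 _ k).
    apply/subset_leq_card/subsetP => l; rewrite in_setU in_set2 in_set1 -orbA => /or3P[] /eqP ->.
    - by rewrite class_mem inl // ca eqxx.
    - by rewrite class_mem inl // cb eqxx.
    - by rewrite class_mem (inc a d k) // ck eqxx.
  move=> n; have -> : c' = ~~ c by move: n; case: (c); case: (c').
  apply: leq_trans (_ : (#|[set d; f; g]| <= _)%N).
    rewrite -setUA !cardsU1 cards1 !inE negb_or fg !(eq_sym d).
    by rewrite !(off3 d).
  apply/subset_leq_card/subsetP => l; rewrite in_setU in_set2 in_set1 -orbA => /or3P[] /eqP ->.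
  - by rewrite class_mem inl // cd eqxx.
  - by rewrite class_mem (inc a b f) // cf eqxx.
  - by rewrite class_mem (inc b d g) // cg eqxx.
have HW : H \subset W.
  apply/subsetP => w; rewrite !inE -!orbA => /or4P[] /eqP -> //.
  - by have [] := hW (nS a na).1.
  - by have [] := hW (nS b nb).1.
  - by have [] := hW (nS d nd).1.
have [eH|nH] := eqVneq H W; last first.
  apply: (core_realizable IH _ _ hs hW hd hc); first by rewrite properEneq nH.
  by rewrite cH.
have W0 : W != set0 by apply/set0Pn; exists v.
rewrite eH in hc cH.
have [bal|//] := core_whole IH W0 hs hW hd hc.
(* A balanced class on four vertices has at most three edges. So there are at most six edges, three
   of which are at [v]. *)
apply: (reduce_three_small IH vW h hs hW hd eS ab ad bd hl _ vab vad vbd).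
have c3 c' : (#|class S col c'| <= 3)%N.
  rewrite -ltnS -cH; apply: (class_lt (gam := gam) hW hd (subxx _)) => // l.
  by rewrite class_mem => /andP[lS _]; apply: bal.
have := cardsID S0 S; rewrite (setIidPr S0S) eS (card_class S col).
have -> : #|[set a; b; d]| = 3%N by rewrite -setUA !cardsU1 cards1 !inE negb_or ab ad bd.
by move=> e; rewrite -(leq_add2r 3) e; apply: leq_add; apply: c3.
Qed.

(** As [a] and [b] share class [c], the chord ab is free there unless it is already an edge,
    necessarily of the other class. If bd lies in the span of [A], then ad does not, and [a] and [b]
    are exchanged. *)
Lemma star_realizable a b : star a b -> realizable ed S.
Proof.
move=> st; have [[eS ab ad bd hl] [ca cb]] := st.
have [na nb nd] : [/\ a \in [set a; b; d], b \in [set a; b; d] & d \in [set a; b; d]].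
  by rewrite !inE !eqxx ?orbT.
have [[a1 a2] [b1 b2] [d1 d2]] := And3 (hl a na) (hl b nb) (hl d nd).
have nS l : l \in [set a; b; d] -> l \in S /\ l \notin S0.
  by rewrite -eS => /setDP.
have nA l : l \in [set a; b; d] -> l \notin A.
  by move=> /nS[_]; apply: contra; apply: subsetP (class_sub _ _ _) _.
have dab : rows c ed a - rows c ed b \notin sp (rows c ed) A.
  apply: (indep_two_inv h) (class_sub _ _ _) _ (nA b nb) _.
    by rewrite in_setU1 negb_or ab nA.
  apply: indep_sub (hd c); apply/subsetP => l; rewrite !in_setU1.
  case/or3P => [/eqP ->|/eqP ->|]; rewrite !class_mem.
  - by rewrite (nS a na).1 ca eqxx.
  - by rewrite (nS b nb).1 cb eqxx.
  - by case/andP => /(subsetP S0S) -> ->.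
have [/exists_inP[f fS ef]|/exists_inPn nf] :=
    boolP [exists f in S0, eqv (chord ed a b) (ed f)]; last first.
  exact: (reduce_three IH vW h hs hW (dec_sub S0S hd) eS ab ad bd hl dab nf).
have fA : f \in A'.
  rewrite class_mem fS; case: (eqVneq (col f) c) => [cf|]; last by case: (c); case: (col f).
  by rewrite (chord_sp c a1 b1 _ ef) // class_mem fS cf eqxx in dab.
have [dbd|dbd] := boolP (rows c ed b - rows c ed d \in sp (rows c ed) A); last first.
  exact: (star_realizable_aux st dab dbd fA ef).
apply: (star_realizable_aux (star_sym st) _ _ fA).
- by rewrite -opprB memvN.
- apply: contraNN dab => dad; have := memvB dad dbd.
  by rewrite subr_cancel.
- apply: eqv_trans ef; rewrite /eqv; apply/orP; right.
  by rewrite /einv /chord /= invgM invgK.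
Qed.

End Star.

Lemma degree_sum W ed S : within W ed S ->
  (\sum_(v in W) (#|links v ed S| + 2 * #|loops v ed S|) = 2 * #|S|)%N.
Proof.
move=> hW.
have e v : (#|links v ed S| + 2 * #|loops v ed S| =
    \sum_(i in S) (((ed i).1.1 == v) + ((ed i).1.2 == v)))%N.
  rewrite /links /loops -!sum1dep_card mul2n -addnn !big_mkcondr /= -!big_split /=.
  by apply: eq_bigr => i _; do 2!case: (_ == v).
under eq_bigr do rewrite e.
rewrite exchange_big /= mulnC -sum_nat_const; apply: eq_bigr => i iS.
have [h1 h2] := hW i iS; rewrite big_split /=.
have one w : w \in W -> (\sum_(v in W) (w == v) = 1)%N.
  move=> wW; rewrite (bigD1 w) //= eqxx big1 // => v /andP[_ /negPf].
  by rewrite eq_sym => ->.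
by rewrite !one.
Qed.

(** Independence allows at most (|W| - 1) + |W| edges, so the average degree is below four. *)
Lemma exists_low_degree W ed S col : W != set0 -> within W ed S ->
  dec ed S col ->
  exists2 v, v \in W & (#|links v ed S| + 2 * #|loops v ed S| <= 3)%N.
Proof.
move=> W0 hW hd; apply/exists_inP; apply: contraT => /exists_inPn n.
have lt : (#|S| < 2 * #|W|)%N.
  rewrite (card_class S col) mul2n -addnn -addSn.
  by apply: leq_add; [apply: class_false_lt hW hd W0|apply: class_le hW hd].
have : (\sum_(v in W) 4 <= \sum_(v in W) (#|links v ed S| + 2 * #|loops v ed S|))%N.
  by apply: leq_sum => v /n; rewrite -ltnNge.
rewrite degree_sum // sum_nat_const; move: lt; move: #|S| #|W| => x y; lia.
Qed.

(** Two of the three edges share a colour, and the third can be given the other one: if this changes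
    it, all three had the same colour, so it becomes the only edge at [v] in its new class. *)
Lemma degree_three v W ed S col : below (#|W| + #|S|) -> v \in W ->
  simple ed S -> within W ed S -> dec ed S col ->
  #|links v ed S| = 3%N -> loops v ed S = set0 -> realizable ed S.
Proof.
move=> IH vW hs hW hd; have [ed' [he h]] := orient v ed S.
have [<- <-] := eqv_links v he => deg3 L0.
have he' : {in S, forall i, eqv (ed' i) (ed i)} by move=> i /he; rewrite eqv_sym.
apply: (realizable_eqv he').
have {}hs := simple_eqv he hs; have {}hW := within_eqv he hW.
have {he he'}hd : dec ed' S col by apply: (eq_dec he _ hd).
have eN := setD_off h; rewrite L0 setU0 in eN.
have hl : {in links v ed' S, forall l, (ed' l).1.1 = v /\ (ed' l).1.2 != v}.
  by move=> l; rewrite outward_links // inE => /and3P[_ /eqP].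
rewrite -eN in hl deg3; have hN l : l \in S :\: off v ed' S -> l \in S.
  by rewrite in_setD => /andP[].
set N := S :\: off v ed' S in hl deg3 hN eN.
have [a [b [d [eabd ab ad bd ec]]]] : exists a b d,
    [/\ N = [set a; b; d], a != b, a != d, b != d & col a = col b].
  have [a aN] : exists a, a \in N by apply/card_gt0P; rewrite deg3.
  have : #|N :\ a| == 2%N by apply/eqP; move: deg3; rewrite (cardsD1 a) aN add1n => -[].
  case/cards2P => b [d [bd e]].
  have eNs : N = [set a; b; d] by rewrite -setUA -e setD1K.
  have ab : a != b by have : b \in N :\ a by [rewrite e set21]; rewrite eq_sym in_setD1 => /andP[].
  have ad : a != d by have : d \in N :\ a by [rewrite e set22]; rewrite eq_sym in_setD1 => /andP[].
  have [e1|e1] := eqVneq (col a) (col b); first by exists a, b, d.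
  have [e2|e2] := eqVneq (col a) (col d).
    exists a, d, b; split=> //; last by rewrite eq_sym.
    by rewrite eNs; apply/setP => l; rewrite !inE orbAC.
  exists b, d, a; split=> //; [by rewrite (set3_rot a)|by rewrite eq_sym|by rewrite eq_sym|].
  by move: e1 e2; case: (col a); case: (col b); case: (col d).
pose c := col a; pose col' l := if l == d then ~~ c else col l.
have [aN bN dN] : [/\ a \in N, b \in N & d \in N] by rewrite eabd !inE !eqxx ?orbT.
have hd' : dec ed' S col'.
  move=> c'; case: (eqVneq c' c) => [->|n].
    apply: indep_sub (hd c); apply/subsetP => l; rewrite !class_mem /col'.
    by case: (eqVneq l d) => // _; case: (c); rewrite ?andbF.
  have hd0 := dec_sub (off_sub v ed' S) hd.
  have := indep_pendant (c := c') (i := d) h (class_sub (off v ed' S) col c') _ (hd0 c').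
  have [d1 d2] := hl d dN; rewrite rows_src // oner_neq0 => /(_ isT).
  apply: indep_sub; apply/subsetP => l; rewrite in_setU1 !class_mem /col'.
  case: (eqVneq l d) => //= ld /andP[lS /eqP lc].
  rewrite lc eqxx andbT; apply: contraT => lo.
  have : l \in N by rewrite in_setD lo.
  rewrite eabd in_setU in_set2 in_set1 (negPf ld) orbF.
  by case/orP => /eqP e; move: n; rewrite -lc e -?ec /c eqxx.
apply: (star_realizable (c := c) (d := d) IH vW h hs hW hd' _ (a := a) (b := b)).
  by rewrite /col' eqxx.
rewrite /star -/N -eabd; do 2!split=> //.
  by rewrite /col' (negPf ad).
by rewrite /col' (negPf bd) -ec.
Qed.

Theorem simple_realizable W ed S col : simple ed S -> within W ed S ->
  dec ed S col -> realizable ed S.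
Proof.
suff main n : below n by apply: (main (#|W| + #|S|).+1).
elim: n => [//|n IHn] {}W {}ed {}S {}col le hs hW hd.
have IH : below (#|W| + #|S|).
  move=> W' ed' S' col' lt; apply: IHn; exact: leq_trans lt le.
have [W0|W0] := eqVneq W set0.
  have S0 : S = set0.
    apply/setP => i; rewrite in_set0; apply/negP => /hW[].
    by rewrite W0 in_set0.
  exists (fun _ => 0); rewrite S0; split=> [i|c]; first by rewrite in_set0.
  by apply: indep_sub (indep0 _); rewrite class_sub.
have [v vW deg] := exists_low_degree W0 hW hd.
have [le2|gt2] := leqP #|links v ed S| 2; first exact: (low_degree IH vW hs hW hd).
have [L3 L0] : #|links v ed S| = 3%N /\ #|loops v ed S| = 0%N by lia.
by apply: (degree_three IH vW hs hW hd) => //; apply/eqP; rewrite -cards_eq0 L0.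
Qed.

End Realization.

(** * Colouring a sparse gain graph *)

Lemma indep_dl (R : realType) (T : finType) (A : {set T}) : indep (@dl R T) A.
Proof.
elim: {A}#|A| {-2}A (erefl #|A|) => [|n IH] A cA.
  by rewrite (cards0_eq cA) indep0.
have [i iA] : exists i, i \in A by apply/card_gt0P; rewrite cA.
rewrite -(setD1K iA) indepU1 ?setD11 // IH /=; last first.
  by move: cA; rewrite (cardsD1 i) iA add1n => -[].
apply/negP => /(@sp_coord0 R T T (@dl R T) (A :\ i) (dl R i) i); rewrite !ffunE eqxx.
suff h : {in A :\ i, forall j, dl R j i = 0} by move/(_ h)/eqP; rewrite oner_eq0.
by move=> j; rewrite in_setD1 ffunE eq_sym => /andP[/negPf ->].
Qed.

Lemma dim_sp_dl (R : realType) (T : finType) (A : {set T}) :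
  \dim (sp (@dl R T) A) = #|A|.
Proof. exact/eqP/indep_dl. Qed.

Section Walks.
Variable G : gain_graph.
Implicit Types (E F : {set edge G}) (s : seq (step G)) (u v w : vertex G).

Lemma walk_cat E u v w s s' : is_walk E u s v -> is_walk E v s' w ->
  is_walk E u (s ++ s') w.
Proof. by elim: s u => [|x s IH] u /= => [-> //|[h1 h2 h3] h]; split=> //; apply: IH. Qed.

Lemma net_gain_cat s s' : net_gain (s ++ s') = (net_gain s * net_gain s')%g.
Proof. by elim: s => [|x s IH] /=; rewrite ?mul1g // IH mulgA. Qed.

Definition flip_step (x : step G) : step G := (x.1, ~~ x.2).

Lemma flip_step_gain x : step_gain (flip_step x) = (step_gain x)^-1%g.
Proof. by rewrite /step_gain /=; case: x.2 => //=; rewrite invgK. Qed.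

Lemma walk_flip E u v s : is_walk E u s v ->
  exists2 s', is_walk E v s' u & net_gain s' = (net_gain s)^-1%g.
Proof.
elim: s u => [|x s IH] u /=; first by move=> ->; exists [::] => //=; rewrite invg1.
case=> h1 h2 /IH[s' h3 h4]; exists (s' ++ [:: flip_step x]).
  apply: walk_cat h3 _; split=> //=; first by rewrite /step_src /step_tgt /=; case: x.2.
  by rewrite -h2 /step_src /step_tgt /=; case: x.2.
by rewrite net_gain_cat /= mulg1 h4 flip_step_gain invgM.
Qed.

Lemma closed_walks_translation E v :
  (forall s, is_walk E v s v -> is_translation (net_gain s)) ->
  forall g, gain_space E v g -> is_translation g.
Proof.
rewrite /is_translation => h g; elim=> {g} [g [s /h + <-] //|//|g k _ hg _ hk|g _ hg].
- by rewrite /= hg hk.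
- by rewrite /= hg.
Qed.

End Walks.

Section RankCondition.
Variables (R : realType) (G : gain_graph).
Implicit Types (E F : {set edge G}) (s : seq (step G)) (u v w : vertex G) (c : bool).

Definition edge_data (e : edge G) : edata (vertex G) := (src e, tgt e, gain e).

Local Notation erows c := (@rows R (vertex G) (edge G) c edge_data).
Local Notation dl := (@dl R (vertex G)).

Lemma edge_data_simple : simple edge_data [set: edge G].
Proof.
move=> e f _ _ /eqP ef; apply/negP => /orP[] /eqP h.
  have h1 := congr1 (fun x : edata _ => x.1.1) h; have h2 := congr1 (fun x : edata _ => x.1.2) h.
  have h3 : gain f = gain e := congr1 snd h.
  exact: (parallel_gain ef (esym h1) (esym h2) (esym h3)).
have h1 := congr1 (fun x : edata _ => x.1.1) h; have h2 := congr1 (fun x : edata _ => x.1.2) h.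
have h3 : gain f = (gain e)^-1%g := congr1 snd h.
by apply: (antiparallel_gain ef (esym h2) (esym h1)); rewrite h3 invgK.
Qed.

Definition support F := [set v | [exists e in F, (src e == v) || (tgt e == v)]].

Lemma support_subgraph F : is_subgraph (support F) F.
Proof.
by move=> e eF; split; rewrite inE; apply/exists_inP; exists e; rewrite ?eqxx ?orbT.
Qed.

Lemma walk_rows F u s v : is_walk F u s v ->
  dl u - sg R true (net_gain s) *: dl v \in sp (erows true) F.
Proof.
elim: s u => [|x s IH] u /=.
  by move=> ->; rewrite sg1 scale1r subrr mem0v.
case=> xF <- /IH h.
have hx : dl (step_src x) - sg R true (step_gain x) *: dl (step_tgt x) \in sp (erows true) F.
  have xr := mem_sp (erows true) xF; rewrite /step_src /step_tgt /step_gain.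
  case: x.2 => //=; have := memvZ (- sg R true (gain x.1)) xr.
  by rewrite /rows -(row_inv R true (edge_data x.1)).
have := memvD hx (memvZ (sg R true (step_gain x)) h).
by rewrite scalerBr addrA subrK scalerA -sgM.
Qed.

(** A linear stand-in for a connected component: it contains that of [v], is closed along edges, and
    yields the bound of [rank_connected] directly. *)
Definition reach c F v := [set w | dl w \in (sp (erows c) F + <[dl v]>)%VS].

Lemma reach_refl c F v : v \in reach c F v.
Proof. by rewrite inE (subvP (addvSr _ _)) // memv_line. Qed.

Lemma reach_edge c F v e : e \in F -> (src e \in reach c F v) = (tgt e \in reach c F v).
Proof.
move=> eF; rewrite !inE; set U := (_ + _)%VS.
have h : erows c e \in U by apply: (subvP (addvSl _ _)); apply: mem_sp.
have e1 : dl (src e) = erows c e + sg R c (gain e) *: dl (tgt e).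
  by rewrite /rows /row subrK.
by rewrite e1 rpredDl // rpredZeq (negPf (sg_neq0 _ _ _)).
Qed.

(** The two sets of rows have disjoint supports. *)
Lemma rank_split (C : {set vertex G}) F c :
  {in F, forall e, (src e \in C) = (tgt e \in C)} ->
  \dim (sp (erows c) F) = (\dim (sp (erows c) [set e in F | src e \in C]) +
                          \dim (sp (erows c) [set e in F | src e \notin C]))%N.
Proof.
move=> hC; set F1 := finset _; set F2 := [set e in F | src e \notin C].
have -> : F = F1 :|: F2.
  by apply/setP => e; rewrite !inE; case: (e \in F) => //=; rewrite orbN.
rewrite spU dimv_disjoint_sum //; apply/eqP; rewrite -subv0; apply/subvP => x.
rewrite memv_cap memv0 => /andP[x1 x2]; apply/eqP/ffunP => w; rewrite ffunE.
case: (boolP (w \in C)) => wC.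
  apply: (sp_coord0 (v := w)) x2 => e; rewrite inE => /andP[eF eC].
  apply: row_out; first by apply: contraNneq eC => /= <-.
  by rewrite hC // in eC; apply: contraNneq eC => /= <-.
apply: (sp_coord0 (v := w)) x1 => e; rewrite inE => /andP[eF eC].
apply: row_out; first by apply: contraNneq wC => /= ->.
by rewrite hC // in eC; apply: contraNneq wC => /= ->.
Qed.

Lemma rank_connected c F v : support F \subset reach c F v ->
  (#|support F| <= (dl v \notin sp (erows c) F) + \dim (sp (erows c) F))%N.
Proof.
move=> /subsetP h; rewrite -dimv_add_line addvC -(dim_sp_dl R (support F)).
by apply/dimvS/sp_subP => w /h; rewrite inE.
Qed.

(** Both sides are additive over a splitting. In the connected case each rank is at least |support
    F| - 1, which suffices unless |F| = 2|support F| - 1. Then [F] is not purely periodic, and a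
    reflecting closed walk gives the second class full rank. *)
Lemma tight_rank_condition F : Z2Cs_q_tight G ->
  (#|F| <= \dim (sp (erows false) F) + \dim (sp (erows true) F))%N.
Proof.
move=> [[sp1 _] sp2]; elim: {F}_.+1 {-2}F (ltnSn #|F|) => // n IH F /ltnSE Fn.
have [->|[e0 e0F]] := set_0Vmem F; first by rewrite cards0.
have [conn|] := pselect (forall c v, v \in support F -> support F \subset reach c F v); last first.
  move=> /existsNP[c /existsNP[v /not_implyP[vF /negP/subsetPn[w wF wC]]]].
  have hC : {in F, forall e, (src e \in reach c F v) = (tgt e \in reach c F v)}.
    by move=> e; apply: reach_edge.
  rewrite !(rank_split _ hC); set F1 := [set e in F | src e \in _].
  set F2 := [set e in F | src e \notin _].
  have cF : (#|F1| + #|F2| = #|F|)%N.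
    rewrite -(cardsID [set e | src e \in reach c F v] F); congr (_ + _)%N.
      by apply: eq_card => e; rewrite !in_set.
    by apply: eq_card => e; rewrite !in_set andbC.
  have [e1 e1F] : exists e, e \in F1.
    move: vF; rewrite inE => /exists_inP[e eF /orP[] /eqP ev]; exists e.
      by rewrite in_set eF ev reach_refl.
    by rewrite in_set eF hC // ev reach_refl.
  have [e2 e2F] : exists e, e \in F2.
    move: wF; rewrite inE => /exists_inP[e eF /orP[] /eqP ev]; exists e.
      by rewrite in_set eF ev wC.
    by rewrite in_set eF hC // ev wC.
  have p1 : (0 < #|F1|)%N by apply/card_gt0P; exists e1.
  have p2 : (0 < #|F2|)%N by apply/card_gt0P; exists e2.
  have h1 : (#|F1| < n)%N by apply: leq_trans Fn; rewrite -cF -addn1 leq_add2l.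
  have h2 : (#|F2| < n)%N by apply: leq_trans Fn; rewrite -cF -add1n leq_add2r.
  by rewrite -cF addnACA; apply: leq_add; apply: IH.
have F0 : (1 <= #|F|)%N by apply/card_gt0P; exists e0.
have sub : is_subgraph (support F) F by exact: support_subgraph.
have v0 : src e0 \in support F by have [] := sub _ e0F.
have le1 : (#|F| < 2 * #|support F|)%N.
  have := sp1 _ _ sub (subsetT _) (subsetT _) F0; lia.
have rk c := leq_trans (rank_connected (conn c _ v0)) (leq_add (leq_b1 _) (leqnn _)).
have [lt|ge] := ltnP #|F|.+1 (2 * #|support F|)%N.
  by have := rk false; have := rk true; lia.
have [v vF [s sw sr]] : exists2 v, v \in support F &
    exists2 s, is_walk F v s v & reflects (net_gain s).
  apply: contrapT => n0.
  have pp : purely_periodic (support F) F.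
    move=> v vF; apply: closed_walks_translation => s sw.
    rewrite /is_translation; apply: contra_notF n0 => sr.
    by exists v => //; exists s.
  by have := sp2 _ _ sub pp _ _ sub (subxx _) (subxx _) F0; lia.
(* The rows telescope along the reflecting closed walk to twice [dl v]. *)
have dv : dl v \in sp (erows true) F.
  have := walk_rows sw; rewrite /sg sr /= scaleN1r opprK -mulr2n -scaler_nat rpredZeq.
  by rewrite pnatr_eq0.
have := rank_connected (conn true _ vF); rewrite dv /=.
by have := rk false; lia.
Qed.

Lemma tight_coloring : Z2Cs_q_tight G ->
  exists col, dec R edge_data [set: edge G] col.
Proof.
move=> tG; have [|B _ [B1 B2]] := matroid_partition (A := [set: edge G])
  (rank_function_sp (erows false)) (rank_function_sp (erows true)).
  by move=> B _; apply: tight_rank_condition.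
exists (fun e => e \notin B) => -[].
  rewrite (_ : class _ _ _ = setT :\: B); first exact/eqP.
  by apply/setP => e; rewrite class_mem !inE; case: (e \in B).
rewrite (_ : class _ _ _ = B); first exact/eqP.
by apply/setP => e; rewrite class_mem !inE; case: (e \in B).
Qed.

End RankCondition.

(** * Symmetric motions *)

Section Motions.
Variables (R : realType) (G : gain_graph).
Implicit Types (E F : {set edge G}) (e f : edge G) (v w : vertex G).
Implicit Types (p : vertex G -> 'rV[R]_2) (u : dvertex G -> 'rV[R]_2).

Local Notation flex := {ffun vertex G * bool -> R^o}.
Local Notation load := {ffun edge G -> R^o}.
Implicit Types m : flex.

Definition sym_extend m (x : dvertex G) : 'rV[R]_2 :=
  linear_part x.1 (vec2 (m (x.2, false)) (m (x.2, true))).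

Definition restrict u : flex :=
  [ffun vb => if vb.2 then u (1%g, vb.1) 0 1 else u (1%g, vb.1) 0 0].

Lemma linear_partM g h (x : 'rV[R]_2) :
  linear_part (g * h)%g x = linear_part g (linear_part h x).
Proof. by apply: vec2P; rewrite ?linear0E ?linear1E ?sgM ?mulrA. Qed.

Lemma linear_partB g (x y : 'rV[R]_2) :
  linear_part g (x - y) = linear_part g x - linear_part g y.
Proof.
by apply: vec2P; rewrite !coordB ?linear0E ?linear1E !coordB // mulrBr.
Qed.

Lemma sym_extend_sym m : sym_map (sym_extend m).
Proof. by move=> g x; rewrite /sym_extend linear_partM. Qed.

Lemma restrictK u : sym_map u -> forall x, u x = sym_extend (restrict u) x.
Proof.
move=> h [g v]; have -> : (g, v) = dact g (1%g, v) by rewrite /dact mulg1.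
rewrite h sym_extend_sym; congr linear_part.
by apply: vec2P; rewrite /sym_extend ?linear0E ?linear1E ?sg1 ?mul1r !mxE /= !ffunE.
Qed.

(** One scalar per edge orbit, read at the edge from (1, src e) to (gain e, tgt e); by
    [orbit_motion] the other edges of the orbit give an equivalent condition. *)
Definition constraint p e m : R :=
  let c := ydom (diff p (edge_data e)) in
  if strict (diff p (edge_data e)) then m (src e, c) - sg R c (gain e) * m (tgt e, c)
  else 0.

Lemma dot_kappa (d x : 'rV[R]_2) : dot (kappa d) x =
  if strict d then (if ydom d then x 0 1 else x 0 0) else 0.
Proof.
rewrite /dot big_ord_recl big_ord1 /kappa /strict /ydom.
have -> : lift ord0 ord0 = 1 :> 'I_2 by apply: val_inj.
case: (ltgtP `|d 0 0| `|d 0 1|) => /= _; rewrite !mxE /=;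
  by rewrite ?mul0r ?mul1r ?add0r ?addr0.
Qed.

Lemma dot_linear g (d x : 'rV[R]_2) :
  dot (kappa (linear_part g d)) (linear_part g x) =
  sg R (ydom d) g * dot (kappa d) x.
Proof.
rewrite !dot_kappa strict_linear ydom_linear; case: ifP; last by rewrite mulr0.
by case: ifP => h _; rewrite ?linear0E ?linear1E ?sg_false ?mul1r.
Qed.

Lemma kappaN (d : 'rV[R]_2) : kappa (- d) = kappa d.
Proof. by rewrite /kappa !mxE !normrN. Qed.

Lemma dot_kappaN (d x : 'rV[R]_2) : dot (kappa (- d)) (- x) = - dot (kappa d) x.
Proof.
by rewrite kappaN /dot -sumrN; apply: eq_bigr => i _; rewrite !mxE mulrN.
Qed.

Lemma dposition_edge p g e :
  dposition p (g, src e) - dposition p ((g * gain e)%g, tgt e) =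
  linear_part g (diff p (edge_data e)).
Proof. by rewrite /dposition /= actM actB. Qed.

Lemma sym_extend_edge p g e m :
  dot (kappa (linear_part g (diff p (edge_data e))))
      (sym_extend m (g, src e) - sym_extend m ((g * gain e)%g, tgt e)) =
  sg R (ydom (diff p (edge_data e))) g * constraint p e m.
Proof.
have -> : sym_extend m (g, src e) - sym_extend m ((g * gain e)%g, tgt e) =
    linear_part g (sym_extend m (1%g, src e) - sym_extend m (gain e, tgt e)).
  rewrite linear_partB -!sym_extend_sym /dact /= mulg1.
  by [].
rewrite dot_linear; congr (_ * _); rewrite dot_kappa /constraint.
case: ifP => // _; rewrite !coordB /sym_extend /=.
by case: ifP => _; rewrite ?linear0E ?linear1E !mxE /= ?sg1 ?mul1r.
Qed.

Lemma orbit_motion p e m x y : edge_orbit e x y ->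
  (dot (kappa (dposition p x - dposition p y)) (sym_extend m x - sym_extend m y) = 0 <->
   constraint p e m = 0).
Proof.
have key g : sg R (ydom (diff p (edge_data e))) g * constraint p e m = 0 <->
    constraint p e m = 0.
  split=> [/eqP|->]; last exact: mulr0.
  by rewrite mulf_eq0 (negPf (sg_neq0 _ _ _)) => /eqP.
case=> g [] [-> ->]; rewrite -1?(opprB (dposition p (g, src e))) -1?(opprB (sym_extend m (g, src e))).
  by rewrite dposition_edge sym_extend_edge.
rewrite dot_kappaN dposition_edge sym_extend_edge.
by split=> [/eqP|/key ->]; rewrite ?oppr0 // oppr_eq0 => /eqP/key.
Qed.

Lemma sym_extend_motion p m : (forall e, constraint p e m = 0) ->
  sym_inf_motion (@dedge G) p (sym_extend m).
Proof.
move=> h; split; last exact: sym_extend_sym.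
by move=> x y [e exy]; apply/(orbit_motion p m exy)/h.
Qed.

Lemma motion_constraint p m e : inf_motion (@dedge G) (dposition p) (sym_extend m) ->
  constraint p e m = 0.
Proof.
have o : edge_orbit e (1%g, src e) ((1 * gain e)%g, tgt e) by exists 1%g; left.
by move=> /(_ _ _ (ex_intro _ e o)) /(orbit_motion p m o).
Qed.

Lemma sym_extend_motion_minus p m e : (forall f, f != e -> constraint p f m = 0) ->
  sym_inf_motion (dedge_minus e) p (sym_extend m).
Proof.
move=> h; split; last exact: sym_extend_sym.
move=> x y [[f fxy] ne]; apply/(orbit_motion p m fxy)/h.
by apply/eqP => fe; apply: ne; rewrite -fe.
Qed.

(** The representative edge of [f] survives the removal of the orbit of [e]: otherwise [e] and [f]
    would be parallel with equal gains, up to orientation. *)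
Lemma motion_minus_constraint p m e f :
  inf_motion (dedge_minus e) (dposition p) (sym_extend m) -> f != e ->
  constraint p f m = 0.
Proof.
move=> h /eqP fe.
have o : edge_orbit f (1%g, src f) (gain f, tgt f).
  by exists 1%g; left; rewrite mul1g.
apply/(orbit_motion p m o)/h; split; first by exists f.
case=> g [] [ex ey]; have ex2 := congr1 snd ex; have ey2 := congr1 snd ey.
  have ex1 : 1%g = g := congr1 fst ex.
  have ey1 : gain f = (g * gain e)%g := congr1 fst ey.
  by apply: (parallel_gain fe ex2 ey2); rewrite ey1 -ex1 mul1g.
have ex1 : gain f = g := congr1 fst ex.
have ey1 : 1%g = (g * gain e)%g := congr1 fst ey.
by apply: (antiparallel_gain fe ey2 ex2); apply: (mulIg (gain e)); rewrite mulVg ex1.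
Qed.

Definition shift : flex := [ffun vb => if vb.2 then 0 else 1].

Lemma sym_extend_shift x : sym_extend shift x = vec2 1 0.
Proof.
by apply: vec2P; rewrite /sym_extend ?linear0E ?linear1E !mxE /= !ffunE //= mulr0.
Qed.

Lemma trivial_sym_extend m : trivial_motion (sym_extend m) <-> m \in <[shift]>%VS.
Proof.
split=> [[a h]|/vlineP[k ->]].
  have h0 v : m (v, false) = a 0 0.
    by rewrite -(h (1%g, v)) /sym_extend linear0E mxE.
  have h1 v : m (v, true) = 0.
    (* The pure reflection forces a constant symmetric map to have second coordinate zero. *)
    have := h (MkZ2Cs 0 0 true, v); rewrite -(h (1%g, v)) => e.
    have := congr1 (fun z : 'rV[R]_2 => z 0 1) e.
    rewrite /sym_extend !linear1E /sg /= !mxE /= mul1r mulN1r => /eqP.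
    by rewrite eq_sym -addr_eq0 -mulr2n mulrn_eq0 => /eqP.
  apply/vlineP; exists (a 0 0); apply/ffunP => -[v []]; rewrite !ffunE /=.
    by rewrite h1 scaler0.
  by rewrite h0 [_ *: _]mulr1.
exists (vec2 k 0) => x; apply: vec2P; rewrite /sym_extend ?linear0E ?linear1E !mxE /= !ffunE /=.
  by rewrite [_ *: _]mulr1.
by rewrite scaler0 mulr0.
Qed.

Lemma shift_neq0 : shift != 0.
Proof.
have /card_gt0P[v _] := vertex_gt0 G.
apply/eqP => /ffunP/(_ (v, false)); rewrite !ffunE /= => /eqP.
by rewrite oner_eq0.
Qed.

Lemma constraint_shift p e : constraint p e shift = 0.
Proof.
rewrite /constraint; case: ifP => // _; rewrite !ffunE /=.
by case: (ydom _); rewrite ?mulr0 ?subrr // sg_false mul1r subrr.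
Qed.

(** The orbit rigidity matrix, with the rows outside [F] replaced by zero. *)
Definition load_fun p F m : load := [ffun e => if e \in F then constraint p e m else 0].

Lemma constraint_linear p e (k : R) m m' :
  constraint p e (k *: m + m') = k * constraint p e m + constraint p e m'.
Proof.
rewrite /constraint; case: ifP => _; last by rewrite mulr0 addr0.
have sE (y z : R) : y *: (z : R^o) = y * z by [].
by rewrite !ffunE !sE; ring.
Qed.

Lemma load_fun_linear p F : linear (load_fun p F).
Proof.
move=> k m m'; apply/ffunP => e; rewrite !ffunE.
case: ifP => _; first exact: constraint_linear.
by rewrite scaler0 addr0.
Qed.

HB.instance Definition _ p F :=
  GRing.isLinear.Build R flex load *:%R (load_fun p F) (load_fun_linear p F).

Definition load_map p F : 'Hom(flex, load) := linfun (load_fun p F).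

Lemma load_mapE p F m e :
  load_map p F m e = if e \in F then constraint p e m else 0.
Proof. by rewrite lfunE /= ffunE. Qed.

Lemma load_kerP p F m :
  reflect {in F, forall e, constraint p e m = 0} (m \in lker (load_map p F)).
Proof.
rewrite memv_ker; apply: (iffP eqP) => [h e eF|h].
  by have := congr1 (fun z : load => z e) h; rewrite load_mapE eF ffunE.
by apply/ffunP => e; rewrite load_mapE ffunE; case: ifP => // /h.
Qed.

Lemma full_dl (T : finType) : (fullv = sp (@dl R T) [set: T])%VS.
Proof.
apply/eqP; rewrite eqEsubv subvf andbT; apply/subvP => x _.
by apply: mem_sp_dl => v; rewrite inE.
Qed.

Lemma load_img_le p F (U : {vspace flex}) : (\dim (load_map p F @: U) <= #|F|)%N.
Proof.
rewrite -(dim_sp_dl R F); apply: dimvS; apply/subvP => _ /memv_imgP[m _ ->].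
by apply: mem_sp_dl => e /negPf eF; rewrite load_mapE eF.
Qed.

Lemma dim_flex : \dim {: flex} = (2 * #|vertex G|)%N.
Proof. by rewrite full_dl dim_sp_dl cardsT card_prod card_bool mulnC. Qed.

Lemma rigidP p : sym_inf_rigid (@dedge G) p <->
  (lker (load_map p [set: edge G]) <= <[shift]>)%VS.
Proof.
split=> [h|/subvP h u [hu su]].
  apply/subvP => m /load_kerP hm; apply/trivial_sym_extend/h/sym_extend_motion => e.
  by apply: hm; rewrite inE.
have e := restrictK su.
have : sym_extend (restrict u) = u by apply/funext => x; rewrite -e.
move=> <-; apply/trivial_sym_extend/h/load_kerP => f _; apply: motion_constraint.
by move=> x y xy; rewrite -!e; apply: hu.
Qed.

Lemma rigid_minusP p e : sym_inf_rigid (dedge_minus e) p <->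
  (lker (load_map p [set~ e]) <= <[shift]>)%VS.
Proof.
split=> [h|/subvP h u [hu su]].
  apply/subvP => m /load_kerP hm; apply/trivial_sym_extend/h/sym_extend_motion_minus => f fe.
  by apply: hm; rewrite !inE.
have eu := restrictK su.
have : sym_extend (restrict u) = u by apply/funext => x; rewrite -eu.
move=> <-; apply/trivial_sym_extend/h/load_kerP => f; rewrite !inE => fe.
apply: motion_minus_constraint fe.
by move=> x y xy; rewrite -!eu; apply: hu.
Qed.

(** Only 2|V| - 2 orbits remain, whatever the positions, so the kernel has dimension at least
    two. *)
Lemma tight_not_rigid_minus p e : #|edge G| = (2 * #|vertex G| - 1)%N ->
  ~ sym_inf_rigid (dedge_minus e) p.
Proof.
move=> cE /rigid_minusP /dimvS; rewrite dim_vline shift_neq0.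
have := limg_ker_dim (load_map p [set~ e]) fullv; rewrite capfv dim_flex.
have := load_img_le p [set~ e] fullv; rewrite cardsC1 cE.
have := vertex_gt0 G; move: #|vertex G| (\dim _) (\dim _) => n k l /=; lia.
Qed.

Lemma constraint_pairing p e m c : strict (diff p (edge_data e)) ->
  ycol p (@edge_data G) e = c -> constraint p e m = 0 ->
  pairing (fun v => m (v, c)) (rows R c (@edge_data G) e) = 0.
Proof.
rewrite /constraint /ycol => -> ->.
by rewrite /rows pairing_row.
Qed.

(** The count forces classes of sizes |V| - 1 and |V|. The second spans everything, so second
    coordinates vanish; the first spans a complement of any [dl v0] and annihilates constants, so
    first coordinates are constant. *)
Lemma realizes_rigid p : Z2Cs_q_tight G ->
  realizes (@edge_data G) [set: edge G] p -> sym_inf_rigid (@dedge G) p.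
Proof.
move=> [[_ cE] _] [hst hd]; apply/rigidP/subvP => m /load_kerP hm.
have /card_gt0P[v0 _] := vertex_gt0 G.
have hW : within [set: vertex G] (@edge_data G) [set: edge G].
  by move=> e _; rewrite !inE.
have W0 : [set: vertex G] != set0 by apply/set0Pn; exists v0; rewrite inE.
pose C c := class [set: edge G] (ycol p (@edge_data G)) c.
have e1 : #|C false| = (#|vertex G| - 1)%N /\ #|C true| = #|vertex G|.
  have := class_false_lt hW hd W0; have := class_le true hW hd.
  have := card_class [set: edge G] (ycol p (@edge_data G)).
  by rewrite !cardsT in cE *; rewrite -/(C false) -/(C true); lia.
have hp c x : x \in sp (rows R c (@edge_data G)) (C c) ->
    pairing (fun v => m (v, c)) x = 0.
  apply: pairing_sp => e; rewrite class_mem => /andP[_ /eqP ec].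
  by apply: (constraint_pairing (hst e _) ec); rewrite ?hm ?inE.
have hT v : m (v, true) = 0.
  rewrite -(pairing_dl (fun v => m (v, true)) v); apply: hp.
  have /eqP dT := hd true; rewrite -/(C true) in dT.
  suff -> : sp (rows R true (@edge_data G)) (C true) = fullv by rewrite memvf.
  apply/eqP; rewrite eqEdim subvf /= full_dl dim_sp_dl cardsT.
  by rewrite -e1.2 dT.
have hF v : m (v, false) = m (v0, false).
  have /eqP dF := hd false; rewrite -/(C false) in dF.
  set U := sp (rows R false (@edge_data G)) (C false) in dF.
  have ones x : x \in U -> pairing (fun _ => 1) x = 0.
    by apply: pairing_sp => e _; rewrite /rows pairing_row sg_false mul1r subrr.
  have n0 : dl R v0 \notin U.
    apply/negP => /ones; rewrite pairing_dl => /eqP; rewrite oner_eq0 //.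
  have full : (<[dl R v0]> + U)%VS = fullv.
    apply/eqP; rewrite eqEdim subvf /= dimv_add_line n0 full_dl dim_sp_dl cardsT.
    by rewrite dF e1.1; have := vertex_gt0 G; lia.
  have : dl R v \in (<[dl R v0]> + U)%VS by rewrite full memvf.
  case/memv_addP => _ /vlineP[k ->] [x xU ex].
  have := congr1 (pairing (fun _ => 1)) ex.
  rewrite pairingD pairingZ !pairing_dl ones // mulr1 addr0 => k1.
  have := congr1 (pairing (fun w => m (w, false))) ex.
  by rewrite pairingD pairingZ !pairing_dl (hp false) // -k1 mul1r addr0.
apply/vlineP; exists (m (v0, false)); apply/ffunP => -[v []]; rewrite !ffunE /=.
  by rewrite hT scaler0.
by rewrite hF [_ *: _]mulr1.
Qed.

Lemma realizes_configuration p :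
  realizes (@edge_data G) [set: edge G] p -> configuration p.
Proof.
move=> [hst _] x y [e [g hg]] exy.
have hs : strict (linear_part g (diff p (edge_data e))).
  by rewrite strict_linear hst // inE.
have := strict_neq0 hs; rewrite -dposition_edge subr_eq0.
by case: hg => -[ex ey]; rewrite -ex -ey exy eqxx.
Qed.

Lemma sym_extend_shift_motion p : sym_inf_motion (@dedge G) p (sym_extend shift).
Proof. by apply: sym_extend_motion => e; apply: constraint_shift. Qed.

Lemma rigid_has_dim p : sym_inf_rigid (@dedge G) p ->
  has_dim (sym_inf_motion (@dedge G) p) 1.
Proof.
move=> /rigidP/subvP h; have /card_gt0P[v _] := vertex_gt0 G.
exists (fun _ => sym_extend shift); split.
- by move=> _; apply: sym_extend_shift_motion.
- move=> c /(_ (1%g, v)); rewrite big_ord1 sym_extend_shift => hc i; rewrite (ord1 i).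
  by have := congr1 (fun z : 'rV[R]_2 => z 0 0) hc; rewrite !mxE /= mulr1.
move=> u [hu su]; have eu := restrictK su.
have /vlineP[k ek] : restrict u \in <[shift]>%VS.
  apply/h/load_kerP => e _; apply: motion_constraint => x y xy.
  by rewrite -!eu; apply: hu.
exists (fun _ => k) => x; rewrite big_ord1 eu ek.
apply: vec2P; rewrite !mxE /sym_extend ?linear0E ?linear1E !mxE /= !ffunE /= //.
by rewrite scaler0 !mulr0.
Qed.

Lemma low_dim_rigid p n : has_dim (sym_inf_motion (@dedge G) p) n -> (n <= 1)%N ->
  sym_inf_rigid (@dedge G) p.
Proof.
move=> [b [_ _ hb]] n1 u hu.
have /card_gt0P[v _] := vertex_gt0 G.
have [c hc] := hb _ (sym_extend_shift_motion p); have [d hd] := hb _ hu.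
have one0 : vec2 1 0 != 0 :> 'rV[R]_2.
  by apply/eqP => /rowP/(_ 0); rewrite !mxE /= => /eqP; rewrite oner_eq0.
case: n n1 b c d hc hd {hb} => [_|[_|//]] b c d hc hd.
  by have := hc (1%g, v); rewrite big_ord0 sym_extend_shift => /eqP; rewrite (negPf one0).
have c0 : c 0 != 0.
  have := hc (1%g, v); rewrite big_ord1 sym_extend_shift => e.
  by apply: contraNneq one0 => z; rewrite e z scale0r.
exists ((d 0 / c 0) *: vec2 1 0) => x; have := hc x; rewrite hd !big_ord1 sym_extend_shift.
by move=> ->; rewrite scalerA divfK.
Qed.

(** The realization found is rigid with a one-dimensional space of motions, so regularity bounds the
    dimension at [p] by 1. The translation already fills that dimension, hence rigidity. *)
Lemma tight_min_rigid p : regular p -> Z2Cs_q_tight G -> min_sym_inf_rigid p.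
Proof.
move=> [_ [n hn hmin]] tG.
have [col hd] := tight_coloring R tG.
have hW : within [set: vertex G] (@edge_data G) [set: edge G].
  by move=> e _; rewrite !inE.
have [p' hp'] := simple_realizable (@edge_data_simple G) hW hd.
have n1 := hmin _ _ (realizes_configuration hp')
  (rigid_has_dim (realizes_rigid tG hp')).
split; first exact: low_dim_rigid hn n1.
move=> e; apply: tight_not_rigid_minus.
by have [[_ cE] _] := tG; rewrite !cardsT in cE; lia.
Qed.

End Motions.

(** * Necessity of the counts *)

Section Necessity.
Variables (R : realType) (G : gain_graph).
Implicit Types (E F : {set edge G}) (e f : edge G) (v w : vertex G).
Implicit Types (p : vertex G -> 'rV[R]_2) (X : {set vertex G}).

Local Notation flex := {ffun vertex G * bool -> R^o}.
Local Notation load := {ffun edge G -> R^o}.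
Implicit Types m : flex.

(** [b w] is the sign of the net gain of any walk from [v0] to [w], well defined because closed
    walks are translations, and 0 where no walk arrives. *)
Lemma periodic_potential E v0 :
  (forall s, is_walk E v0 s v0 -> is_translation (net_gain s)) ->
  exists b : vertex G -> R, [/\ b v0 = 1,
    forall w, b w != 0 -> exists s, is_walk E v0 s w &
    {in E, forall e, b (src e) = sg R true (gain e) * b (tgt e)}].
Proof.
move=> h; pose b w := if pselect (exists s, is_walk E v0 s w) is left ex
  then sg R true (net_gain (projT1 (cid ex))) else 0.
have bP s w : is_walk E v0 s w -> b w = sg R true (net_gain s).
  rewrite /b => hs; case: pselect => [ex|[]]; last by exists s.
  case: (cid ex) => s' hs' /=; have [t ht et] := walk_flip hs.
  have := h _ (walk_cat hs' ht); rewrite net_gain_cat et /is_translation => e.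
  have : sg R true (net_gain s' * (net_gain s)^-1)%g = 1 by rewrite /sg e.
  rewrite sgM sgV => e1; rewrite -[LHS]mulr1 -(sg_sqr R true (net_gain s)).
  by rewrite mulrA e1 mul1r.
exists b; split.
- by rewrite (bP [::]) //= sg1.
- by move=> w; rewrite /b; case: pselect => // _; rewrite eqxx.
move=> e eE; have [[s hs]|n1] := pselect (exists s, is_walk E v0 s (src e)).
  have ht : is_walk E v0 (s ++ [:: (e, true)]) (tgt e) by apply: walk_cat hs _.
  rewrite (bP _ _ hs) (bP _ _ ht) net_gain_cat /= mulg1 sgM mulrCA.
  by rewrite sg_sqr mulr1.
have n2 : ~ exists s, is_walk E v0 s (tgt e).
  by case=> s hs; apply: n1; exists (s ++ [:: (e, false)]); apply: walk_cat hs _.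
by rewrite /b; do 2![case: pselect => //]; rewrite mulr0.
Qed.

Definition cut X m : flex := [ffun vb => if vb.1 \in X then m vb else 0].

Lemma cut_in X m : cut X m \in sp (@dl R _) (setX X [set: bool]).
Proof.
by apply: mem_sp_dl => -[v c]; rewrite in_setX inE andbT ffunE /= => /negPf ->.
Qed.

Lemma constraint_cut p X e m : src e \in X -> tgt e \in X ->
  constraint p e (cut X m) = constraint p e m.
Proof. by move=> h1 h2; rewrite /constraint !ffunE /= h1 h2. Qed.

Definition isolating p m e : Prop :=
  (forall f, f != e -> constraint p f m = 0) /\ constraint p e m != 0.

(** A nontrivial motion that appears when [e] is removed must violate [e], by rigidity of the whole
    framework. *)
Lemma min_rigid_isolating p e : min_sym_inf_rigid p -> exists m, isolating p m e.
Proof.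
move=> [/rigidP/subvP h /(_ e) n].
have [m /load_kerP hm ms] : exists2 m, m \in lker (load_map p [set~ e]) & m \notin <[shift R G]>%VS.
  by apply/subvPn/negP => /rigid_minusP.
have hm' f : f != e -> constraint p f m = 0 by move=> fe; apply: hm; rewrite !inE.
exists m; split=> //; apply: contraNneq ms => me; apply/h/load_kerP => f _.
by case: (eqVneq f e) => [->|/hm'].
Qed.

(** Cut down to [X], the isolating flexes still isolate the edges of [E], so flexes supported on [X]
    map onto all loads of [E]. Rank-nullity then leaves at most 2|X| - |E| for the kernel, which
    contains [K]. *)
Lemma isolating_count p X E (K : {vspace flex}) :
  (forall e, exists m, isolating p m e) -> is_subgraph X E ->
  (K <= sp (@dl R _) (setX X [set: bool]))%VS -> (K <= lker (load_map p E))%VS ->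
  (#|E| + \dim K <= 2 * #|X|)%N.
Proof.
move=> hm hX KU Kk; set U := sp _ _ in KU.
have dU : \dim U = (2 * #|X|)%N by rewrite dim_sp_dl cardsX cardsT card_bool mulnC.
have := limg_ker_dim (load_map p E) U; rewrite dU => <-; rewrite addnC.
apply: leq_add; first by apply: dimvS; rewrite subv_cap KU.
rewrite -(dim_sp_dl R E); apply/dimvS/sp_subP => e eE; have [m [m0 me]] := hm e.
have [se te] := hX e eE.
have <- : (constraint p e m)^-1 *: load_map p E (cut X m) = dl R e.
  apply/ffunP => f; have sE (y z : R) : y *: (z : R^o) = y * z by [].
  rewrite [LHS]ffunE sE load_mapE ffunE; case: ifP => fE.
    have [sf tf] := hX f fE; rewrite constraint_cut //.
    by case: (eqVneq f e) => [->|/m0 ->]; rewrite ?mulVf ?mulr0.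
  by case: eqVneq fE => [->|_ _]; rewrite ?eE // mulr0.
by apply/memvZ/memv_img/cut_in.
Qed.

Lemma cut_shift_ker p X E : is_subgraph X E ->
  cut X (shift R G) \in lker (load_map p E).
Proof.
move=> hX; apply/load_kerP => e /hX[h1 h2].
by rewrite constraint_cut // constraint_shift.
Qed.

Lemma min_rigid_tight p : min_sym_inf_rigid p -> Z2Cs_q_tight G.
Proof.
move=> hp; have hm e := min_rigid_isolating e hp.
have cut_neq0 X v : v \in X -> cut X (shift R G) != 0.
  move=> vX; apply/eqP => /ffunP/(_ (v, false)); rewrite !ffunE /= vX => /eqP.
  by rewrite oner_eq0.
have line_count X E : is_subgraph X E -> X != set0 -> (#|E| + 1 <= 2 * #|X|)%N.
  move=> hX /set0Pn[v vX].
  have := isolating_count (K := <[cut X (shift R G)]>%VS) hm hX.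
  rewrite dim_vline (cut_neq0 _ _ vX); apply; rewrite -memvE ?cut_in //.
  exact: cut_shift_ker.
have nonempty X E : is_subgraph X E -> (1 <= #|E|)%N -> exists2 v, v \in X & exists2 e, e \in E & v = src e.
  by move=> hX /card_gt0P[e eE]; have [h1 _] := hX e eE; exists (src e) => //; exists e.
have /card_gt0P[v0 _] := vertex_gt0 G.
split; first split.
- move=> X E hX _ _ /(nonempty X E hX)[v vX _].
  have X0 : X != set0 by apply/set0Pn; exists v.
  by have := line_count X E hX X0; lia.
- have hT : is_subgraph [set: vertex G] [set: edge G] by move=> e _; rewrite !inE.
  have T0 : [set: vertex G] != set0 by apply/set0Pn; exists v0; rewrite inE.
  have le1 := line_count _ _ hT T0.
  (* Conversely the kernel has dimension at most 1, which requires at least 2|V| - 1 constraints. *)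
  have [/rigidP/dimvS + _] := hp; rewrite dim_vline shift_neq0 => le2.
  have := limg_ker_dim (load_map p [set: edge G]) fullv; rewrite capfv dim_flex.
  have := load_img_le p [set: edge G] fullv; move: le1 le2.
  rewrite !cardsT; move: #|vertex G| #|edge G| (\dim _) (\dim _) => n k a b /=; lia.
move=> X0 E0 h0 pp X E hX XX EE E1.
have [v vX [e eE ve]] := nonempty X E hX E1.
have EEw s a w : is_walk E a s w -> is_walk E0 a s w.
  by elim: s a => //= x s IH a [h1 h2 /IH h3]; split=> //; apply: (subsetP EE).
have [|b [b1 b2 b3]] := @periodic_potential E v.
  move=> s hs; apply: (pp v (subsetP XX _ vX)); apply: gen_base; exists s => //.
  exact: EEw.
(* Walks in [E] starting at [v] stay in [X]. *)
have bX w : w \notin X -> b w = 0.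
  move=> wX; apply/eqP; apply: contraNT wX => /b2[s hs].
  elim: s (v) vX hs => [|x s IH] a aX /=; first by move=> <-.
  case=> xE xs; apply: IH; have [h1 h2] := hX _ xE.
  by rewrite /step_tgt; case: x.2.
(* The sign potential in the second coordinate is a second solution on [X], independent of the
   translation; it lowers the bound by one more. *)
pose y : flex := [ffun vb => if vb.2 then b vb.1 else 0].
set x := cut X (shift R G).
have yU : y \in sp (@dl R _) (setX X [set: bool]).
  apply: mem_sp_dl => -[w []]; rewrite in_setX inE andbT ffunE //=; exact: bX.
have yk : y \in lker (load_map p E).
  apply/load_kerP => f fE; rewrite /constraint; case: ifP => // _; rewrite !ffunE /=.
  by case: ydom; [rewrite b3 // subrr | rewrite mulr0 subrr].
have xy : y \notin <[x]>%VS.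
  apply/negP => /vlineP[k ek].
  have := congr1 (fun z : flex => z (v, true)) ek.
  rewrite !ffunE /= vX b1 => /eqP.
  by rewrite [_ *: _]mulr0 oner_eq0.
have := isolating_count (K := (<[y]> + <[x]>)%VS) hm hX.
rewrite dimv_add_line xy dim_vline (cut_neq0 _ _ vX) !subv_add -!memvE yU yk cut_in.
rewrite cut_shift_ker // => /(_ isT isT) /=; lia.
Qed.

End Necessity.

Theorem theorem10p1 (R : realType) (G : gain_graph) (p : vertex G -> 'rV[R]_2)
    (p_regular : regular p) :
  min_sym_inf_rigid p <-> Z2Cs_q_tight G.
Proof.
split; first exact: min_rigid_tight.
exact: tight_min_rigid.
Qed.
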